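(* Let $h\in\mathbb{C}$ with $\operatorname{Im}h>0$. Then the operator $M_h$ in $\mathcal{H}=\mathcal{L}^2(\mathbb{R}_-)\oplus\mathcal{L}_{q}^{2}(q^{\mathbb{Z}};\mathbb{C}^{2})\oplus\mathcal{L}^2(\mathbb{R}_+)$ is a selfadjoint dilation of the operator $T_h$ in $\mathcal{L}_{q}^{2}(q^{\mathbb{Z}};\mathbb{C}^{2})$.
   Context: Let $0<q<1$ and $q^{\mathbb{Z}}=\{q^n:n\in\mathbb{Z}\}$. For a complex function $f$ on $q^{\mathbb{Z}}$ put $D_qf(t)=\frac{f(qt)-f(t)}{t(q-1)}$ and $D_{q^{-1}}f(t)=\frac{f(t)-f(q^{-1}t)}{t(1-q^{-1})}$, $t\in q^{\mathbb{Z}}$. The Jackson integral over $(0,\infty)$ is $\int_0^\infty f(t)\,d_qt=(1-q)\sum_{n\in\mathbb{Z}}q^nf(q^n)$. A function $f$ on $q^{\mathbb{Z}}$ is $q$-regular at zero if $f(0):=\lim_{n\to\infty}f(q^n)$ exists and is finite. $\mathcal{L}_{q}^{2}(q^{\mathbb{Z}};\mathbb{C}^{2})$ is the Hilbert space of functions $f:q^{\mathbb{Z}}\to\mathbb{C}^2$ with $\int_0^\infty\|f(t)\|_{\mathbb{C}^2}^2\,d_qt<\infty$ and inner product $(f,g)=\int_0^\infty(f(t),g(t))_{\mathbb{C}^2}\,d_qt$. Let $p,r:q^{\mathbb{Z}}\to\mathbb{R}$ be $q$-regular at zero with $p(t)\ne0$, $r(t)\ne0$ for all $t\in q^{\mathbb{Z}}$.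 For $y=(y_1,y_2)^T$ set $$(l_1y)(t)=\begin{pmatrix}-\frac1q D_{q^{-1}}y_2(t)+p(t)y_1(t)\\ D_qy_1(t)+r(t)y_2(t)\end{pmatrix}.$$ $D_{max}$ is the set of all $y=(y_1,y_2)^T\in\mathcal{L}_{q}^{2}(q^{\mathbb{Z}};\mathbb{C}^{2})$ such that $y_1,y_2$ are $q$-regular at zero and $l_1y\in\mathcal{L}_{q}^{2}(q^{\mathbb{Z}};\mathbb{C}^{2})$; for such $y$, $y_i(0)=\lim_{n\to\infty}y_i(q^n)$. Put $[y,z](t)=y_1(t)\overline{z_2(q^{-1}t)}-\overline{z_1(t)}\,y_2(q^{-1}t)$. For this system the limit-point case holds at infinity: $\lim_{n\to\infty}[y,z](q^{-n})=0$ for all $y,z\in D_{max}$. $T_h$ is the operator with domain $D(T_h)=\{y\in D_{max}:y_2(0)-h\,y_1(0)=0\}$ and $T_hy=l_1y$. $\mathbb{R}_-=(-\infty,0]$, $\mathbb{R}_+=[0,\infty)$; $\mathcal{W}_2^1(\mathbb{R}_\mp)$ is the Sobolev space of locally absolutely continuous $f\in\mathcal{L}^2(\mathbb{R}_\mp)$ with $f'\in\mathcal{L}^2(\mathbb{R}_\mp)$. Let $\delta>0$, $\delta^2=2\operatorname{Im}h$. $M_h$ is the selfadjoint operator in $\mathcal{H}$ with domain consisting of all $\langle\phi_-,y,\phi_+\rangle$ with $\phi_\mp\in\mathcal{W}_2^1(\mathbb{R}_\mp)$, $y\in D_{max}$, $y_2(0)-h\,y_1(0)=\delta\phi_-(0)$,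 $y_2(0)-\overline{h}\,y_1(0)=\delta\phi_+(0)$, acting by $M_h\langle\phi_-,y,\phi_+\rangle=\langle i\phi_-',\,l_1y,\,i\phi_+'\rangle$. Let $U_h(s)=\exp(iM_hs)$, $s\in\mathbb{R}$, let $P_1:\mathcal{H}\to\mathcal{L}_{q}^{2}(q^{\mathbb{Z}};\mathbb{C}^{2})$, $P_1\langle\phi_-,y,\phi_+\rangle=y$, and $P_2:\mathcal{L}_{q}^{2}(q^{\mathbb{Z}};\mathbb{C}^{2})\to\mathcal{H}$, $P_2y=\langle0,y,0\rangle$. Put $Z_h(s)=P_1U_h(s)P_2$, $s\ge0$. ''$M_h$ is a selfadjoint dilation of $T_h$'' means that $\{Z_h(s)\}_{s\ge0}$ is a strongly continuous contraction semigroup whose generator $B_hy=\lim_{s\to0^+}(is)^{-1}(Z_h(s)y-y)$, with domain all $y$ for which the limit exists, equals $T_h$ (including equality of domains). *)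

(* Defs.v *)
From HB Require Import structures.
From mathcomp Require Import all_boot all_order all_algebra.
From mathcomp Require Import complex ring_quotient.
From mathcomp Require Import all_classical all_reals all_analysis measurable_realfun.
From mathcomp Require Import ring lra.

Set Implicit Arguments.
Unset Strict Implicit.
Unset Printing Implicit Defensive.

Import Order.TTheory GRing.Theory Num.Theory.
Import numFieldNormedType.Exports.

Local Open Scope classical_set_scope.
Local Open Scope complex_scope.
Local Open Scope ring_scope.

Local Notation modulus := ComplexField.Normc.normc.

Section ComplexL2.
Variables (R : realType) (I : interval R).
Local Notation C := R[i].
Local Notation mu := (@lebesgue_measure R).

Definition sqr_integrable (f : R -> C) : Prop :=
  [/\ measurable_fun [set` I] (fun x => complex.Re (f x)),
      measurable_fun [set` I] (fun x => complex.Im (f x)) &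
      (\int[mu]_(x in [set` I]) (modulus (f x) ^+ 2)%:E < +oo)%E].

Definition L2fun : {pred (R -> C)} := mem [set f | sqr_integrable f].

Lemma modulus_sqr (z : C) :
  modulus z ^+ 2 = complex.Re z ^+ 2 + complex.Im z ^+ 2.
Proof.
by case: z => a b; rewrite /= sqr_sqrtr // addr_ge0 // sqr_ge0.
Qed.

Lemma modulus_sqr_ge0 (z : C) : 0 <= modulus z ^+ 2.
Proof. by rewrite sqr_ge0. Qed.

Lemma modulus_sqrD (w z : C) :
  modulus (w + z) ^+ 2 <= 2 * modulus w ^+ 2 + 2 * modulus z ^+ 2.
Proof.
rewrite !modulus_sqr !raddfD /=.
move: (complex.Re w) (complex.Im w) (complex.Re z) (complex.Im z) => a b c d.
rewrite -subr_ge0.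
have -> : 2 * (a ^+ 2 + b ^+ 2) + 2 * (c ^+ 2 + d ^+ 2)
    - ((a + c) ^+ 2 + (b + d) ^+ 2) = (a - c) ^+ 2 + (b - d) ^+ 2 :> R.
  by rewrite !mulr_natl; ring.
by rewrite addr_ge0 ?sqr_ge0.
Qed.

Lemma modulus_sqrM (w z : C) :
  modulus (w * z) ^+ 2 = modulus w ^+ 2 * modulus z ^+ 2.
Proof.
rewrite !modulus_sqr; case: w => a b; case: z => c d /=.
by ring.
Qed.

Lemma measurable_modulus_sqr (f : R -> C) :
  measurable_fun [set` I] (fun x => complex.Re (f x)) ->
  measurable_fun [set` I] (fun x => complex.Im (f x)) ->
  measurable_fun [set` I] (EFin \o (fun x => modulus (f x) ^+ 2)%R).
Proof.
move=> mr mi; apply/measurable_EFinP.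
rewrite [X in measurable_fun _ X](_ : _ = fun x =>
  complex.Re (f x) ^+ 2 + complex.Im (f x) ^+ 2); last first.
  by apply/funext => x; rewrite modulus_sqr.
by apply: measurable_funD; apply: measurable_funX.
Qed.

Lemma L2fun_submod_closed : submod_closed L2fun.
Proof.
split.
  rewrite inE; split; [exact: measurable_cst|exact: measurable_cst|].
  rewrite integral0_eq // => x _; rewrite modulus_sqr /=.
  by rewrite expr0n addr0.
move=> a f g; rewrite !inE => -[fr fi f2] [gr gi g2].
have mr : measurable_fun [set` I] (fun x => complex.Re ((a *: f + g) x)).
  rewrite [X in measurable_fun _ X](_ : _ = fun x =>
    complex.Re a * complex.Re (f x) - complex.Im a * complex.Im (f x)
    + complex.Re (g x)); last first.
    apply/funext => x; rewrite (_ : (a *: f + g) x = a * f x + g x) //.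
    by case: (a) => ? ?; case: (f x) => ? ?; case: (g x).
  apply: measurable_funD => //; apply: measurable_funB;
    by apply: measurable_funM.
have mi : measurable_fun [set` I] (fun x => complex.Im ((a *: f + g) x)).
  rewrite [X in measurable_fun _ X](_ : _ = fun x =>
    complex.Re a * complex.Im (f x) + complex.Im a * complex.Re (f x)
    + complex.Im (g x)); last first.
    apply/funext => x; rewrite (_ : (a *: f + g) x = a * f x + g x) //.
    by case: (a) => ? ?; case: (f x) => ? ?; case: (g x).
  apply: measurable_funD => //; apply: measurable_funD;
    by apply: measurable_funM.
split=> //.
pose k := modulus a ^+ 2.
have mI : measurable [set` I] by exact: measurable_itv.
have k0 : (0 <= 2 * k)%R by rewrite mulr_ge0 // modulus_sqr_ge0.
have mf2 := measurable_modulus_sqr fr fi.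
have mg2 := measurable_modulus_sqr gr gi.
apply: (@le_lt_trans _ _ (\int[mu]_(x in [set` I])
    ((2 * k)%:E * (modulus (f x) ^+ 2)%:E + 2%:E * (modulus (g x) ^+ 2)%:E))%E).
  apply: ge0_le_integral => //.
  - by move=> x _; rewrite lee_fin modulus_sqr_ge0.
  - exact: measurable_modulus_sqr.
  - by apply: emeasurable_funD; exact: measurable_funeM.
  - move=> x _; rewrite -!EFinM -EFinD lee_fin.
    by rewrite (le_trans (modulus_sqrD _ _)) // modulus_sqrM mulrA.
rewrite ge0_integralD //=.
- rewrite !ge0_integralZl //=.
  + by rewrite lte_add_pinfty // lte_mul_pinfty.
  + by move=> x _; rewrite lee_fin modulus_sqr_ge0.
  + by move=> x _; rewrite lee_fin modulus_sqr_ge0.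
- by move=> x _; rewrite mule_ge0 // lee_fin ?modulus_sqr_ge0.
- exact: measurable_funeM.
- by move=> x _; rewrite mule_ge0 // lee_fin ?modulus_sqr_ge0.
- exact: measurable_funeM.
Qed.

HB.instance Definition _ :=
  GRing.isSubmodClosed.Build C (R -> C) L2fun L2fun_submod_closed.

Record L2rep := MkL2rep { L2rep_val :> R -> C; _ : L2rep_val \in L2fun }.
HB.instance Definition _ := [isSub for L2rep_val].
HB.instance Definition _ := [Choice of L2rep by <:].
HB.instance Definition _ := [SubChoice_isSubLmodule of L2rep by <:].

Definition L2null : {pred L2rep} :=
  mem [set f : L2rep | {ae mu, forall x, x \in I -> f x = 0}].

Lemma L2null_submod_closed : submod_closed L2null.
Proof.
split; first by rewrite inE; apply/aeW.
move=> a f g; rewrite !inE /= => f0 g0.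
have F := @ae_filter_ringOfSetsType _ _ R mu.
apply: filterS2 f0 g0 => x fx gx xI.
rewrite -[LHS]/(a * f x + g x).
by rewrite fx // gx // mulr0 addr0.
Qed.

HB.instance Definition _ :=
  GRing.isSubmodClosed.Build C L2rep L2null L2null_submod_closed.

Local Open Scope quotient_scope.

(* Classes of square integrable functions I -> C modulo equality almost
   everywhere on I. *)
Definition L2 : Type := {ideal_quot L2null}.
HB.instance Definition _ := GRing.Zmodule.on L2.
HB.instance Definition _ := ZmodQuotient.on L2.

Definition L2scale (a : C) (u : L2) : L2 := \pi_L2 (a *: repr u).

Lemma pi_L2scale (a : C) (f : L2rep) : \pi_L2 (a *: f) = L2scale a (\pi_L2 f).
Proof.
apply/eqP; rewrite -Quotient.idealrBE -scalerBr rpredZ //.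
by rewrite Quotient.idealrBE reprK.
Qed.

Lemma pi_L2D (f g : L2rep) : \pi_L2 (f + g) = \pi_L2 f + \pi_L2 g.
Proof. exact: Quotient.pi_add. Qed.

Lemma L2scaleA (a b : C) u : L2scale a (L2scale b u) = L2scale (a * b) u.
Proof.
elim/quotW: u => f.
by rewrite -(pi_L2scale b f) -(pi_L2scale a) -(pi_L2scale _ f) scalerA.
Qed.

Lemma L2scale1 : left_id 1 L2scale.
Proof. by elim/quotW => f; rewrite -(pi_L2scale 1 f) scale1r. Qed.

Lemma L2scaleDr : right_distributive L2scale +%R.
Proof.
move=> a; elim/quotW => f; elim/quotW => g.
rewrite -(pi_L2D f g) -(pi_L2scale a (f + g)) scalerDr pi_L2D.
by rewrite (pi_L2scale a f) (pi_L2scale a g).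
Qed.

Lemma L2scaleDl u : {morph L2scale^~ u : a b / a + b}.
Proof.
elim/quotW: u => f a b.
by rewrite -(pi_L2scale (a + b) f) scalerDl pi_L2D !(pi_L2scale _ f).
Qed.

HB.instance Definition _ := GRing.Zmodule_isLmodule.Build C L2
  L2scaleA L2scale1 L2scaleDr L2scaleDl.

(* The integrals do not depend on the choice of the representatives. *)
Definition dotL2 (u v : L2) : C :=
  let w x := repr u x * conjc (repr v x) in
  (\int[mu]_(x in [set` I]) complex.Re (w x))%:C
  + 'i%C * (\int[mu]_(x in [set` I]) complex.Im (w x))%:C.
End ComplexL2.

Section Sobolev.
Variables (R : realType) (I : interval R).
Local Notation C := R[i].
Local Notation mu := (@lebesgue_measure R).

(* The seq s lists the endpoints of finitely many nonoverlapping subintervals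
   of [a, b]. *)
Definition abs_continuous (a b : R) (f : R -> C) : Prop :=
  forall e : R, 0 < e -> exists2 d : R, 0 < d &
    forall s : seq (R * R),
      all (fun J => (a <= J.1) && (J.1 <= J.2) && (J.2 <= b)) s ->
      pairwise (fun J K => (J.2 <= K.1) || (K.2 <= J.1)) s ->
      \sum_(J <- s) (J.2 - J.1) < d ->
      \sum_(J <- s) modulus (f J.2 - f J.1) < e.

Definition locally_abs_continuous (f : R -> C) : Prop :=
  forall a b, a \in I -> b \in I -> a <= b -> abs_continuous a b f.

(* u belongs to the Sobolev space on I, phi is its locally absolutely
   continuous representative, and du is the class of the derivative. *)
Definition sobolev (phi : R -> C) (u du : L2 I) : Prop :=
  [/\ locally_abs_continuous phi,
      {ae mu, forall x, x \in I -> repr u x = phi x} &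
      {ae mu, forall x, x \in I ->
         is_derive x (1 : R) (fun t => complex.Re (phi t))
           (complex.Re (repr du x)) /\
         is_derive x (1 : R) (fun t => complex.Im (phi t))
           (complex.Im (repr du x))}].
End Sobolev.

(* A function f on q^Z is represented by n |-> f (q ^ n), n : int; thus
   t = q ^ n, q t and q^-1 t correspond to n, n + 1 and n - 1. *)

Definition q_regular (K : numFieldType) (f : int -> K) : Prop :=
  cvgn (fun k : nat => f k%:Z : K^o).

Definition at_zero (K : numFieldType) (f : int -> K) : K :=
  limn (fun k : nat => f k%:Z : K^o).

Section QCalculus.
Variables (R : realType) (q : R).
Local Notation C := R[i].

Definition Dq (f : int -> C) (n : int) : C :=
  (f (n + 1) - f n) / (q ^ n * (q - 1))%:C.

Definition Dqinv (f : int -> C) (n : int) : C :=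
  (f n - f (n - 1)) / (q ^ n * (1 - q^-1))%:C.

(* The bilateral series is the sum of its two one-sided halves. *)
Definition jackson (f : int -> C) : C :=
  let g n : C^o := (q ^ n)%:C * f n in
  (1 - q)%:C * (limn (series (fun k : nat => g k%:Z)) +
                limn (series (fun k : nat => g (- k.+1%:Z)))).

(* The Jackson integral of a nonnegative function, possibly infinite. *)
Definition jackson_ge0 (f : int -> R) : \bar R :=
  ((1 - q)%:E * \esum_(n in [set: int]) (q ^ n * f n)%:E)%E.

Definition Lq2fun of 0 < q < 1 : {pred (int -> C * C)} :=
  mem [set f | (jackson_ge0
    (fun n => modulus (f n).1 ^+ 2 + modulus (f n).2 ^+ 2)%R < +oo)%E].

Hypothesis q01 : 0 < q < 1.

Lemma esumZ_le (c : R) (F : int -> \bar R) : 0 <= c -> (forall n, 0 <= F n)%E ->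
  (\esum_(n in [set: int]) (c%:E * F n) <= c%:E * \esum_(n in [set: int]) F n)%E.
Proof.
move=> c0 F0; apply: ge_ereal_sup => _ [A [finA _] <-].
rewrite -ge0_mule_fsumr //; apply: lee_wpmul2l; first by rewrite lee_fin.
by apply: ereal_sup_ubound; exists A.
Qed.

Lemma Lq2fun_submod_closed : submod_closed (Lq2fun q01).
Proof.
have [q0 q1] := andP q01.
have q0' n : 0 <= q ^ n by rewrite exprz_ge0 // ltW.
have m0 (z : C * C) : 0 <= modulus z.1 ^+ 2 + modulus z.2 ^+ 2.
  by rewrite addr_ge0 // modulus_sqr_ge0.
split.
  rewrite inE /= /jackson_ge0 esum1 ?mule0 // => n _.
  by rewrite expr0n /= addr0 sqrtr0 expr0n /= addr0 mulr0.
move=> a f g; rewrite !inE /= => f2 g2.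
set k := modulus a ^+ 2.
have k0 : 0 <= 2 * k by rewrite mulr_ge0 // modulus_sqr_ge0.
pose F n := (q ^ n * (modulus (f n).1 ^+ 2 + modulus (f n).2 ^+ 2))%:E.
pose G n := (q ^ n * (modulus (g n).1 ^+ 2 + modulus (g n).2 ^+ 2))%:E.
have F0 n : (0 <= F n)%E by rewrite lee_fin mulr_ge0.
have G0 n : (0 <= G n)%E by rewrite lee_fin mulr_ge0.
apply: (@le_lt_trans _ _ ((1 - q)%:E *
  \esum_(n in [set: int]) ((2 * k)%:E * F n + 2%:E * G n))%E).
  apply: lee_wpmul2l; first by rewrite lee_fin subr_ge0 ltW.
  apply: le_esum => n _.
  rewrite -!EFinM -EFinD lee_fin.
  have -> : 2 * k * (q ^ n * (modulus (f n).1 ^+ 2 + modulus (f n).2 ^+ 2)) +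
      2 * (q ^ n * (modulus (g n).1 ^+ 2 + modulus (g n).2 ^+ 2)) =
      q ^ n * ((2 * (k * modulus (f n).1 ^+ 2) + 2 * modulus (g n).1 ^+ 2) +
      (2 * (k * modulus (f n).2 ^+ 2) + 2 * modulus (g n).2 ^+ 2)) :> R.
    by ring.
  rewrite ler_wpM2l // -!modulus_sqrM.
  exact: lerD (modulus_sqrD (a * (f n).1) (g n).1)
              (modulus_sqrD (a * (f n).2) (g n).2).
rewrite esumD; [|by move=> n _; rewrite mule_ge0|by move=> n _; rewrite mule_ge0].
have E0 (H : int -> \bar R) : (forall n, 0 <= H n)%E ->
    (0 <= \esum_(n in [set: int]) H n)%E by move=> H0; exact: esum_ge0.
rewrite ge0_muleDr; [|by apply: E0 => n; rewrite mule_ge0..].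
have c0 : 0 <= 1 - q by rewrite subr_ge0 ltW.
apply: (@le_lt_trans _ _ ((2 * k)%:E * jackson_ge0 (fun n =>
    modulus (f n).1 ^+ 2 + modulus (f n).2 ^+ 2)%R + 2%:E * jackson_ge0 (fun n =>
    modulus (g n).1 ^+ 2 + modulus (g n).2 ^+ 2)%R)%E).
  rewrite /jackson_ge0 !(muleCA _ (1 - q)%:E).
  by apply: leeD; (apply: lee_wpmul2l; first by rewrite lee_fin);
    exact: esumZ_le.
by rewrite lte_add_pinfty // lte_mul_pinfty.
Qed.

HB.instance Definition _ :=
  GRing.isSubmodClosed.Build C (int -> C * C) (Lq2fun q01) Lq2fun_submod_closed.

Record Lq2 := MkLq2 { Lq2_val :> int -> C * C; _ : Lq2_val \in Lq2fun q01 }.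
HB.instance Definition _ := [isSub for Lq2_val].
HB.instance Definition _ := [Choice of Lq2 by <:].
HB.instance Definition _ := [SubChoice_isSubLmodule of Lq2 by <:].

Definition dotLq2 (y z : Lq2) : C :=
  jackson (fun n => (y n).1 * conjc (z n).1 + (y n).2 * conjc (z n).2).

End QCalculus.

(* Possibly unbounded operators on a complex inner product space (V, dot) are
   represented by their graphs: A x x' means that x is in D(A) and A x = x'. *)
Section Operators.
Variables (R : realType) (V : lmodType R[i]) (dot : V -> V -> R[i]).

Definition hnorm (x : V) : R := Num.sqrt (complex.Re (dot x x)).

Definition norm_cvg (F : set_system R) (u : R -> V) (l : V) : Prop :=
  hnorm (u s - l) @[s --> F] --> (0 : R).

Definition adjoint (A : V -> V -> Prop) (x x' : V) : Prop :=
  forall y y', A y y' -> dot y' x = dot y x'.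

Definition densely_defined (A : V -> V -> Prop) : Prop :=
  forall (x : V) (e : R), 0 < e -> exists y y', A y y' /\ hnorm (x - y) < e.

Definition selfadjoint (A : V -> V -> Prop) : Prop :=
  densely_defined A /\ forall x x', A x x' <-> adjoint A x x'.

(* The operator x |-> lim_{s -> F} (i s)^-1 (U s x - x), defined wherever the
   limit exists. *)
Definition generator (F : set_system R) (U : R -> V -> V) (x x' : V) : Prop :=
  norm_cvg F (fun s => ('i%C * s%:C)^-1 *: (U s x - x)) x'.

Definition is_linear (T : V -> V) : Prop :=
  forall (a : R[i]) x y, T (a *: x + y) = a *: T x + T y.

Definition unitary (T : V -> V) : Prop :=
  [/\ is_linear T, forall x y, dot (T x) (T y) = dot x y &
      forall y, exists x, T x = y].

Definition unitary_group (U : R -> V -> V) : Prop :=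
  [/\ forall s, unitary (U s),
      forall x, U 0 x = x,
      forall s t x, U (s + t) x = U s (U t x) &
      forall s x, norm_cvg (nbhs s) (fun t => U t x) (U s x)].

(* For selfadjoint A, exp (i s A) is the value at s of the strongly continuous
   unitary group generated by i A (Stone's theorem); the value is irrelevant
   when no such group exists. *)
Definition is_exp_group (A : V -> V -> Prop) (U : R -> V -> V) : Prop :=
  unitary_group U /\ forall x x', A x x' <-> generator 0^' U x x'.

Definition exp_i (A : V -> V -> Prop) : R -> V -> V :=
  @xget (R -> V -> V) (fun _ x => x) [set U | is_exp_group A U].

(* The values Z s with s < 0 are irrelevant. *)
Definition contraction_semigroup (Z : R -> V -> V) : Prop :=
  [/\ forall s : R, 0 <= s -> is_linear (Z s),
      forall (s : R) x, 0 <= s -> hnorm (Z s x) <= hnorm x,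
      forall x, Z 0 x = x,
      forall (s t : R) x, 0 <= s -> 0 <= t -> Z (s + t) x = Z s (Z t x) &
      forall (s : R) x, 0 <= s ->
        norm_cvg (within [set t : R | 0 <= t] (nbhs s)) (fun t => Z t x) (Z s x)].
End Operators.

Definition selfadjoint_dilation (R : realType) (V K : lmodType R[i])
    (dotV : V -> V -> R[i]) (dotK : K -> K -> R[i])
    (P1 : K -> V) (P2 : V -> K)
    (M : K -> K -> Prop) (T : V -> V -> Prop) : Prop :=
  let Z (s : R) (y : V) := P1 (exp_i dotK M s (P2 y)) in
  [/\ selfadjoint dotK M, contraction_semigroup dotV Z &
      forall y z, T y z <-> generator dotV 0^'+ Z y z].

Section Dirac.
Variables (R : realType) (q : R) (q01 : 0 < q < 1) (p r : int -> R).
Local Notation C := R[i].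

Definition l1 (y : int -> C * C) (n : int) : C * C :=
  (- (q^-1)%:C * Dqinv q (fun m => (y m).2) n + (p n)%:C * (y n).1,
   Dq q (fun m => (y m).1) n + (r n)%:C * (y n).2).

Definition Dmax (y : Lq2 q01) : Prop :=
  [/\ q_regular (fun n => (y n).1), q_regular (fun n => (y n).2) &
      l1 y \in Lq2fun q01].

Definition y1_0 (y : Lq2 q01) : C := at_zero (fun n => (y n).1).
Definition y2_0 (y : Lq2 q01) : C := at_zero (fun n => (y n).2).

Definition T_op (h : C) (y z : Lq2 q01) : Prop :=
  [/\ Dmax y, y2_0 y - h * y1_0 y = 0 & l1 y = z].

Local Notation Rminus := `]-oo, (0 : R)].
Local Notation Rplus := `[(0 : R), +oo[.

Local Notation H := (L2 Rminus * Lq2 q01 * L2 Rplus)%type.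

Definition dotH (u v : H) : C :=
  dotL2 u.1.1 v.1.1 + dotLq2 u.1.2 v.1.2 + dotL2 u.2 v.2.

Definition P1 (u : H) : Lq2 q01 := u.1.2.
Definition P2 (y : Lq2 q01) : H := (0, y, 0).

Definition M_op (h : C) (delta : R) (u w : H) : Prop :=
  let: (um, y, up) := u in
  let: (wm, z, wp) := w in
  exists (phim phip : R -> C) (dm : L2 Rminus) (dp : L2 Rplus),
    [/\ sobolev phim um dm, sobolev phip up dp, Dmax y,
        y2_0 y - h * y1_0 y = delta%:C * phim 0 /\
        y2_0 y - conjc h * y1_0 y = delta%:C * phip 0 &
        [/\ wm = 'i%C *: dm, l1 y = z & wp = 'i%C *: dp]].
End Dirac.

(* Main.v *)
Require Import Defs.
From mathcomp Require Import all_boot all_order all_algebra.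
From mathcomp Require Import complex ring_quotient.
From mathcomp Require Import all_classical all_reals all_analysis measurable_realfun.
From mathcomp Require Import zify ring lra.

Set Implicit Arguments.
Unset Strict Implicit.
Unset Printing Implicit Defensive.

Import Order.TTheory GRing.Theory Num.Theory.
Import numFieldNormedType.Exports.

Local Open Scope classical_set_scope.
Local Open Scope complex_scope.
Local Open Scope ring_scope.

Local Notation modulus := ComplexField.Normc.normc.
Local Notation Re := complex.Re.
Local Notation Im := complex.Im.

(* Put tau = 1 / s.  Solving u - i s (M_h u) = f means solving
   phi' = - tau phi + tau f on each half-line and l_1 y = - i tau (y - g) with a
   boundary condition at 0.  On the half-lines, take the square integrable
   solution on the whole line, corrected on one side by a multiple of
   exp (- tau x); on the lattice, the range is closed by the dissipation
   estimate coming from Green's formula and its orthogonal complement is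
   trivial.  Hence M_h, which is symmetric because delta ^ 2 = 2 Im h, is
   selfadjoint and i M_h generates a unitary group U, the strong limit of
   (1 - i (t / 2 ^ k) M_h) ^ (- 2 ^ k).

   If Q is the projection onto the first component, or onto the first two, then
   Im (Q M_h u, Q u) is |phi_-(0)| ^ 2 / 2, or |phi_+(0)| ^ 2 / 2, so that
   |Q U(t) u| decreases for t >= 0.  Therefore U(t) P_2 y has no component in
   L^2(R_-), and U(t) maps the third summand into itself; this gives the
   semigroup law for Z_h.  For y in D(T_h) and a suitable k the vector
   <0, y, k exp (- x)> lies in D(M_h) and P_1 U(t) sends it to Z_h(t) y, so the
   generator of Z_h extends T_h.  They are equal since the generator is
   dissipative and 1 - i T_h is onto. *)

(** * Inner products on complex vector spaces *)

(** [exp_i] is defined by choice, so beyond existence every property is proved for an arbitrary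
    group generated by [i M]; decay under a compression passes from the resolvents to any such group
    by comparing the two over many small steps. Existence rests on completeness and three facts on
    [B = i A]: it is single-valued, skew, and [1 - s B] is onto for all real [s] other than zero.
    Density of the domain is derived from these. The number of steps is a power of two because
    halving a step replaces one resolvent by the square of another, at a cost controlled by [B ^ 2],
    and the resulting bounds telescope.

    Both signs of [s] are required, and for [tau < 0] the lattice equation comes with the conjugate
    of [h]; so the lattice problem is solved for every complex parameter whose imaginary part has
    the sign of [tau]. On the lattice, the mass [(1 - q) q ^ n] of the point [q ^ n] is summable
    near zero, which makes boundary values continuous in the graph norm, and grows towards infinity,
    which makes the bracket of Green's formula vanish there. *)

Section ComplexParts.
Variable R : realType.
Implicit Types (z w : R[i]) (t : R).

Lemma cReD z w : Re (z + w) = Re z + Re w. Proof. by case: z; case: w. Qed.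
Lemma cImD z w : Im (z + w) = Im z + Im w. Proof. by case: z; case: w. Qed.
Lemma cReN z : Re (- z) = - Re z. Proof. by case: z. Qed.
Lemma cImN z : Im (- z) = - Im z. Proof. by case: z. Qed.
Lemma cReM z w : Re (z * w) = Re z * Re w - Im z * Im w.
Proof. by case: z; case: w. Qed.
Lemma cImM z w : Im (z * w) = Re z * Im w + Im z * Re w.
Proof. by case: z; case: w. Qed.
Lemma cReJ z : Re (conjc z) = Re z. Proof. by case: z. Qed.
Lemma cImJ z : Im (conjc z) = - Im z. Proof. by case: z. Qed.
Lemma cJD z w : conjc (z + w) = conjc z + conjc w. Proof. exact: rmorphD. Qed.
Lemma cJN z : conjc (- z) = - conjc z. Proof. exact: rmorphN. Qed.
Lemma cJM z w : conjc (z * w) = conjc z * conjc w. Proof. exact: rmorphM. Qed.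
Lemma cIm_iM t z : Im ('i%C * t%:C * z) = t * Re z.
Proof. by rewrite !cImM !cReM /=; ring. Qed.
Lemma complex_eq z w : Re z = Re w -> Im z = Im w -> z = w.
Proof. by case: z; case: w => ? ? ? ? /= -> ->. Qed.
Lemma modulus_real t : modulus t%:C = `|t|.
Proof. by rewrite /= expr0n /= addr0 sqrtr_sqr. Qed.
Lemma modulus_i : modulus ('i%C : R[i]) = 1.
Proof. by rewrite /= expr0n /= add0r expr1n sqrtr1. Qed.
Lemma modulus_ge0 z : 0 <= modulus z. Proof. by case: z => a b; exact: sqrtr_ge0. Qed.
Lemma Re_le_modulus z : `|Re z| <= modulus z.
Proof. by case: z => a b /=; rewrite -sqrtr_sqr ler_wsqrtr // lerDl sqr_ge0. Qed.
Lemma Im_le_modulus z : `|Im z| <= modulus z.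
Proof. by case: z => a b /=; rewrite -sqrtr_sqr ler_wsqrtr // lerDr sqr_ge0. Qed.
Lemma modulus_le_parts z : modulus z <= `|Re z| + `|Im z|.
Proof.
rewrite -(@ler_pXn2r _ 2) ?nnegrE ?addr_ge0 ?modulus_ge0 //.
rewrite modulus_sqr sqrrD !real_normK ?num_real // lerD2r lerDl.
by rewrite mulrn_wge0 // mulr_ge0.
Qed.
End ComplexParts.

Definition conjE := (cJD, cJN, cJM, conjc_real, conjcK).
Definition complexE_parts := (cReD, cImD, cReN, cImN, cReM, cImM, cReJ, cImJ).

Record inner_product (R : realType) (V : lmodType R[i]) (dot : V -> V -> R[i]) : Prop := {
  dot_linear : forall a x y z, dot (a *: x + y) z = a * dot x z + dot y z;
  dot_conj : forall x y, dot y x = conjc (dot x y);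
  dot_ge0 : forall x, 0 <= Re (dot x x);
  dot_eq0 : forall x, Re (dot x x) = 0 -> x = 0 }.

Definition norm_complete (R : realType) (V : lmodType R[i]) (dot : V -> V -> R[i]) : Prop :=
  forall u : nat -> V,
    (forall e : R, 0 < e -> exists N, forall m n, (N <= m)%N -> (N <= n)%N ->
       hnorm dot (u m - u n) < e) ->
    exists l, forall e : R, 0 < e -> exists N, forall n, (N <= n)%N ->
       hnorm dot (u n - l) < e.

Section InnerProduct.
Variables (R : realType) (V : lmodType R[i]) (dot : V -> V -> R[i]).
Hypothesis dotP : inner_product dot.
Implicit Types (x y z : V) (a : R[i]) (s t : R).
Local Notation N := (hnorm dot).

(** For the real inner product [ip], the operator [i A] is skew when [A] is symmetric. The estimates
    are made in this real space and [dot_ipE] recovers the complex product. *)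
Definition ip x y := Re (dot x y).

Lemma dotDl x y z : dot (x + y) z = dot x z + dot y z.
Proof. by rewrite -[x]scale1r (dot_linear dotP) mul1r scale1r. Qed.
Lemma dot0l z : dot 0 z = 0.
Proof.
have := dot_linear dotP (-1) 0 0 z.
by rewrite scaler0 addr0 mulN1r addNr.
Qed.
Lemma dotZl a x z : dot (a *: x) z = a * dot x z.
Proof. by rewrite -[a *: x]addr0 (dot_linear dotP) dot0l addr0. Qed.
Lemma dotNl x z : dot (- x) z = - dot x z.
Proof. by rewrite -scaleN1r dotZl mulN1r. Qed.

Lemma dotZr a x z : dot z (a *: x) = conjc a * dot z x.
Proof. by rewrite (dot_conj dotP) dotZl rmorphM /= -(dot_conj dotP). Qed.
Lemma dotNr x z : dot z (- x) = - dot z x.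
Proof. by rewrite (dot_conj dotP) dotNl rmorphN /= -(dot_conj dotP). Qed.
Lemma dot0r z : dot z 0 = 0.
Proof. by rewrite (dot_conj dotP) dot0l rmorph0. Qed.

Lemma ipC x y : ip x y = ip y x.
Proof. by rewrite /ip (dot_conj dotP) cReJ. Qed.
Lemma ipDl x y z : ip (x + y) z = ip x z + ip y z.
Proof. by rewrite /ip dotDl cReD. Qed.
Lemma ipNl x z : ip (- x) z = - ip x z.
Proof. by rewrite /ip dotNl cReN. Qed.
Lemma ipZl t x z : ip (t%:C *: x) z = t * ip x z.
Proof. by rewrite /ip dotZl cReM /= mul0r subr0. Qed.
Lemma ipDr x y z : ip z (x + y) = ip z x + ip z y.
Proof. by rewrite ipC ipDl !(ipC z). Qed.
Lemma ipNr x z : ip z (- x) = - ip z x.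
Proof. by rewrite ipC ipNl (ipC z). Qed.
Lemma ipZr t x z : ip z (t%:C *: x) = t * ip z x.
Proof. by rewrite ipC ipZl (ipC z). Qed.
Lemma ip0l z : ip 0 z = 0. Proof. by rewrite /ip dot0l. Qed.
Lemma ip0r z : ip z 0 = 0. Proof. by rewrite /ip dot0r. Qed.
Lemma dot_ipE x y : dot x y = ip x y +i* ip x ('i%C *: y).
Proof. by rewrite /ip dotZr; case: (dot x y) => a b /=; simpc. Qed.

Definition ipE := (ipDl, ipDr, ipNl, ipNr, ipZl, ipZr, ip0l, ip0r).

Lemma hnorm_ge0 x : 0 <= N x. Proof. exact: sqrtr_ge0. Qed.
Lemma hnorm_sqr x : N x ^+ 2 = ip x x.
Proof. by rewrite /hnorm sqr_sqrtr // (dot_ge0 dotP). Qed.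
Lemma hnorm_zero : N 0 = 0. Proof. by rewrite /hnorm dot0l sqrtr0. Qed.
Lemma hnorm_eq0 x : N x = 0 -> x = 0.
Proof. by move=> x0; apply: (dot_eq0 dotP); rewrite -[Re _]hnorm_sqr x0 expr0n. Qed.
Lemma hnorm_opp x : N (- x) = N x.
Proof. by rewrite /hnorm dotNl dotNr opprK. Qed.
Lemma hnorm_distC x y : N (x - y) = N (y - x).
Proof. by rewrite -hnorm_opp opprB. Qed.
Lemma hnorm_scale a x : N (a *: x) = modulus a * N x.
Proof.
apply/eqP; rewrite -(@eqrXn2 _ 2) ?mulr_ge0 ?hnorm_ge0 ?modulus_ge0 //.
rewrite exprMn !hnorm_sqr modulus_sqr; apply/eqP.
by rewrite /ip dotZl dotZr mulrA cReM !complexE_parts; ring.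
Qed.
Lemma hnorm_scaler t x : N (t%:C *: x) = `|t| * N x.
Proof. by rewrite hnorm_scale modulus_real. Qed.

Lemma cauchy_schwarz x y : ip x y <= N x * N y.
Proof.
have [->|y0] := eqVneq y 0; first by rewrite ip0r mulr_ge0 ?hnorm_ge0.
have Ny : 0 < N y.
  by rewrite lt_def hnorm_ge0 andbT; apply: contra y0 => /eqP/hnorm_eq0 ->.
have [->|x0] := eqVneq x 0; first by rewrite ip0l mulr_ge0 ?hnorm_ge0.
have Nx : 0 < N x.
  by rewrite lt_def hnorm_ge0 andbT; apply: contra x0 => /eqP/hnorm_eq0 ->.
(* The square of this vector is [2 |x| |y| (|x| |y| - ip x y)]. *)
have := dot_ge0 dotP ((N y)%:C *: x - (N x)%:C *: y).
rewrite -/(ip _ _) !ipE (ipC y x) -!hnorm_sqr.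
rewrite (_ : _ + _ = 2 * (N x * N y) * (N x * N y - ip x y)); last by ring.
by rewrite pmulr_rge0 ?subr_ge0 // !mulr_gt0.
Qed.

Lemma norm_ip_le x y : `|ip x y| <= N x * N y.
Proof.
rewrite ler_norml cauchy_schwarz andbT lerNl -ipNl.
by rewrite (le_trans (cauchy_schwarz _ _)) // hnorm_opp.
Qed.

Lemma hnorm_add x y : N (x + y) <= N x + N y.
Proof.
rewrite -(@ler_pXn2r _ 2) ?nnegrE ?addr_ge0 ?hnorm_ge0 //.
rewrite sqrrD !hnorm_sqr !ipE (ipC y x).
by have := cauchy_schwarz x y; lra.
Qed.

Lemma hnorm_tri x y z : N (x - z) <= N (x - y) + N (y - z).
Proof. by rewrite -[x - z](subrKA y); exact: hnorm_add. Qed.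

Lemma hnorm_small x : (forall e : R, 0 < e -> N x <= e) -> x = 0.
Proof.
move=> H; apply: hnorm_eq0; apply: le_anti; rewrite hnorm_ge0 andbT.
by apply/ler_addgt0Pl => e e0; rewrite addr0 H.
Qed.
End InnerProduct.

(** * Linear identities in modules by reflection *)

Section ModuleReflection.
Variables (K : comPzRingType) (V : lmodType K).

(* Linear expressions over a list of vectors; two of them are equal as soon as
   their coefficients are, which [ring] can decide. *)
Inductive lexp := LVar of nat | LZero | LAdd of lexp & lexp | LOpp of lexp
  | LScale of K & lexp.

Fixpoint leval (env : seq V) (e : lexp) : V :=
  match e with
  | LVar n => nth 0 env n
  | LZero => 0
  | LAdd e1 e2 => leval env e1 + leval env e2
  | LOpp e1 => - leval env e1
  | LScale c e1 => c *: leval env e1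
  end.

(** [Nat.eqb] reduces under [cbn] on numerals, so the coefficients become plain ring expressions. *)
Fixpoint lcoef (i : nat) (e : lexp) : K :=
  match e with
  | LVar n => if Nat.eqb n i then 1 else 0
  | LZero => 0
  | LAdd e1 e2 => lcoef i e1 + lcoef i e2
  | LOpp e1 => - lcoef i e1
  | LScale c e1 => c * lcoef i e1
  end.

Lemma levalE env e : leval env e = \sum_(i < size env) lcoef i e *: nth 0 env i.
Proof.
elim: e => [n||e1 IH1 e2 IH2|e IH|c e IH] /=.
- have [ltn|gen] := ltnP n (size env).
    rewrite (bigD1 (Ordinal ltn)) //= PeanoNat.Nat.eqb_refl scale1r big1 ?addr0 // => i ni.
    case: PeanoNat.Nat.eqb_spec => [ein|]; last by rewrite scale0r.
    by case/eqP: ni; apply: val_inj.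
  rewrite nth_default // big1 // => i _; case: PeanoNat.Nat.eqb_spec => [ein|]; last by rewrite scale0r.
  by rewrite ein leqNgt ltn_ord in gen.
- by rewrite big1 // => i _; rewrite scale0r.
- by rewrite IH1 IH2 -big_split; apply: eq_bigr => i _; rewrite scalerDl.
- by rewrite IH -sumrN; apply: eq_bigr => i _; rewrite scaleNr.
- by rewrite IH scaler_sumr; apply: eq_bigr => i _; rewrite scalerA.
Qed.

(** An iterated conjunction rather than a quantifier, so that it unfolds into one scalar goal per
    vector. *)
Fixpoint lcoef_eq (k : nat) (e1 e2 : lexp) : Prop :=
  match k with
  | 0%N => True
  | k'.+1 => lcoef k' e1 = lcoef k' e2 /\ lcoef_eq k' e1 e2
  end.

Lemma leval_eq env e1 e2 : lcoef_eq (size env) e1 e2 -> leval env e1 = leval env e2.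
Proof.
move=> H; rewrite !levalE; apply: eq_bigr => i _; congr (_ *: _).
elim: (size env) H i => [|k IH] /= => [_ []//|[Hk H] i].
have [->//|ik] := eqVneq (i : nat) k.
have ltik : (i < k)%N by rewrite ltn_neqAle ik -ltnS ltn_ord.
exact: (IH H (Ordinal ltik)).
Qed.
End ModuleReflection.

Ltac lmod_index x env :=
  lazymatch env with
  | nil => fail
  | x :: _ => constr:(0%N)
  | _ :: ?env' => let n := lmod_index x env' in constr:(S n)
  end.
Ltac lmod_insert x env :=
  match env with
  | _ => let _ := lmod_index x env in env
  | _ => constr:(x :: env)
  end.
Ltac lmod_atoms env t :=
  lazymatch t with
  | GRing.add ?a ?b => let env' := lmod_atoms env a in lmod_atoms env' b
  | GRing.opp ?a => lmod_atoms env a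
  | GRing.scale _ ?a => lmod_atoms env a
  | GRing.zero => env
  | _ => lmod_insert t env
  end.
Ltac lmod_reify K env t :=
  lazymatch t with
  | GRing.add ?a ?b => let x := lmod_reify K env a in let y := lmod_reify K env b in constr:(@LAdd K x y)
  | GRing.opp ?a => let x := lmod_reify K env a in constr:(@LOpp K x)
  | GRing.scale ?c ?a => let x := lmod_reify K env a in constr:(@LScale K c x)
  | GRing.zero => constr:(@LZero K)
  | _ => let n := lmod_index t env in constr:(@LVar K n)
  end.
Ltac lmod_with K :=
  lazymatch goal with
  | |- @eq ?V ?u ?v =>
    let env := lmod_atoms (@nil V) u in
    let env := lmod_atoms env v in
    let e1 := lmod_reify K env u in
    let e2 := lmod_reify K env v in
    apply: (@leval_eq K _ env e1 e2); cbn [size lcoef_eq lcoef Nat.eqb]; repeat split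
  end.
Ltac lmod_ring R :=
  lmod_with constr:(GRing.ComPzRing.clone (complex R) _); ring.

(** * Sequential limits in norm *)

Section SequentialLimits.
Variables (R : realType) (V : lmodType R[i]) (dot : V -> V -> R[i]).
Hypothesis dotP : inner_product dot.
Local Notation norm := (hnorm dot).
Implicit Types (u v : nat -> V) (l m x y : V) (e c : R).

(** Convertible to the conclusion of [norm_complete], so limits provided by completeness need no
    translation. *)
Definition ncvg u l := forall e, 0 < e -> exists N, forall n, (N <= n)%N -> norm (u n - l) < e.

Lemma ncvg_dist u v l m c : ncvg u l -> ncvg v m ->
  (exists N, forall n, (N <= n)%N -> norm (u n - v n) <= c) -> norm (l - m) <= c.
Proof.
move=> ul vm [N H]; apply/ler_addgt0Pl => e e0; have e2 : 0 < e / 2 by rewrite divr_gt0.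
have [N1 H1] := ul _ e2; have [N2 H2] := vm _ e2.
pose n := maxn N (maxn N1 N2).
have {}H := H n (leq_maxl _ _).
have {}H1 := H1 n (leq_trans (leq_maxl _ _) (leq_maxr _ _)).
have {}H2 := H2 n (leq_trans (leq_maxr _ _) (leq_maxr _ _)).
have := hnorm_tri dotP l (u n) m; have := hnorm_tri dotP (u n) (v n) m.
by move: H1; rewrite (hnorm_distC dotP); lra.
Qed.

Lemma ncvg_cst x : ncvg (fun=> x) x.
Proof. by move=> e e0; exists 0%N => n _; rewrite subrr (hnorm_zero dotP). Qed.

Lemma ncvg_unique u l m : ncvg u l -> ncvg u m -> l = m.
Proof.
move=> ul um; apply/eqP; rewrite -subr_eq0; apply/eqP/(hnorm_eq0 dotP)/le_anti.
rewrite hnorm_ge0 andbT; apply: ncvg_dist ul um _.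
by exists 0%N => n _; rewrite subrr (hnorm_zero dotP).
Qed.

Lemma ncvg_norm_le u l c : ncvg u l -> (forall n, norm (u n) <= c) -> norm l <= c.
Proof.
move=> ul uc; rewrite -(subr0 l); apply: ncvg_dist ul (ncvg_cst 0) _.
by exists 0%N => n _; rewrite subr0.
Qed.

Lemma ncvg_linear a u v l m : ncvg u l -> ncvg v m ->
  ncvg (fun n => a *: u n + v n) (a *: l + m).
Proof.
move=> ul vm e e0; have e2 : 0 < e / 2 by rewrite divr_gt0.
have a1 : 0 < modulus a + 1 by rewrite ltr_pwDr ?modulus_ge0.
have [N1 H1] := ul _ (divr_gt0 e2 a1); have [N2 H2] := vm _ e2.
exists (maxn N1 N2) => n; rewrite geq_max => /andP[/H1 {}H1 /H2 {}H2].
have -> : a *: u n + v n - (a *: l + m) = a *: (u n - l) + (v n - m) by lmod_ring R.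
apply: le_lt_trans (hnorm_add dotP _ _) _; rewrite (hnorm_scale dotP).
rewrite ltr_pdivlMr // in H1.
suff : modulus a * norm (u n - l) <= norm (u n - l) * (modulus a + 1) by move: H1 H2; lra.
by have := hnorm_ge0 dot (u n - l); lra.
Qed.

(** Through this identity linear maps that preserve the norm preserve the inner product, see
    [dot_isometry]. *)
Lemma polarization x y : ip dot x y = (norm (x + y) ^+ 2 - norm x ^+ 2 - norm y ^+ 2) / 2.
Proof. by rewrite !(hnorm_sqr dotP) !(ipE dotP) (ipC dotP y x); field. Qed.
End SequentialLimits.

(** * Unitary groups and Stone's theorem *)

Section SkewAdjoint.
Variables (R : realType) (V : lmodType R[i]) (dot : V -> V -> R[i]).
Hypothesis dotP : inner_product dot.
Hypothesis complete : norm_complete dot.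
Variable B : V -> V -> Prop.
Hypothesis B_linear : forall a x x' y y',
  B x x' -> B y y' -> B (a *: x + y) (a *: x' + y').
Hypothesis B0 : B 0 0.
Hypothesis B_fun : forall x', B 0 x' -> x' = 0.
Hypothesis B_skew : forall x x' y y', B x x' -> B y y' -> ip dot x' y = - ip dot x y'.
Hypothesis B_onto : forall (s : R) z, s != 0 -> exists x x', B x x' /\ x - s%:C *: x' = z.
Implicit Types (x y z : V) (a b s t : R) (k m n : nat).
Local Notation norm := (hnorm dot).
Local Notation ip := (ip dot).

Lemma BD x x' y y' : B x x' -> B y y' -> B (x + y) (x' + y').
Proof. by move=> Bx By; have := B_linear 1 Bx By; rewrite !scale1r. Qed.
Lemma BZ c x x' : B x x' -> B (c *: x) (c *: x').
Proof. by move=> Bx; have := B_linear c Bx B0; rewrite !addr0. Qed.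
Lemma BB x x' y y' : B x x' -> B y y' -> B (x - y) (x' - y').
Proof. by move=> Bx By; have := B_linear (-1) By Bx; rewrite !scaleN1r !(addrC (- _)). Qed.
Lemma B_inj x x' x'' : B x x' -> B x x'' -> x' = x''.
Proof.
by move=> B1 B2; apply/eqP; rewrite -subr_eq0; apply/eqP/B_fun; rewrite -(subrr x); apply: BB.
Qed.

Lemma skew0 x x' : B x x' -> ip x' x = 0.
Proof. by move=> Bx; have := B_skew Bx Bx; rewrite (ipC dotP x x'); lra. Qed.

(** Skewness kills the cross term: [|x - s x'|^2 = |x|^2 + s^2 |x'|^2]. *)
Lemma resolvent_le s x x' : B x x' -> norm x <= norm (x - s%:C *: x').
Proof.
move=> Bx; rewrite -(@ler_pXn2r _ 2) ?nnegrE ?hnorm_ge0 //.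
rewrite !(hnorm_sqr dotP) !(ipE dotP) (ipC dotP x x') (skew0 Bx).
by rewrite -(hnorm_sqr dotP x') -[leLHS]addr0; nra.
Qed.

(* At [s = 0] the resolvent is the identity, whose values need not lie in the
   domain of [B]. *)
Lemma resolvent_ex s z : exists xx : V * V, (s != 0 -> B xx.1 xx.2) /\ xx.1 - s%:C *: xx.2 = z.
Proof.
have [->|s0] := eqVneq s 0; first by exists (z, 0); split; rewrite ?eqxx //= scaler0 subr0.
by have [x [x' [Bx xz]]] := B_onto z s0; exists (x, x').
Qed.

(** For [s] other than zero, [res s] is [(1 - s B)^-1] and [dres s] is [B (1 - s B)^-1]. *)
Definition res s z : V := (proj1_sig (cid (resolvent_ex s z))).1.
Definition dres s z : V := (proj1_sig (cid (resolvent_ex s z))).2.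

Lemma B_res s z : s != 0 -> B (res s z) (dres s z).
Proof. exact: (proj2_sig (cid (resolvent_ex s z))).1. Qed.
Lemma resP s z : res s z - s%:C *: dres s z = z.
Proof. exact: (proj2_sig (cid (resolvent_ex s z))).2. Qed.
Lemma resE s z : res s z = z + s%:C *: dres s z.
Proof. by rewrite -{2}(resP s z) subrK. Qed.
Lemma res0 x : res 0 x = x.
Proof. by rewrite resE scale0r addr0. Qed.

Lemma res_unique s z x x' : B x x' -> x - s%:C *: x' = z -> x = res s z.
Proof.
have [->|s0] := eqVneq s 0; first by move=> _ <-; rewrite res0 scale0r subr0.
move=> Bx xz; apply/eqP; rewrite -subr_eq0; apply/eqP/(hnorm_eq0 dotP)/le_anti.
rewrite hnorm_ge0 andbT.
have := resolvent_le s (BB Bx (B_res z s0)).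
rewrite (_ : x - res s z - s%:C *: (x' - dres s z) = (x - s%:C *: x') - (res s z - s%:C *: dres s z)); last by lmod_ring R.
by rewrite xz resP subrr (hnorm_zero dotP).
Qed.

Lemma res_linear s c x y : res s (c *: x + y) = c *: res s x + res s y.
Proof.
have [->|s0] := eqVneq s 0; first by rewrite !res0.
symmetry; apply: (res_unique (B_linear c (B_res x s0) (B_res y s0))).
rewrite -{3}(resP s x) -{3}(resP s y); lmod_ring R.
Qed.
Lemma res_le s x : norm (res s x) <= norm x.
Proof.
have [->|s0] := eqVneq s 0; first by rewrite res0.
by rewrite -{2}(resP s x) resolvent_le //; exact: B_res.
Qed.

(** With [w = res s x'], the vector [x + s w] is mapped by [B] to [x' + s B w = w], so [1 - s B]
    sends it to [x]; hence it is [res s x] and its image is [w]. *)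
Lemma B_res_comm s x x' : B x x' -> B (res s x) (res s x').
Proof.
have [->|s0] := eqVneq s 0; first by rewrite !res0.
move=> Bx; have Bw := B_res x' s0.
have Bv : B (x + s%:C *: res s x') (x' + s%:C *: dres s x') by apply: BD => //; apply: BZ.
have Ex' : x' + s%:C *: dres s x' = res s x' by rewrite -resE.
rewrite Ex' in Bv.
by rewrite -(@res_unique s x _ _ Bv) // addrK.
Qed.

Lemma res_comm s x x' : B x x' -> res s x - x = s%:C *: res s x'.
Proof.
have [->|s0] := eqVneq s 0; first by rewrite !res0 scale0r subrr.
move=> Bx; have -> : res s x' = dres s x.
  by apply: B_inj (B_res x s0); exact: B_res_comm.
by rewrite -{2}(resP s x) opprB addrC subrK.
Qed.

Lemma res_resC a b x : res a (res b x) = res b (res a x).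
Proof.
have [->|b0] := eqVneq b 0; first by rewrite !res0.
apply: (@res_unique b _ _ (res a (dres b x))); first exact/B_res_comm/B_res.
rewrite -{3}(resP b x) (_ : res b x - _ = (- b%:C) *: dres b x + res b x); last by lmod_ring R.
rewrite res_linear; lmod_ring R.
Qed.

(** The squared norms of [res s x - x] decrease with [s] and their differences dominate the squared
    increments. This yields the Cauchy property before anything is known about density. *)
Lemma res_diff_le s t x : 0 < t -> t <= s ->
  norm ((res s x - x) - (res t x - x)) ^+ 2 <= norm (res s x - x) ^+ 2 - norm (res t x - x) ^+ 2.
Proof.
move=> t_gt0; rewrite le_eqVlt => /orP[/eqP ->|ts].
  by rewrite !subrr (hnorm_zero dotP) expr0n.
have E u : res u x - x = u%:C *: dres u x by rewrite resE addrC addKr.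
have t0 : t != 0 by rewrite gt_eqF.
have s0 : s != 0 by rewrite gt_eqF // (lt_trans t_gt0).
have := skew0 (BB (B_res x s0) (B_res x t0)).
rewrite (_ : res s x - res t x = s%:C *: dres s x - t%:C *: dres t x); last by rewrite -!E; lmod_ring R.
rewrite !E !(hnorm_sqr dotP) !(ipE dotP) (ipC dotP (dres t x) (dres s x)).
set p := ip (dres s x) (dres s x); set q := ip (dres t x) (dres t x).
set r := ip (dres s x) (dres t x) => K0.
have Q0 : 0 <= s * s * p - 2 * s * t * r + t * t * q.
  have := dot_ge0 dotP (s%:C *: dres s x - t%:C *: dres t x).
  rewrite -/(ip _ _) !(ipE dotP) (ipC dotP (dres t x) (dres s x)) -/p -/q -/r; lra.
(* After expansion the claim is [t q <= s r]. [K0], which is skewness on the difference of the two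
   resolvents, reads [(s + t) r = s p + t q]; multiplying [Q0] by [s + t] and eliminating [r] leaves
   [(s - t) (s^2 p - t^2 q) >= 0]. *)
suff : t * q <= s * r by nra.
have rE : (s + t) * r = s * p + t * q by lra.
have H1 : 0 <= (s - t) * (s * s * p - t * t * q).
  have : 0 <= (s + t) * (s * s * p - 2 * s * t * r + t * t * q) by rewrite mulr_ge0 //; lra.
  rewrite (_ : _ * _ = (s + t) * (s * s * p + t * t * q) - 2 * s * t * ((s + t) * r)); last by ring.
  by rewrite rE; lra.
rewrite pmulr_rge0 ?subr_gt0 // in H1.
rewrite -(ler_pM2l (_ : 0 < s + t)); last by lra.
by rewrite [leRHS]mulrCA rE; lra.
Qed.

(** By [res_diff_le] the vectors [res s x - x] form a Cauchy sequence along [s = 1 / (n + 1)]; the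
    limit is orthogonal to the domain of [B], and such a vector vanishes. *)
Lemma res_cvg x e : 0 < e -> exists2 s, 0 < s & norm (res s x - x) < e.
Proof.
move=> e0.
pose S n : R := n.+1%:R^-1.
have S0 n : 0 < S n by rewrite invr_gt0 ltr0n.
have Sle m n : (m <= n)%N -> S n <= S m by move=> mn; rewrite lef_pV2 ?posrE ?ltr0n // ler_nat.
pose a n := res (S n) x - x.
pose f n := norm (a n) ^+ 2.
have f0 n : 0 <= f n by rewrite sqr_ge0.
have fle m n : (m <= n)%N -> norm (a m - a n) ^+ 2 <= f m - f n.
  by move=> mn; apply: res_diff_le => //; exact: Sle.
have infS : has_inf (range f) by split; [exists (f 0%N); exists 0%N|exists 0 => _ [n _ <-]].
have [l al] : exists l, forall d : R, 0 < d -> exists N, forall n, (N <= n)%N -> norm (a n - l) < d.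
  apply: complete => d d0.
  have [_ [N _ <-] fN] := inf_adherent (exprn_gt0 2 d0) infS.
  have wl m n : (N <= m)%N -> (m <= n)%N -> norm (a m - a n) < d.
    move=> Nm mn; rewrite -(@ltr_pXn2r _ 2) ?nnegrE ?hnorm_ge0 ?(ltW d0) //.
    have fn : inf (range f) <= f n by apply: ge_inf; [case: infS|exists n].
    have fm : f m <= f N by rewrite -subr_ge0 (le_trans _ (fle _ _ Nm)) ?sqr_ge0.
    by have := fle _ _ mn; lra.
  exists N => m n Nm Nn; have [mn|/ltnW nm] := leqP m n; first exact: wl.
  by rewrite (hnorm_distC dotP); exact: wl.
(* Skewness moves [B] onto [y]: [ip (a n) y = - S n * ip (res (S n) x) y'], which tends to zero
   because the resolvents are contractions. *)
have l_orth y y' : B y y' -> ip l y = 0.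
  move=> By; apply/eqP; rewrite -normr_eq0; apply/eqP/le_anti.
  rewrite normr_ge0 andbT; apply/ler_addgt0Pl => d d0; rewrite addr0.
  pose K := norm x * norm y' + norm y + 1.
  have K1 : 0 < K by rewrite ltr_pwDr ?ltr01 ?addr_ge0 ?mulr_ge0 ?hnorm_ge0.
  have [N HN] := al _ (divr_gt0 d0 K1).
  have [M HM] : exists M, forall n, (M <= n)%N -> S n < d / K.
    exists (Num.bound (K / d)) => n Mn.
    rewrite invf_plt ?posrE ?ltr0n ?divr_gt0 // invf_div.
    apply: lt_le_trans (_ : (Num.bound (K / d))%:R <= _); first by rewrite archi_boundP // ltW // divr_gt0.
    by rewrite ler_nat ltnW // ltnS.
  pose n := maxn N M; have {}HN := HN n (leq_maxl _ _); have {}HM := HM n (leq_maxr _ _).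
  have -> : ip l y = ip (a n) y - ip (a n - l) y by rewrite !(ipE dotP); ring.
  have -> : ip (a n) y = - (S n * ip (res (S n) x) y').
    have -> : a n = (S n)%:C *: dres (S n) x by rewrite /a {1}resE addrC addKr.
    by rewrite (ipE dotP) (B_skew (B_res _ (lt0r_neq0 (S0 n))) By) mulrN.
  rewrite (le_trans (ler_normB _ _)) // normrN normrM gtr0_norm //.
  have h1 : `|ip (res (S n) x) y'| <= norm x * norm y'.
    by rewrite (le_trans (norm_ip_le dotP _ _)) // ler_wpM2r ?hnorm_ge0 // res_le.
  have h2 : `|ip (a n - l) y| <= d / K * norm y.
    by rewrite (le_trans (norm_ip_le dotP _ _)) // ler_wpM2r ?hnorm_ge0 // ltW.
  have h3 : S n * `|ip (res (S n) x) y'| <= d / K * (norm x * norm y').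
    by rewrite ler_pM // ltW.
  apply: le_trans (lerD h3 h2) _; rewrite -mulrDr -ler_pdivlMl ?divr_gt0 // invf_div divrK ?unitfE ?gt_eqF //.
  by rewrite /K lerDl.
(* Let [u = res 1 l], so [l = u - B u]. Orthogonality of [l] to [u] and skewness give [|u|^2 = 0];
   single-valuedness of [B] then gives [B u = 0]. *)
have l0 : l = 0.
  have Bl := B_res l (oner_neq0 R); have := l_orth _ _ Bl.
  rewrite -{1}(resP 1 l) !(ipE dotP) (skew0 Bl) mulr0 subr0 -(hnorm_sqr dotP).
  move=> /eqP; rewrite sqrf_eq0 => /eqP/(hnorm_eq0 dotP) E.
  have := B_res l (oner_neq0 R); rewrite E => /B_fun E'.
  by rewrite -(resP 1 l) E E' scaler0 subr0.
have [N /(_ N (leqnn _))] := al e e0.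
by rewrite l0 subr0 => HN; exists (S N).
Qed.

Lemma resB s x y : res s (x - y) = res s x - res s y.
Proof.
by rewrite -[x - y]addrC -scaleN1r res_linear scaleN1r addrC.
Qed.

Lemma iter_res_linear n s c x y :
  iter n (res s) (c *: x + y) = c *: iter n (res s) x + iter n (res s) y.
Proof. by elim: n => //= n ->; exact: res_linear. Qed.

Lemma iter_res_le n s x : norm (iter n (res s) x) <= norm x.
Proof. by elim: n => //= n IH; exact: le_trans (res_le _ _) IH. Qed.

Lemma B_iter_res n s x x' : B x x' -> B (iter n (res s) x) (iter n (res s) x').
Proof. by move=> Bx; elim: n => //= n IH; exact: B_res_comm. Qed.

(** Telescoping over the step at which [F] replaces [G]: only [F] has to be a contraction, and the
    two maps need to be close only along the orbit of [G]. *)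
Lemma iter_dist (F G : V -> V) n c x :
  (forall u v, norm (F u - F v) <= norm (u - v)) ->
  (forall k, norm (F (iter k G x) - G (iter k G x)) <= c) ->
  norm (iter n F x - iter n G x) <= n%:R * c.
Proof.
move=> Fle FG; elim: n => [|n IH] /=; first by rewrite subrr (hnorm_zero dotP) mul0r.
apply: le_trans (hnorm_tri dotP _ (F (iter n G x)) _) _.
by rewrite -[n.+1]addn1 natrD mulrDl mul1r lerD // (le_trans (Fle _ _)).
Qed.

Lemma res_dist s u v : norm (res s u - res s v) <= norm (u - v).
Proof. by rewrite -resB res_le. Qed.

(** From [(1 - a B) (1 - b B) = 1 - (a + b) B + a b B^2], the difference is [a b] times three
    resolvents applied to [B^2 x]. *)
Lemma res_add_le a b x x' x'' : B x x' -> B x' x'' ->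
  norm (res (a + b) x - res a (res b x)) <= `|a * b| * norm x''.
Proof.
move=> Bx Bx'.
pose u := res a (res b x); pose u' := res a (res b x'); pose u'' := res a (res b x'').
have Bu : B u u' by do 2 apply: B_res_comm.
have xE : x = (a * b)%:C *: u'' + (u - (a + b)%:C *: u').
  have e1 := res_comm a (B_res_comm b Bx); have e2 := res_comm b Bx.
  have e3 := res_comm a (B_res_comm b Bx').
  have -> : u = x + a%:C *: u' + b%:C *: res b x' by rewrite /u' -e1 -e2 /u; lmod_ring R.
  have -> : res b x' = u' - a%:C *: u'' by rewrite /u'' -e3 /u'; lmod_ring R.
  lmod_ring R.
rewrite {1}xE res_linear -(res_unique Bu erefl) -/u addrK (hnorm_scaler dotP).
by rewrite ler_wpM2l // /u'' !(le_trans (res_le _ _)) // -/u''; do 2 apply: le_trans (res_le _ _) _.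
Qed.

Lemma sqr_hnorm_ge0 t x : 0 <= t ^+ 2 * norm x.
Proof. by apply: mulr_ge0; [exact: sqr_ge0|exact: hnorm_ge0]. Qed.

(* [((1 - t B / 2 ^ k)^-1) ^ (2 ^ k)] converges to [exp (t B)]. *)
Definition approx k t := iter (2 ^ k) (res (t / (2 ^ k)%:R)).

(** Each of the [2 ^ k] steps is replaced by two steps of half the size. The total error
    [t^2 |x''| / (4 * 2 ^ k)] is weakened to a difference of consecutive terms so that it telescopes
    in [approx_dist]. *)
Lemma approxS_le k t x x' x'' : B x x' -> B x' x'' ->
  norm (approx k t x - approx k.+1 t x) <= t ^+ 2 * norm x'' * ((2 ^ k)%:R^-1 - (2 ^ k.+1)%:R^-1).
Proof.
move=> Bx Bx'; rewrite /approx; set P : R := (2 ^ k)%:R; have P0 : 0 < P by rewrite ltr0n expn_gt0.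
have -> : (2 ^ k.+1)%:R = P * 2 by rewrite expnSr natrM.
set b := t / (P * 2); rewrite expnSr iterM.
have -> : t / P = b + b by rewrite /b invfM mulrA -splitr.
have le1 j : norm (res (b + b) (iter j (iter 2 (res b)) x) - iter 2 (res b) (iter j (iter 2 (res b)) x)) <=
  `|b * b| * norm x''.
  rewrite -iterM; apply: le_trans (res_add_le _ _ (B_iter_res _ _ Bx) (B_iter_res _ _ Bx')) _.
  by rewrite ler_wpM2l // iter_res_le.
apply: le_trans (iter_dist (2 ^ k) (res_dist (b + b)) le1) _.
rewrite ger0_norm -?expr2 ?sqr_ge0 // -/P /b.
rewrite (_ : P * ((t / (P * 2)) ^+ 2 * norm x'') = (t ^+ 2 * norm x'' * (4 * P)^-1)); last first.
  by move: P P0 {b le1} => P P0; field; rewrite gt_eqF.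
rewrite ler_wpM2l ?sqr_hnorm_ge0 //.
have Pi : 0 < P^-1 by rewrite invr_gt0.
by rewrite !invfM; lra.
Qed.

Lemma approx_dist k m t x x' x'' : B x x' -> B x' x'' -> (k <= m)%N ->
  norm (approx k t x - approx m t x) <= t ^+ 2 * norm x'' * ((2 ^ k)%:R^-1 - (2 ^ m)%:R^-1).
Proof.
move=> Bx Bx' /subnK <-; elim: (m - k)%N => [|j IH].
  by rewrite !subrr (hnorm_zero dotP) mulr0.
apply: le_trans (hnorm_tri dotP _ (approx (j + k) t x) _) _.
apply: le_trans (lerD IH (approxS_le _ _ Bx Bx')) _.
by rewrite -mulrDr subrKA addSn.
Qed.

Lemma res_res_cvg x e : 0 < e -> exists2 s, 0 < s & norm (res s (res s x) - x) < e.
Proof.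
move=> e0; have e2 : 0 < e / 2 by rewrite divr_gt0.
have [s s0 hs] := res_cvg x e2; exists s => //.
apply: le_lt_trans (hnorm_tri dotP _ (res s x) _) _.
by have := res_dist s (res s x) x; lra.
Qed.

(** The rates of convergence involve [B^2 x], and the square of a resolvent maps into the domain of
    [B^2]. *)
Lemma dense2 x e : 0 < e -> exists y y' y'', [/\ B y y', B y' y'' & norm (x - y) < e].
Proof.
move=> e0; have [s s0 hs] := res_res_cvg x e0.
exists (res s (res s x)), (res s (dres s x)), (dres s (dres s x)).
have sn0 : s != 0 by rewrite gt_eqF.
by split; [exact/B_res_comm/B_res|exact: B_res|rewrite (hnorm_distC dotP)].
Qed.

Lemma iter_res_contr n s x y :
  norm (iter n (res s) x - iter n (res s) y) <= norm (x - y).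
Proof. by elim: n => //= n IH; exact: le_trans (res_dist _ _ _) IH. Qed.

Lemma approx_contr k t x y : norm (approx k t x - approx k t y) <= norm (x - y).
Proof. exact: iter_res_contr. Qed.

Lemma pow2_small e : 0 < e -> exists N, forall n, (N <= n)%N -> (2 ^ n)%:R^-1 < e :> R.
Proof.
move=> e0; have [M HM] : exists M : nat, e^-1 < M%:R.
  by exists (Num.bound e^-1); rewrite archi_boundP // invr_ge0 ltW.
exists M => n Mn; rewrite invf_plt ?posrE ?ltr0n ?expn_gt0 //.
apply: lt_le_trans HM _; rewrite ler_nat; apply: leq_trans Mn _.
by apply: ltnW; exact: ltn_expl.
Qed.

Lemma approx_cauchy t x e : 0 < e -> exists N, forall m n, (N <= m)%N -> (N <= n)%N ->
  norm (approx m t x - approx n t x) < e.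
Proof.
move=> e0; have e3 : 0 < e / 3 by rewrite divr_gt0.
have [y [y' [y'' [By By' xy]]]] := dense2 x e3.
pose K := t ^+ 2 * norm y'' + 1.
have K0 : 0 < K by rewrite ltr_pwDr ?ltr01 ?sqr_hnorm_ge0.
have [N HN] := pow2_small (divr_gt0 e3 K0).
have wl m n : (N <= m)%N -> (m <= n)%N -> norm (approx m t x - approx n t x) < e.
  move=> Nm mn; have h1 := approx_dist t By By' mn.
  have h2 : norm (approx m t y - approx n t y) < e / 3.
    apply: le_lt_trans h1 _; apply: le_lt_trans (_ : K * (2 ^ m)%:R^-1 < _); last first.
      by rewrite -ltr_pdivlMl // mulrC; exact: HN.
    rewrite ler_pM ?sqr_hnorm_ge0 ?subr_ge0 ?lerDl //.
      by rewrite lef_pV2 ?posrE ?ltr0n ?expn_gt0 // ler_nat leq_exp2l.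
    by rewrite gerBl invr_ge0.
  have h3 := approx_contr m t x y; have h4 := approx_contr n t y x.
  apply: le_lt_trans (hnorm_tri dotP _ (approx m t y) _) _.
  have := hnorm_tri dotP (approx m t y) (approx n t y) (approx n t x).
  by move: xy h2 h3 h4; rewrite (hnorm_distC dotP y x); lra.
exists N => m n Nm Nn; have [mn|/ltnW nm] := leqP m n; first exact: wl.
by rewrite (hnorm_distC dotP); exact: wl.
Qed.

Local Notation ncvg := (ncvg dot).

Definition grp t x : V := proj1_sig (cid (complete (approx_cauchy t x))).
Lemma approx_cvg t x : ncvg (fun k => approx k t x) (grp t x).
Proof. exact: (proj2_sig (cid (complete (approx_cauchy t x)))). Qed.

Lemma grp_linear t c x y : grp t (c *: x + y) = c *: grp t x + grp t y.
Proof.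
apply: (ncvg_unique dotP (approx_cvg t _)).
have := ncvg_linear dotP c (approx_cvg t x) (approx_cvg t y).
move=> H e /H [N HN]; exists N => n Nn; rewrite [approx n t _]iter_res_linear.
exact: HN.
Qed.

Lemma grp_le t x : norm (grp t x) <= norm x.
Proof. by apply: (ncvg_norm_le dotP (approx_cvg t x)) => n; exact: iter_res_le. Qed.

Lemma grpB t x y : grp t (x - y) = grp t x - grp t y.
Proof. by have := grp_linear t (-1) y x; rewrite !scaleN1r !(addrC (- _)). Qed.

Lemma grp_dist t x y : norm (grp t x - grp t y) <= norm (x - y).
Proof. by rewrite -grpB grp_le. Qed.

Lemma grp0 x : grp 0 x = x.
Proof.
apply: (ncvg_unique dotP (approx_cvg 0 x)) => e e0; exists 0%N => n _.
rewrite (_ : approx n 0 x = x) ?subrr ?(hnorm_zero dotP) // /approx mul0r.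
by elim: (2 ^ n)%N => //= k ->; exact: res0.
Qed.

Lemma iter_res_comm n a b x : iter n (res a) (res b x) = res b (iter n (res a) x).
Proof. by elim: n => //= n ->; exact: res_resC. Qed.

Lemma iter_res_comp n a b x :
  iter n (fun y => res a (res b y)) x = iter n (res a) (iter n (res b) x).
Proof. by elim: n => //= n ->; rewrite iter_res_comm. Qed.

(** Resolvents commute, so the composition is the iterate of a product of two resolvents;
    [res_add_le] bounds the error of each of the [2 ^ k] steps by [|t s| |x''| / 4 ^ k]. *)
Lemma approxD_le k t s x x' x'' : B x x' -> B x' x'' ->
  norm (approx k (t + s) x - approx k t (approx k s x)) <= `|t * s| * norm x'' * (2 ^ k)%:R^-1.
Proof.
move=> Bx Bx'; rewrite /approx -iter_res_comp; set n := (2 ^ k)%N.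
have P0 : 0 < n%:R :> R by rewrite ltr0n expn_gt0.
have le1 j : norm (res ((t + s) / n%:R) (iter j (fun y => res (t / n%:R) (res (s / n%:R) y)) x) -
   (fun y => res (t / n%:R) (res (s / n%:R) y)) (iter j (fun y => res (t / n%:R) (res (s / n%:R) y)) x)) <=
  `|t / n%:R * (s / n%:R)| * norm x''.
  rewrite mulrDl iter_res_comp.
  apply: le_trans (res_add_le _ _ (B_iter_res _ _ (B_iter_res _ _ Bx)) (B_iter_res _ _ (B_iter_res _ _ Bx'))) _.
  by rewrite ler_wpM2l // !(le_trans (iter_res_le _ _ _)) //; apply: le_trans (iter_res_le _ _ _) _.
apply: le_trans (iter_dist n (res_dist _) le1) _.
move: (n%:R) P0 {le1} => P P0; rewrite !normrM normfV (gtr0_norm P0).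
by rewrite le_eqVlt; apply/orP; left; apply/eqP; field; rewrite gt_eqF.
Qed.

Lemma grpD t s x : grp (t + s) x = grp t (grp s x).
Proof.
have D2 y y' y'' : B y y' -> B y' y'' -> grp (t + s) y = grp t (grp s y).
  move=> By By'; apply/eqP; rewrite -subr_eq0; apply/eqP/(hnorm_small dotP) => e e0.
  have c2 : ncvg (fun k => approx k t (approx k s y)) (grp t (grp s y)).
    move=> d d0; have d2 : 0 < d / 2 by rewrite divr_gt0.
    have [N1 H1] := approx_cvg s y d2; have [N2 H2] := approx_cvg t (grp s y) d2.
    exists (maxn N1 N2) => n; rewrite geq_max => /andP[/H1 {}H1 /H2 {}H2].
    apply: le_lt_trans (hnorm_tri dotP _ (approx n t (grp s y)) _) _.
    by have := approx_contr n t (approx n s y) (grp s y); lra.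
  apply: ncvg_dist (approx_cvg (t + s) y) c2 _ => //.
  pose K := `|t * s| * norm y'' + 1.
  have K0 : 0 < K by rewrite ltr_pwDr ?ltr01 // mulr_ge0 // hnorm_ge0.
  have [N HN] := pow2_small (divr_gt0 e0 K0).
  exists N => n /HN Hn; apply: le_trans (approxD_le _ _ _ By By') _.
  rewrite ltr_pdivlMr // in Hn; apply: le_trans (ltW Hn).
  by rewrite mulrC ler_wpM2l ?invr_ge0 // /K lerDl.
apply/eqP; rewrite -subr_eq0; apply/eqP/(hnorm_small dotP) => e e0.
have e2 : 0 < e / 2 by rewrite divr_gt0.
have [y [y' [y'' [By By' xy]]]] := dense2 x e2.
apply: le_trans (hnorm_tri dotP _ (grp (t + s) y) _) _.
rewrite [in X in _ + X](D2 _ _ _ By By').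
have h1 := grp_dist (t + s) x y; have h2 := grp_dist t (grp s y) (grp s x).
have h3 := grp_dist s y x; move: xy h1 h2 h3; rewrite (hnorm_distC dotP y x); lra.
Qed.

Lemma grpK t x : grp t (grp (- t) x) = x.
Proof. by rewrite -grpD subrr grp0. Qed.

(** [grp t] and its inverse [grp (- t)] are both contractions, since resolvents are available for
    both signs. *)
Lemma grp_norm t x : norm (grp t x) = norm x.
Proof.
apply/le_anti; rewrite grp_le /= -{1}(grpK (- t) x) opprK; exact: grp_le.
Qed.

(** The iterates are compared with those of the identity, from which one step differs by at most
    [|t / n| |x'|]. *)
Lemma grp_near t x x' : B x x' -> norm (grp t x - x) <= `|t| * norm x'.
Proof.
move=> Bx; apply: (ncvg_dist dotP (approx_cvg t x) (ncvg_cst dotP x)).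
exists 0%N => k _; rewrite /approx; set n := (2 ^ k)%N.
have P0 : 0 < n%:R :> R by rewrite ltr0n expn_gt0.
have iter_id j : iter j id x = x by elim: j => //= j ->.
have le1 j : norm (res (t / n%:R) (iter j id x) - id (iter j id x)) <= `|t / n%:R| * norm x'.
  by rewrite iter_id /= (res_comm _ Bx) (hnorm_scaler dotP) ler_wpM2l // res_le.
have := iter_dist n (res_dist _) le1; rewrite iter_id.
move: (n%:R) P0 {le1} => P P0; rewrite normrM normfV (gtr0_norm P0).
rewrite (_ : P * (`|t| / P * norm x') = `|t| * norm x') //.
by field; rewrite gt_eqF.
Qed.

Lemma grp_cont x e : 0 < e -> exists2 d, 0 < d & forall t, `|t| < d -> norm (grp t x - x) < e.
Proof.
move=> e0; have e3 : 0 < e / 3 by rewrite divr_gt0.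
have [y [y' [_ [By _ xy]]]] := dense2 x e3.
have K0 : 0 < norm y' + 1 by rewrite ltr_pwDr ?ltr01 ?hnorm_ge0.
exists (e / 3 / (norm y' + 1)); first by rewrite divr_gt0.
move=> t; rewrite ltr_pdivlMr // => td.
have h1 := grp_dist t x y; have h2 := grp_near t By.
have h3 := hnorm_tri dotP (grp t x) (grp t y) x.
have h4 := hnorm_tri dotP (grp t y) y x.
by have := normr_ge0 t; move: xy h1 h2 h3 h4; rewrite (hnorm_distC dotP y x); lra.
Qed.

(** Both [exp (t B) x] and [x + t B x] are within [t^2 |x''|] of the single step [res t x], the
    approximant with [k = 0]. *)
Lemma grp_taylor t x x' x'' : B x x' -> B x' x'' ->
  norm (grp t x - x - t%:C *: x') <= 2 * t ^+ 2 * norm x''.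
Proof.
move=> Bx Bx'.
have h1 : norm (grp t x - res t x) <= t ^+ 2 * norm x''.
  apply: (ncvg_dist dotP (approx_cvg t x) (ncvg_cst dotP (res t x))).
  exists 0%N => k _; rewrite (hnorm_distC dotP).
  have := approx_dist t Bx Bx' (leq0n k).
  rewrite {1}/approx expn0 divr1 /= => /le_trans; apply.
  by rewrite ler_piMr ?sqr_hnorm_ge0 // invr1 gerBl invr_ge0.
have h2 : norm (res t x - x - t%:C *: x') <= t ^+ 2 * norm x''.
  rewrite (res_comm _ Bx) -scalerBr (res_comm _ Bx') scalerA -rmorphM (hnorm_scaler dotP) -expr2.
  by rewrite ger0_norm ?sqr_ge0 // ler_wpM2l ?sqr_ge0 // res_le.
rewrite (_ : _ - _ = (grp t x - res t x) + (res t x - x - t%:C *: x')); last by lmod_ring R.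
by have := hnorm_add dotP (grp t x - res t x) (res t x - x - t%:C *: x'); lra.
Qed.

Definition diff_quot (U : R -> V -> V) t x := t^-1%:C *: (U t x - x).

(** The two-sided derivative at zero in real time; [generator] divides by [i t] instead, see
    [generator_i]. *)
Definition generates (U : R -> V -> V) x x' := forall e, 0 < e -> exists2 d, 0 < d &
  forall t, t != 0 -> `|t| < d -> norm (diff_quot U t x - x') < e.

Lemma diff_quotE U t x x' : t != 0 ->
  norm (U t x - x - t%:C *: x') = `|t| * norm (diff_quot U t x - x').
Proof.
move=> t0; rewrite -(hnorm_scaler dotP) /diff_quot scalerBr scalerA -rmorphM divff //.
by rewrite scale1r.
Qed.

(** The Taylor bound needs the domain of [B^2], so [x] is replaced by [res s x], whose image
    [res s x'] is close to [x']; the remainder [x - res s x] has a small image and [grp_near]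
    controls its difference quotient. *)
Lemma grp_generates x x' : B x x' -> generates grp x x'.
Proof.
move=> Bx e e0; have e3 : 0 < e / 3 by rewrite divr_gt0.
have [s s0 xs] := res_cvg x' e3.
have Bz := B_res_comm s Bx; have Bz' := B_res x' (lt0r_neq0 s0).
have K0 : 0 < 2 * norm (dres s x') + 1 by rewrite ltr_pwDr ?ltr01 // mulr_ge0 // hnorm_ge0.
exists (e / 3 / (2 * norm (dres s x') + 1)); first by rewrite divr_gt0.
move=> t t0; rewrite ltr_pdivlMr // => td.
have tp : 0 < `|t| by rewrite normr_gt0.
have h1 : norm (diff_quot grp t (x - res s x)) <= e / 3.
  rewrite (hnorm_scaler dotP) normfV ler_pdivrMl // (le_trans (grp_near _ (BB Bx Bz))) //.
  by rewrite ler_wpM2l // (hnorm_distC dotP) ltW.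
have h2 : norm (diff_quot grp t (res s x) - res s x') < e / 3.
  rewrite -(ltr_pM2l tp) -diff_quotE //.
  apply: le_lt_trans (grp_taylor _ Bz Bz') _.
  rewrite -[t ^+ 2]real_normK ?num_real // expr2.
  rewrite (_ : 2 * (`|t| * `|t|) * _ = `|t| * (`|t| * (2 * norm (dres s x')))); last by ring.
  by rewrite ltr_pM2l //; have := normr_ge0 t; nra.
have -> : diff_quot grp t x - x' = diff_quot grp t (x - res s x) +
    ((diff_quot grp t (res s x) - res s x') + (res s x' - x')).
  rewrite /diff_quot grpB; lmod_ring R.
have := hnorm_add dotP (diff_quot grp t (x - res s x)) ((diff_quot grp t (res s x) - res s x') + (res s x' - x')).
by have := hnorm_add dotP (diff_quot grp t (res s x) - res s x') (res s x' - x'); lra.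
Qed.

(** Since [1 - B] and [1 + B] are onto, there is no proper skew extension: solving
    [z - B z = x - x'], the vector [w = x - z] equals [x' - B z], so skewness makes it orthogonal to
    the range of [1 + B]. *)
Lemma B_maximal x x' : (forall y y', B y y' -> ip y' x = - ip y x') -> B x x'.
Proof.
move=> Hx; have Bz := B_res (x - x') (oner_neq0 R); have zE := resP 1 (x - x').
move: (res 1 _) (dres 1 _) Bz zE => z z' Bz zE.
have w_skew y y' : B y y' -> ip y' (x - z) = - ip y (x' - z').
  by move=> By; rewrite !(ipE dotP) (Hx _ _ By) (B_skew By Bz); ring.
have wE : x - z = x' - z'.
  apply/eqP; rewrite -subr_eq0; apply/eqP.
  transitivity ((x - x') - (z - 1%:C *: z')); last by rewrite zE subrr.
  lmod_ring R.
have w_zero w : (forall y y', B y y' -> ip y' w = - ip y w) -> w = 0.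
  move=> H; apply: (hnorm_eq0 dotP); apply/eqP; rewrite -sqrf_eq0 (hnorm_sqr dotP); apply/eqP.
  rewrite -{1}(resP (-1) w) (ipDl dotP) (ipNl dotP) (ipZl dotP) (H _ _ (B_res _ _)) ?oppr_eq0 ?oner_neq0 //.
  by ring.
have w0 : x - z = 0 by apply: w_zero => y y' By; rewrite (w_skew _ _ By) wE.
have -> : x = z by apply/eqP; rewrite -subr_eq0 w0.
suff -> : x' = z' by [].
by apply/eqP; rewrite -subr_eq0 -wE w0.
Qed.

Section IsometryGroup.
Variable U : R -> V -> V.
Hypothesis UB : forall t x y, U t (x - y) = U t x - U t y.
Hypothesis UZ : forall t s x, U t (s%:C *: x) = s%:C *: U t x.
Hypothesis U_ip : forall t x y, ip (U t x) (U t y) = ip x y.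
Hypothesis U0 : forall x, U 0 x = x.
Hypothesis U_add : forall t s x, U (t + s) x = U t (U s x).

Lemma U_norm t x : norm (U t x) = norm x.
Proof. by rewrite /hnorm -!/(ip _ _) U_ip. Qed.

Lemma U_adj t x y : ip (U t x) y = ip x (U (- t) y).
Proof. by rewrite -(U_ip (- t)) -U_add addNr U0. Qed.

(** The adjoint of the difference quotient at [t] is minus the one at [- t]; both are small-time
    quotients because the derivative is two-sided. *)
Lemma generates_skew x x' y y' : generates U x x' -> generates U y y' ->
  ip y' x = - ip y x'.
Proof.
move=> Ux Uy; apply/eqP; rewrite -subr_eq0 opprK -normr_eq0; apply/eqP/le_anti.
rewrite normr_ge0 andbT; apply/ler_addgt0Pl => e e0; rewrite addr0.
have K0 : 0 < norm x + norm y + 1 by rewrite ltr_pwDr ?ltr01 // addr_ge0 // hnorm_ge0.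
have [d1 d10 H1] := Ux _ (divr_gt0 e0 K0); have [d2 d20 H2] := Uy _ (divr_gt0 e0 K0).
pose t := Num.min d1 d2 / 2.
have t0 : 0 < t by rewrite divr_gt0 // lt_min d10.
have tm : t < Num.min d1 d2 by rewrite /t; have : 0 < Num.min d1 d2 by [rewrite lt_min d10|]; lra.
have := tm; rewrite lt_min => /andP[t1 t2].
have h1 := H1 (- t); rewrite oppr_eq0 gt_eqF // normrN gtr0_norm // in h1; have {}h1 := h1 isT t1.
have h2 := H2 t; rewrite gt_eqF // gtr0_norm // in h2; have {}h2 := h2 isT t2.
have E : ip (diff_quot U t y) x = - ip y (diff_quot U (- t) x).
  by rewrite /diff_quot !(ipE dotP) U_adj invrN; ring.
have -> : ip y' x + ip y x' = - ip (diff_quot U t y - y') x - ip y (diff_quot U (- t) x - x').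
  by rewrite (ipDl dotP) (ipDr dotP) (ipNl dotP) (ipNr dotP) E; ring.
apply: le_trans (ler_normB _ _) _; rewrite normrN.
have k1 := norm_ip_le dotP (diff_quot U t y - y') x.
have k2 := norm_ip_le dotP y (diff_quot U (- t) x - x').
have x0 := hnorm_ge0 dot x; have y0 := hnorm_ge0 dot y.
apply: le_trans (lerD k1 k2) _.
apply: le_trans (lerD (ler_wpM2r x0 (ltW h2)) (ler_wpM2l y0 (ltW h1))) _.
rewrite [norm y * _]mulrC -mulrDr mulrAC ler_pdivrMr // ler_wpM2l ?ltW //.
by rewrite ltrDl.
Qed.

Hypothesis U_gen : forall x x', B x x' <-> generates U x x'.

Lemma B_group t x x' : B x x' -> B (U t x) (U t x').
Proof.
move=> /U_gen Ux; apply/U_gen => e /Ux [d d0 H]; exists d => // s s0 sd.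
have -> : diff_quot U s (U t x) = U t (diff_quot U s x).
  by rewrite /diff_quot UZ UB -!U_add [s + t]addrC.
by rewrite -UB U_norm; exact: H.
Qed.

Lemma res_group s t x : res s (U t x) = U t (res s x).
Proof.
have [->|s0] := eqVneq s 0; first by rewrite !res0.
symmetry; apply: (res_unique (B_group t (B_res x s0))).
by rewrite -UZ -UB resP.
Qed.

(** [res_cvg] provides one parameter; by the monotonicity in [res_diff_le] all smaller ones do as
    well. *)
Lemma res_small x e : 0 < e -> exists2 d, 0 < d & forall t, 0 < t -> t < d -> norm (res t x - x) < e.
Proof.
move=> /(res_cvg x) [d d0 xd]; exists d => // t t0 td; apply: le_lt_trans xd.
rewrite -(@ler_pXn2r _ 2) ?nnegrE ?hnorm_ge0 // -subr_ge0.
by apply: le_trans (res_diff_le x t0 (ltW td)); rewrite sqr_ge0.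
Qed.

Lemma iter_group n t x : iter n (U t) x = U (n%:R * t) x.
Proof.
elim: n => [|n IH] /=; first by rewrite mul0r U0.
by rewrite IH -U_add -[in RHS]addn1 natrD mulrDl mul1r addrC.
Qed.

(** Any isometry group generated by [B] is approximated by resolvent iterates, without identifying
    it with [grp]: for a small step both [U s x] and [res s x] agree with [x + s x'] up to a small
    multiple of [s]. *)
Lemma group_res_iter t x x' e : 0 < t -> 0 < e -> B x x' ->
  exists n, norm (U t x - iter n (res (t / n%:R)) x) <= e.
Proof.
move=> t0 e0 Bx; have et : 0 < e / t / 2 by rewrite !divr_gt0.
have [d1 d10 H1] := res_small x' et.
have [d2 d20 H2] := (U_gen x x').1 Bx _ et.
have dm : 0 < Num.min d1 d2 by rewrite lt_min d10.
have [n] : exists n : nat, t / Num.min d1 d2 < n%:R.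
  by exists (Num.bound (t / Num.min d1 d2)); rewrite archi_boundP // divr_ge0 // ltW.
exists n; have n0 : 0 < n%:R :> R by apply: lt_trans p; rewrite divr_gt0.
set s := t / n%:R.
have s0 : 0 < s by rewrite divr_gt0.
have sm : s < Num.min d1 d2 by rewrite ltr_pdivrMr // mulrC -ltr_pdivrMr.
move: sm; rewrite lt_min => /andP[s1 s2].
have -> : U t x = iter n (U s) x.
  by rewrite iter_group /s; congr U; field; rewrite gt_eqF.
have Us : norm (U s x - x - s%:C *: x') <= s * (e / t / 2).
  rewrite diff_quotE ?gt_eqF // gtr0_norm // ler_wpM2l ?ltW //.
  by apply: H2; rewrite ?gt_eqF // gtr0_norm.
have Rs : norm (res s x - x - s%:C *: x') <= s * (e / t / 2).
  by rewrite (res_comm _ Bx) -scalerBr (hnorm_scaler dotP) gtr0_norm // ler_wpM2l ?ltW // H1.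
(* Resolvents commute with the group, so the error at a point of the orbit is the isometric image of
   the error at [x]. *)
have le1 k : norm (res s (iter k (U s) x) - U s (iter k (U s) x)) <= s * (e / t).
  rewrite iter_group res_group -U_add [s + _]addrC U_add -UB U_norm.
  have -> : res s x - U s x = (res s x - x - s%:C *: x') - (U s x - x - s%:C *: x') by lmod_ring R.
  apply: le_trans (hnorm_add dotP _ _) _; rewrite (hnorm_opp dotP).
  by have := lerD Rs Us; lra.
have := iter_dist n (res_dist s) le1; rewrite (hnorm_distC dotP) => /le_trans; apply.
by rewrite le_eqVlt; apply/orP; left; apply/eqP; rewrite /s; field; rewrite !gt_eqF.
Qed.

(* The projection [Q] is decreased by the resolvents, hence by the group. *)
Lemma group_contraction (Q : V -> V) t x :
  (forall x y, Q (x - y) = Q x - Q y) ->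
  (forall s x, Q (s%:C *: x) = s%:C *: Q x) ->
  (forall x, norm (Q x) <= norm x) ->
  (forall x x', B x x' -> ip (Q x') (Q x) <= 0) ->
  0 < t -> norm (Q (U t x)) <= norm (Q x).
Proof.
move=> QB QZ Qle Qdiss t0.
(* [Q y] is [Q (res s y) - s Q (dres s y)], and the cross term of its square has the favourable sign
   by [Qdiss]. *)
have Qres s y : 0 < s -> norm (Q (res s y)) <= norm (Q y).
  move=> s0; have By := B_res y (lt0r_neq0 s0).
  rewrite -(@ler_pXn2r _ 2) ?nnegrE ?hnorm_ge0 //.
  rewrite -{2}(resP s y) QB QZ !(hnorm_sqr dotP) !(ipE dotP).
  rewrite (ipC dotP (Q (res s y)) (Q (dres s y))).
  have := Qdiss _ _ By; have := dot_ge0 dotP (Q (dres s y)); rewrite -/(ip _ _).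
  by move=> ? ?; nra.
have Qiter n s y : 0 < s -> norm (Q (iter n (res s) y)) <= norm (Q y).
  by move=> s0; elim: n => //= n IH; exact: le_trans (Qres _ _ s0) IH.
have QD y y' : B y y' -> norm (Q (U t y)) <= norm (Q y).
  move=> By; apply/ler_addgt0Pl => e e0.
  have [n Hn] := group_res_iter t0 e0 By.
  have := hnorm_tri dotP (Q (U t y)) (Q (iter n (res (t / n%:R)) y)) 0.
  rewrite !subr0 -QB => /le_trans; apply; apply: lerD; first exact: le_trans (Qle _) Hn.
  have [->|n0] := posnP n; first by [].
  by apply: Qiter; rewrite divr_gt0 // ltr0n.
apply/ler_addgt0Pl => e e0; have e2 : 0 < e / 2 by rewrite divr_gt0.
have [y [y' [_ [By _ xy]]]] := dense2 x e2.
have h1 := QD _ _ By.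
have h2 : norm (Q (U t x - U t y)) <= norm (x - y) by rewrite (le_trans (Qle _)) // -UB U_norm.
have h3 := Qle (y - x).
have h4 := hnorm_tri dotP (Q (U t x)) (Q (U t y)) 0.
have h5 := hnorm_tri dotP (Q y) (Q x) 0.
move: h2 h3 h4 h5; rewrite !QB !subr0 (hnorm_distC dotP y x); lra.
Qed.
End IsometryGroup.

End SkewAdjoint.

(** * Norm limits in epsilon-delta form *)

Section NormLimits.
Variables (R : realType) (V : lmodType R[i]) (dot : V -> V -> R[i]).
Local Notation norm := (hnorm dot).

Lemma norm_cvg_within (D : set R) (s : R) (u : R -> V) l :
  norm_cvg dot (within D (nbhs s)) u l <->
  forall e : R, 0 < e -> exists2 d : R, 0 < d &
    forall t, D t -> `|t - s| < d -> norm (u t - l) < e.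
Proof.
split.
  move=> /cvgrPdist_lt H e /H; rewrite near_withinE => /nbhs_ballP[d /= d0 Hd].
  exists d => // t Dt td; have := Hd t; rewrite /ball /= distrC => /(_ td Dt).
  by rewrite sub0r normrN ger0_norm ?hnorm_ge0.
move=> H; apply/cvgrPdist_lt => e /H[d d0 Hd]; rewrite near_withinE.
apply/nbhs_ballP; exists d => //= t; rewrite /ball /= distrC => td Dt.
by rewrite sub0r normrN ger0_norm ?hnorm_ge0 // Hd.
Qed.

Lemma norm_cvg_nbhs (s : R) (u : R -> V) l :
  norm_cvg dot (nbhs s) u l <->
  forall e : R, 0 < e -> exists2 d : R, 0 < d & forall t, `|t - s| < d -> norm (u t - l) < e.
Proof.
split.
  move=> H; have /(norm_cvg_within setT) HT : norm_cvg dot (within setT (nbhs s)) u l.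
    exact: cvg_within_filter H.
  by move=> e /HT[d d0 Hd]; exists d => // t; exact: Hd.
move=> H; apply/cvgrPdist_lt => e /H[d d0 Hd].
apply/nbhs_ballP; exists d => //= t; rewrite /ball /= distrC => td.
by rewrite sub0r normrN ger0_norm ?hnorm_ge0 // Hd.
Qed.

Lemma norm_cvg_dnbhs (u : R -> V) l :
  norm_cvg dot 0^' u l <->
  forall e : R, 0 < e -> exists2 d : R, 0 < d &
    forall t, t != 0 -> `|t| < d -> norm (u t - l) < e.
Proof.
split=> [/norm_cvg_within H e /H[d d0 Hd]|H].
  by exists d => // t t0 td; apply: Hd; rewrite ?subr0.
apply/norm_cvg_within => e /H[d d0 Hd].
by exists d => // t t0; rewrite subr0; exact: Hd.
Qed.

Lemma norm_cvg_right (u : R -> V) l :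
  norm_cvg dot 0^'+ u l <->
  forall e : R, 0 < e -> exists2 d : R, 0 < d &
    forall t, 0 < t -> t < d -> norm (u t - l) < e.
Proof.
split=> [/norm_cvg_within H e /H[d d0 Hd]|H].
  by exists d => // t t0 td; apply: Hd; rewrite ?subr0 ?gtr0_norm.
apply/norm_cvg_within => e /H[d d0 Hd].
by exists d => // t /= t0; rewrite subr0 gtr0_norm //; exact: Hd.
Qed.
End NormLimits.

Section Stone.
Variables (R : realType) (V : lmodType R[i]) (dot : V -> V -> R[i]).
Hypothesis dotP : inner_product dot.
Hypothesis complete : norm_complete dot.
Variable A : V -> V -> Prop.
Hypothesis A_linear : forall a x x' y y',
  A x x' -> A y y' -> A (a *: x + y) (a *: x' + y').
Hypothesis A0 : A 0 0.
Hypothesis A_fun : forall x', A 0 x' -> x' = 0.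
Hypothesis A_sym : forall x x' y y', A x x' -> A y y' -> dot x' y = dot x y'.
Hypothesis A_onto : forall (s : R) z, s != 0 -> exists x x', A x x' /\ x - ('i%C * s%:C) *: x' = z.
Local Notation norm := (hnorm dot).
Local Notation ip := (ip dot).

(** The graph of [i A]. *)
Let B x x' := A x (- 'i%C *: x').

Lemma i_neq0 : 'i%C != 0 :> R[i].
Proof. by apply/eqP => /(congr1 (@complex.Im R)) /= /eqP; rewrite oner_eq0. Qed.

Lemma ii : 'i%C * 'i%C = -1 :> R[i].
Proof. by rewrite -expr2 sqr_i. Qed.

Lemma iA x x' : A x x' <-> B x ('i%C *: x').
Proof. by rewrite /B scalerA mulNr ii opprK scale1r. Qed.

Let B_linear a x x' y y' : B x x' -> B y y' -> B (a *: x + y) (a *: x' + y').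
Proof.
move=> Bx By; rewrite /B (_ : - 'i%C *: (a *: x' + y') = a *: (- 'i%C *: x') + - 'i%C *: y').
  exact: A_linear.
lmod_ring R.
Qed.
Let B0 : B 0 0. Proof. by rewrite /B scaler0. Qed.
Let B_fun x' : B 0 x' -> x' = 0.
Proof.
move=> /A_fun /eqP; rewrite scaler_eq0 oppr_eq0 (negbTE i_neq0) /=.
by move/eqP.
Qed.
Let B_skew x x' y y' : B x x' -> B y y' -> ip x' y = - ip x y'.
Proof.
move=> Bx By; have := A_sym Bx By; rewrite (dotZl dotP) (dotZr dotP) /ip.
by move/(congr1 (@complex.Im R)); rewrite !complexE_parts /=; lra.
Qed.
Let B_onto (s : R) z : s != 0 -> exists x x', B x x' /\ x - s%:C *: x' = z.
Proof.
move=> s0; have [x [x' [Ax xz]]] := A_onto z s0; exists x, ('i%C *: x'); split; first by case: (iA x x') => + _; apply.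
by rewrite scalerA mulrC.
Qed.

(** An element of the graph of the adjoint is skew against the graph of [i A], so [B_maximal] puts
    it into the graph. *)
Lemma stone_selfadjoint : selfadjoint dot A.
Proof.
split=> [x e e0|x x'].
  have [y [y' [_ [By _ xy]]]] := dense2 dotP complete B_linear B0 B_fun B_skew B_onto x e0.
  by exists y, (- 'i%C *: y').
split=> [Ax y y' Ay|adj]; first exact: A_sym.
apply: (iA x x').2; apply: (B_maximal dotP B_skew B_onto) => y y' By.
have := adj _ _ By; rewrite (dotZl dotP) /ip (dotZr dotP).
by move/(congr1 (@complex.Im R)); rewrite !complexE_parts /=; lra.
Qed.

Lemma generator_i (U : R -> V -> V) x x' :
  generator dot 0^' U x x' <-> generates dot U x ('i%C *: x').
Proof.
have E t : norm (('i%C * t%:C)^-1 *: (U t x - x) - x') = norm (diff_quot U t x - 'i%C *: x').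
  have -> : diff_quot U t x - 'i%C *: x' = 'i%C *: (('i%C * t%:C)^-1 *: (U t x - x) - x').
    rewrite scalerBr scalerA invfM mulrA divff ?i_neq0 // mul1r.
    by rewrite /diff_quot fmorphV.
  by rewrite (hnorm_scale dotP) modulus_i mul1r.
rewrite /generator; split => [/norm_cvg_dnbhs H e /H[d d0 Hd]|H].
  by exists d => // t t0 td; rewrite -E; exact: Hd.
apply/norm_cvg_dnbhs => e /H[d d0 Hd].
by exists d => // t t0 td; rewrite E; exact: Hd.
Qed.

Lemma dot_isometry (T : V -> V) :
  (forall a x y, T (a *: x + y) = a *: T x + T y) ->
  (forall x, norm (T x) = norm x) -> forall x y, dot (T x) (T y) = dot x y.
Proof.
move=> Tlin Tn.
have TD x y : T (x + y) = T x + T y by have := Tlin 1 x y; rewrite !scale1r.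
have T0 : T 0 = 0 by apply: (hnorm_eq0 dotP); rewrite Tn (hnorm_zero dotP).
have TZ a x : T (a *: x) = a *: T x by have := Tlin a x 0; rewrite T0 !addr0.
have Tip x y : ip (T x) (T y) = ip x y by rewrite !(polarization dotP) -TD !Tn.
by move=> x y; rewrite !(dot_ipE dotP) -TZ !Tip.
Qed.

Lemma stone_group : exists U, is_exp_group dot A U.
Proof.
pose U := grp dotP complete B_linear B0 B_fun B_skew B_onto.
have Ulin t a x y : U t (a *: x + y) = a *: U t x + U t y by exact: grp_linear.
have Uadd t s x : U (t + s) x = U t (U s x) by exact: grpD.
have U0 x : U 0 x = x by exact: grp0.
have UB t x y : U t (x - y) = U t x - U t y by exact: grpB.
have Unorm t x : norm (U t x) = norm x by exact: grp_norm.
have Udot t x y : dot (U t x) (U t y) = dot x y by exact: dot_isometry.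
exists U; split.
  split=> [s|//|//|s x].
  - split=> // y; exists (U (- s) y); exact: grpK.
  - apply/norm_cvg_nbhs => e e0.
    have [d d0 Hd] := grp_cont dotP complete B_linear B0 B_fun B_skew B_onto x e0.
    exists d => // t td; have -> : U t x = U s (U (t - s) x) by rewrite -Uadd subrKC.
    by rewrite -UB Unorm; exact: Hd.
move=> x x'; rewrite generator_i iA; split; first exact: grp_generates.
(* A vector differentiable along the group is skew against the domain of [B], hence belongs to it by
   maximality. *)
move=> Ux; apply: (B_maximal dotP B_skew B_onto) => y y' By.
have Uy : generates dot U y y' by exact: grp_generates.
apply: (generates_skew dotP _ _ _ Ux Uy) => //.
by move=> t u v; rewrite /ip Udot.
Qed.

(** The complex form of [group_contraction]: the real part of [(Q (i A) x, Q x)] is minus the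
    imaginary part of [(Q A x, Q x)]. The group is arbitrary since [exp_i] is known only through
    [is_exp_group]. *)
Lemma exp_group_decay (U : R -> V -> V) (Q : V -> V) (t : R) x :
  is_exp_group dot A U ->
  (forall a x y, Q (a *: x + y) = a *: Q x + Q y) ->
  (forall x, norm (Q x) <= norm x) ->
  (forall x x', A x x' -> Im (dot (Q x') (Q x)) >= 0) ->
  0 <= t -> norm (Q (U t x)) <= norm (Q x).
Proof.
move=> [[Uu U0 Uadd _] Ugen] Qlin Qle Qdiss.
rewrite le_eqVlt => /orP[/eqP <-|]; first by rewrite U0.
have lin0 (T : V -> V) : (forall a x y, T (a *: x + y) = a *: T x + T y) -> T 0 = 0.
  by move=> Tl; have := Tl (-1) 0 0; rewrite scaler0 addr0 scaleN1r addNr.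
have linZ (T : V -> V) : (forall a x y, T (a *: x + y) = a *: T x + T y) ->
    forall a x, T (a *: x) = a *: T x.
  by move=> Tl a y; have := Tl a y 0; rewrite (lin0 T Tl) !addr0.
have linB (T : V -> V) : (forall a x y, T (a *: x + y) = a *: T x + T y) ->
    forall x y, T (x - y) = T x - T y.
  by move=> Tl y z; rewrite addrC -scaleN1r Tl scaleN1r addrC.
have Ulin s : forall a x y, U s (a *: x + y) = a *: U s x + U s y by case: (Uu s).
have UB s u v : U s (u - v) = U s u - U s v by exact: linB.
have UZ s (c : R) u : U s (c%:C *: u) = c%:C *: U s u by exact: linZ.
have Uip s u v : ip (U s u) (U s v) = ip u v by rewrite /ip; case: (Uu s) => _ ->.
have BU u u' : B u u' <-> generates dot U u u'.
  rewrite [X in X <-> _](_ : _ = A u (- 'i%C *: u')) // Ugen generator_i.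
  by rewrite scalerA mulrN ii opprK scale1r.
have Qi u u' : B u u' -> ip (Q u') (Q u) <= 0.
  move=> /Qdiss; rewrite (linZ Q Qlin) (dotZl dotP) /ip !complexE_parts /=; lra.
exact: (group_contraction dotP complete B_linear B0 B_fun B_skew B_onto UB UZ Uip U0 Uadd BU x
  (linB Q Qlin) (fun c => linZ Q Qlin c%:C) Qle Qi).
Qed.
End Stone.

(** * Closed ranges and orthogonal projection *)

Section ClosedRange.
Variables (R : realType) (V : lmodType R[i]) (dot : V -> V -> R[i]).
Hypothesis dotP : inner_product dot.
Hypothesis complete : norm_complete dot.
Variable A : V -> V -> Prop.
Hypothesis A_linear : forall a x x' y y',
  A x x' -> A y y' -> A (a *: x + y) (a *: x' + y').
Hypothesis A0 : A 0 0.
Variable c : R.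
Hypothesis c_gt0 : 0 < c.
Hypothesis A_below : forall x x', A x x' -> c * hnorm dot x <= hnorm dot x'.
Hypothesis A_closed : forall (u v : nat -> V) x x', (forall n, A (u n) (v n)) ->
  ncvg dot u x -> ncvg dot v x' -> A x x'.
Hypothesis A_dense : forall z, (forall x x', A x x' -> dot x' z = 0) -> z = 0.
Local Notation norm := (hnorm dot).
Local Notation ip := (ip dot).

(** The point [g] of the range nearest to [f] exists because the range is closed; [f - g] is
    orthogonal to the range, so it vanishes. *)
Lemma closed_range_onto f : exists x, A x f.
Proof.
pose D := [set norm (f - g) ^+ 2 | g in [set g | exists x, A x g]].
have infD : has_inf D.
  by split; [exists (norm (f - 0) ^+ 2), 0 => //; exists 0|exists 0 => _ [g _ <-]; exact: sqr_ge0].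
have Dle x g : A x g -> inf D <= norm (f - g) ^+ 2.
  by move=> Axg; apply: ge_inf; [case: infD|exists g => //; exists x].
have S0 n : 0 < n.+1%:R^-1 :> R by rewrite invr_gt0 ltr0n.
have ex n : exists xg : V * V, A xg.1 xg.2 /\ norm (f - xg.2) ^+ 2 < inf D + n.+1%:R^-1.
  by have [_ [g [x Axg] <-] H] := inf_adherent (S0 n) infD; exists (x, g).
pose u n := proj1_sig (cid (ex n)); have uP n := proj2_sig (cid (ex n)).
(* The parallelogram law, with the midpoint of [g] and [k] again in the range. *)
have near_inf x g y k (a b : R) : A x g -> A y k -> norm (f - g) ^+ 2 <= inf D + a ->
    norm (f - k) ^+ 2 <= inf D + b -> norm (g - k) ^+ 2 <= 2 * a + 2 * b.
  move=> Ax Ay xa yb.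
  have Am : A (2^-1%:C *: x + 2^-1%:C *: y) (2^-1%:C *: g + 2^-1%:C *: k).
    by apply: A_linear => //; have := A_linear 2^-1%:C Ay A0; rewrite !addr0.
  have := Dle _ _ Am; move: xa yb; rewrite !(hnorm_sqr dotP) !(ipE dotP).
  by rewrite (ipC dotP g f) (ipC dotP k f) (ipC dotP k g); lra.
have cau m n : norm ((u m).2 - (u n).2) ^+ 2 <= 2 * m.+1%:R^-1 + 2 * n.+1%:R^-1.
  by have [Am /ltW Hm] := uP m; have [An /ltW Hn] := uP n; exact: near_inf Am An Hm Hn.
have small (e : R) : 0 < e -> exists N, forall m n, (N <= m)%N -> (N <= n)%N ->
    norm ((u m).2 - (u n).2) < e.
  move=> e0; have d0 : 0 < e ^+ 2 / 4 by rewrite divr_gt0 // exprn_gt0.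
  have [N HN] : exists N : nat, (e ^+ 2 / 4)^-1 < N%:R.
    by exists (Num.bound (e ^+ 2 / 4)^-1); rewrite archi_boundP // invr_ge0 ltW.
  have lt1 m : (N <= m)%N -> m.+1%:R^-1 < e ^+ 2 / 4.
    move=> Nm; rewrite invf_plt ?posrE ?ltr0n //; apply: lt_le_trans HN _.
    by rewrite ler_nat ltnW.
  exists N => m n /lt1 hm /lt1 hn.
  rewrite -(@ltr_pXn2r _ 2) ?nnegrE ?hnorm_ge0 ?(ltW e0) //.
  apply: le_lt_trans (cau m n) _.
  by move: (m.+1%:R^-1) (n.+1%:R^-1) hm hn => a b; lra.
have [g ug] := complete small.
(* The lower bound on [A] carries the Cauchy property of the images back to the preimages. *)
have [x ux] : exists x, ncvg dot (fun n => (u n).1) x.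
  apply: complete => e e0; have [N HN] := small _ (mulr_gt0 c_gt0 e0).
  exists N => m n Nm Nn; have := HN m n Nm Nn.
  have Amn : A ((u m).1 - (u n).1) ((u m).2 - (u n).2).
    have [Am _] := uP m; have [An _] := uP n.
    have -> : (u m).1 - (u n).1 = -1 *: (u n).1 + (u m).1 by lmod_ring R.
    have -> : (u m).2 - (u n).2 = -1 *: (u n).2 + (u m).2 by lmod_ring R.
    exact: A_linear.
  by move=> /(le_lt_trans (A_below Amn)); rewrite ltr_pM2l.
have Axg : A x g by apply: A_closed ux ug => n; case: (uP n).
suff fg : f - g = 0 by exists x; move/eqP: fg; rewrite subr_eq0 => /eqP ->.
have minD : norm (f - g) ^+ 2 <= inf D.
  apply/ler_addgt0Pl => e e0.
  have H2 n : norm (f - g) <= norm (f - (u n).2) + norm ((u n).2 - g) by exact: hnorm_tri.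
  have bound n : norm (f - (u n).2) ^+ 2 <= inf D + n.+1%:R^-1 by case: (uP n) => _ /ltW.
  pose M := norm (f - g) + 1 + norm (f - g) + 1.
  have M0 : 0 < M by rewrite /M; have := hnorm_ge0 dot (f - g); lra.
  have d0 : 0 < Num.min 1 (e / 2 / M) by rewrite lt_min ltr01 !divr_gt0.
  have [N1 H1] := ug _ d0.
  have [N3 HN] : exists N : nat, (e / 2)^-1 < N%:R.
    by exists (Num.bound (e / 2)^-1); rewrite archi_boundP // invr_ge0 ltW // divr_gt0.
  pose n := maxn N1 N3.
  have {H1} := H1 n (leq_maxl _ _); rewrite lt_min => /andP[h1 h2].
  have lt3 : n.+1%:R^-1 < e / 2.
    rewrite invf_plt ?posrE ?ltr0n ?divr_gt0 //; apply: lt_le_trans HN _.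
    by rewrite ler_nat ltnW // ltnS leq_maxr.
  have := bound n; have := H2 n; have := hnorm_tri dotP f g (u n).2.
  rewrite (hnorm_distC dotP g); rewrite ltr_pdivlMr // in h2.
  have p0 := hnorm_ge0 dot (f - g); have q0 := hnorm_ge0 dot ((u n).2 - g).
  have r0 := hnorm_ge0 dot (f - (u n).2).
  rewrite /M in h2.
  move: (norm (f - g)) (norm (f - (u n).2)) (norm ((u n).2 - g)) p0 q0 r0 h1 h2 => p r q p0 q0 r0 h1 h2 pq rp.
  move: (n.+1%:R^-1) lt3 => a lt3 ra.
  suff : p ^+ 2 <= r ^+ 2 + q * (p + 1 + p + 1) by lra.
  have a1 : (p + r) * (p - r) <= (p + r) * q by rewrite ler_wpM2l //; lra.
  have a2 : q * (p + r) <= q * (p + 1 + p + 1) by rewrite ler_wpM2l //; lra.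
  by rewrite !expr2; lra.
apply: A_dense => y y' Ay.
have ip0 z z' : A z z' -> ip z' (f - g) = 0.
  move=> Az; rewrite (ipC dotP); set b := ip (f - g) z'; set n := norm z' ^+ 2.
  have n0 : 0 <= n by exact: sqr_ge0.
  have ineq t : 0 <= - 2 * t * b + t ^+ 2 * n.
    have Ag : A (t%:C *: z + x) (t%:C *: z' + g) by exact: A_linear.
    have := le_trans minD (Dle _ _ Ag).
    have -> : f - (t%:C *: z' + g) = (f - g) - t%:C *: z' by lmod_ring R.
    rewrite /n !(hnorm_sqr dotP) /b (ipDl dotP (f - g)) (ipDr dotP (f - g)) (ipDr dotP (f - g)).
    by rewrite !(ipNl dotP (_ *: z')) !(ipNr dotP (_ *: z')) !(ipZl dotP t) !(ipZr dotP t) (ipC dotP z' (f - g)); lra.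
  have n1 : 0 < n + 1 by lra.
  (* The optimal choice would be [b / n]; [n + 1] also covers [n = 0] and still gives
     [b ^ 2 (n + 2) <= 0]. *)
  have := ineq (b / (n + 1)).
  rewrite (_ : _ + _ = - (b ^+ 2 * (n + 2) / (n + 1) ^+ 2)); last by field; rewrite gt_eqF.
  rewrite oppr_ge0 pmulr_lle0 ?invr_gt0 ?exprn_gt0 // pmulr_lle0; last by lra.
  by move=> b2; apply/eqP; rewrite -sqrf_eq0; apply/eqP/le_anti; rewrite b2 sqr_ge0.
(* The imaginary part of the product is the real part obtained from [i y]. *)
apply: complex_eq; first by rewrite -/(ip _ _) (ip0 _ _ Ay).
have Aiy : A ('i%C *: y) ('i%C *: y') by have := A_linear 'i%C Ay A0; rewrite !addr0.
by have := ip0 _ _ Aiy; rewrite /ip (dotZl dotP) !complexE_parts /=; lra.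
Qed.
End ClosedRange.

(** * The Hilbert space of lattice functions *)

Section ComplexLimits.
Variable R : realType.
Local Notation C := R[i].
Implicit Types (u v : nat -> C) (l m : C).

(** Splitting into real limits gives access to the order; [ccvg_Co] links it to the topology of
    [C^o] used by [at_zero] and [jackson]. *)
Definition ccvg u l := ((fun n => Re (u n)) @ \oo --> Re l) /\ ((fun n => Im (u n)) @ \oo --> Im l).

Lemma ccvg_Co u l : ccvg u l <-> (u : nat -> C^o) @ \oo --> (l : C^o).
Proof.
split=> [[ur ui]|ul].
  apply/cvgrPdist_lt => e; rewrite ltcE /= => /andP[/eqP ei er].
  have e2 : 0 < Re e / 2 by rewrite divr_gt0.
  near=> n.
  have hr : `|Re l - Re (u n)| < Re e / 2.
    by near: n; move/cvgrPdist_lt : ur => /(_ _ e2).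
  have hi : `|Im l - Im (u n)| < Re e / 2.
    by near: n; move/cvgrPdist_lt : ui => /(_ _ e2).
  rewrite normc_def ltcE /= ei eqxx /=.
  rewrite -[ltLHS]/(modulus (Complex _ _)).
  apply: le_lt_trans (modulus_le_parts _) _.
  by move: hr hi; rewrite -cReN -cReD -cImN -cImD /=; lra.
have H (e : R) : 0 < e -> \forall n \near \oo, modulus (l - u n) < e.
  move=> e0; move/cvgrPdist_lt : ul => /(_ e%:C); rewrite ltcR => /(_ e0).
  by apply: filterS => n; rewrite normc_def ltcR; case: (l - u n).
by split; apply/cvgrPdist_lt => e /H; apply: filterS => n; apply: le_lt_trans;
  rewrite -?cReN -?cReD -?cImN -?cImD ?Re_le_modulus ?Im_le_modulus.
Unshelve. all: by end_near. Qed.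

Lemma ccvg_unique u l m : ccvg u l -> ccvg u m -> l = m.
Proof.
move=> [ur ui] [vr vi]; apply: complex_eq.
  by apply: (cvg_unique (@Rhausdorff R) ur vr).
by apply: (cvg_unique (@Rhausdorff R) ui vi).
Qed.

Lemma ccvgD u v l m : ccvg u l -> ccvg v m -> ccvg (fun n => u n + v n) (l + m).
Proof.
move=> [ur ui] [vr vi]; split.
  by rewrite cReD; under eq_fun do rewrite cReD; exact: cvgD.
by rewrite cImD; under eq_fun do rewrite cImD; exact: cvgD.
Qed.

Lemma ccvgM u v l m : ccvg u l -> ccvg v m -> ccvg (fun n => u n * v n) (l * m).
Proof.
move=> [ur ui] [vr vi]; split.
  by rewrite cReM; under eq_fun do rewrite cReM; apply: cvgB; apply: cvgM.
by rewrite cImM; under eq_fun do rewrite cImM; apply: cvgD; apply: cvgM.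
Qed.

Lemma ccvgJ u l : ccvg u l -> ccvg (fun n => conjc (u n)) (conjc l).
Proof.
move=> [ur ui]; split.
  by rewrite cReJ; under eq_fun do rewrite cReJ.
by rewrite cImJ; under eq_fun do rewrite cImJ; exact: cvgN.
Qed.

Lemma ccvg_cst l : ccvg (fun=> l) l.
Proof. by split; exact: cvg_cst. Qed.

Lemma ccvgZ c u l : ccvg u l -> ccvg (fun n => c * u n) (c * l).
Proof. exact/ccvgM/ccvg_cst. Qed.

Lemma ccvgN u l : ccvg u l -> ccvg (fun n => - u n) (- l).
Proof. by move=> /(ccvgZ (-1)); rewrite mulN1r; under eq_fun do rewrite mulN1r. Qed.

Lemma ccvgB u v l m : ccvg u l -> ccvg v m -> ccvg (fun n => u n - v n) (l - m).
Proof. by move=> ul /ccvgN; exact: ccvgD. Qed.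

Lemma ccvg_lim u l : ccvg u l -> limn (u : nat -> C^o) = l.
Proof. by move=> /ccvg_Co; apply: cvg_lim; exact: norm_hausdorff. Qed.

Lemma ccvg_shift u l : ccvg u l -> ccvg (fun n => u n.+1) l.
Proof.
by move=> [ur ui]; split;
  [rewrite (cvg_shiftS (fun n => Re (u n)))|rewrite (cvg_shiftS (fun n => Im (u n)))].
Qed.

Lemma ccvg_at_zero (f : int -> C) l : ccvg (fun k : nat => f k) l -> at_zero f = l.
Proof. exact: ccvg_lim. Qed.

Lemma ccvg_regular (f : int -> C) l : ccvg (fun k : nat => f k) l -> q_regular f.
Proof. by move=> /ccvg_Co fl; apply/cvg_ex; exists (l : C^o). Qed.
End ComplexLimits.

(** * Bilateral sums *)

Section BilateralSums.
Variable R : realType.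
Implicit Types (f g : int -> R).

(** The sum over the indices from [- N] to [N - 1], split into the same two halves as [jackson]. *)
Definition zsum (T : nmodType) (f : int -> T) (N : nat) : T :=
  \sum_(0 <= k < N) f k%:Z + \sum_(0 <= k < N) f (- k.+1%:Z).

Lemma zsumS (T : nmodType) (f : int -> T) N : zsum f N.+1 = zsum f N + (f N%:Z + f (- N.+1%:Z)).
Proof. by rewrite /zsum !big_nat_recr //= addrACA. Qed.

Lemma zsum0 (T : nmodType) (f : int -> T) : zsum f 0 = 0.
Proof. by rewrite /zsum !big_geq // addr0. Qed.

Lemma zsumD (T : nmodType) (f g : int -> T) N : zsum (fun n => f n + g n) N = zsum f N + zsum g N.
Proof. by rewrite /zsum !big_split /= addrACA. Qed.

Lemma zsumZ (T : pzRingType) (c : T) (f : int -> T) N : zsum (fun n => c * f n) N = c * zsum f N.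
Proof. by rewrite /zsum -!mulr_sumr mulrDr. Qed.

Lemma Re_zsum (f : int -> R[i]) N : Re (zsum f N) = zsum (fun n => Re (f n)) N.
Proof. by elim: N => [|N IH]; rewrite ?zsum0 // !zsumS -IH cReD (cReD (f _)). Qed.

Lemma zsumJ (f : int -> R[i]) N : conjc (zsum f N) = zsum (fun n => conjc (f n)) N.
Proof. by rewrite /zsum rmorphD !rmorph_sum. Qed.

Lemma zsum_telescope (T : zmodType) (g : int -> T) N :
  zsum (fun n => g n - g (n + 1)) N = g (- N%:Z) - g N%:Z.
Proof.
elim: N => [|N IH]; first by rewrite zsum0 oppr0 subrr.
rewrite zsumS IH.
have -> : - N.+1%:Z + 1 = - N%:Z by lia.
have -> : N%:Z + 1 = N.+1%:Z by lia.
by rewrite addrA subrKA addrC subrKA.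
Qed.

Lemma ler_zsum f g N : (forall n, f n <= g n) -> zsum f N <= zsum g N.
Proof. by move=> fg; rewrite /zsum lerD // ler_sum. Qed.

Lemma zsum_nondecreasing f : (forall n, 0 <= f n) ->
  {homo zsum f : n m / (n <= m)%N >-> n <= m}.
Proof.
move=> f0; apply/nondecreasing_seqP => n.
by rewrite zsumS lerDl addr_ge0.
Qed.

Lemma zsum_term_le f n N : (forall k, 0 <= f k) -> (`|n| < N)%N -> f n <= zsum f N.
Proof.
move=> f0; have le1 (g : nat -> R) k : (forall j, 0 <= g j) -> (k < N)%N -> g k <= \sum_(0 <= j < N) g j.
  move=> g0 kN; rewrite (@big_cat_nat _ _ _ k.+1) //= big_nat_recr //= -addrA addrCA.
  by rewrite lerDl addr_ge0 // sumr_ge0.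
case: n => n nN.
  apply: le_trans (le1 (fun k => f k) n _ nN) _ => //.
  by rewrite /zsum lerDl sumr_ge0.
have nN' : (n < N)%N by move: nN; rewrite /= ; apply: ltn_trans.
rewrite NegzE; apply: le_trans (le1 (fun k : nat => f (- k.+1%:Z)) n _ nN') _ => //.
by rewrite /zsum lerDr sumr_ge0.
Qed.

(** For nonnegative [f] this is summability, by [esum_int_fin]. *)
Definition zbounded f := exists M, forall N, zsum f N <= M.

Lemma zbounded_le f g : (forall n, f n <= g n) -> zbounded g -> zbounded f.
Proof. by move=> fg [M H]; exists M => N; exact: le_trans (ler_zsum _ fg) (H N). Qed.

Lemma zboundedD f g : zbounded f -> zbounded g -> zbounded (fun n => f n + g n).
Proof. by move=> [M HM] [K HK]; exists (M + K) => N; rewrite zsumD lerD. Qed.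

Lemma zboundedZ (c : R) f : 0 <= c -> zbounded f -> zbounded (fun n => c * f n).
Proof. by move=> c0 [M HM]; exists (c * M) => N; rewrite zsumZ ler_wpM2l. Qed.

Lemma zbounded_half f g : (forall n, `|f n| <= g n) -> zbounded g ->
  cvgn (series (fun k : nat => f k%:Z)) /\ cvgn (series (fun k : nat => f (- k.+1%:Z))).
Proof.
move=> fg [M HM].
have g0 n : 0 <= g n by exact: le_trans (fg n).
split; apply: normed_cvg; apply: nondecreasing_is_cvgn.
- by apply/nondecreasing_seqP => n; rewrite /series /= [leRHS]big_nat_recr //= lerDl.
- exists M => _ [n _ <-]; apply: le_trans (HM n); rewrite /series /= /zsum.
  by rewrite -[leLHS]addr0 lerD ?ler_sum ?sumr_ge0.
- by apply/nondecreasing_seqP => n; rewrite /series /= [leRHS]big_nat_recr //= lerDl.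
- exists M => _ [n _ <-]; apply: le_trans (HM n); rewrite /series /= /zsum.
  by rewrite -[leLHS]add0r lerD ?ler_sum ?sumr_ge0.
Qed.

Lemma esum_int_fin f : (forall n, 0 <= f n) ->
  (\esum_(n in [set: int]) (f n)%:E < +oo)%E <-> zbounded f.
Proof.
move=> f0; have f0E n : (0 <= (f n)%:E)%E by rewrite lee_fin.
rewrite (esumID (range Posz)) //= !setTI.
have -> : ~` range Posz = [set - (n.+1%:Z) | n in [set: nat]].
  apply/seteqP; split=> [[n|n]|_ [n _ <-]] /=.
  - by move=> H; exfalso; apply: H; exists n.
  - by move=> _; exists n; rewrite // -NegzE.
  - by rewrite -NegzE; case.
rewrite !esum_image; [|by move=> a b _ _ /= /oppr_inj[]|by move=> a b _ _ /= []].
rewrite -!nneseries_esumT //.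
have fin (u : nat -> R) (M : R) : (forall N, \sum_(0 <= k < N) u k <= M) ->
    (\sum_(0 <= k <oo) (u k)%:E <= M%:E)%E \/ exists k, u k < 0.
  move=> uM; have [u0|] := pselect (forall k, 0 <= u k); last first.
    by move=> /existsNP[k /negP]; rewrite -ltNge; right; exists k.
  left; apply: lime_le; first by apply: is_cvg_nneseries => k _ _; rewrite lee_fin.
  by apply: nearW => N; rewrite sumEFin lee_fin.
split=> [|[M HM]].
  have tot (u : nat -> R) N : (forall k, 0 <= u k) ->
      ((\sum_(0 <= k < N) u k)%:E <= \sum_(0 <= k <oo) (u k)%:E)%E.
    by move=> u0; rewrite -sumEFin; apply: nneseries_lim_ge => k _; rewrite lee_fin.
  set a := (\sum_(i <oo) _)%E; set b := (\sum_(i <oo) _)%E => ab.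
  have a0 : (0 <= a)%E by apply: nneseries_ge0.
  have b0 : (0 <= b)%E by apply: nneseries_ge0.
  exists (fine (a + b)) => N; rewrite -lee_fin fineK ?ge0_fin_numE ?adde_ge0 //.
  by rewrite /zsum EFinD; apply: leeD; apply: tot.
have h1 N : \sum_(0 <= k < N) f k%:Z <= M.
  by apply: le_trans (HM N); rewrite /zsum lerDl sumr_ge0.
have h2 N : \sum_(0 <= k < N) f (- k.+1%:Z) <= M.
  by apply: le_trans (HM N); rewrite /zsum lerDr sumr_ge0.
apply: lte_add_pinfty.
  have [H|[k]] := fin _ _ h1; first exact: le_lt_trans H (ltry _).
  by rewrite ltNge f0.
have [H|[k]] := fin _ _ h2; first exact: le_lt_trans H (ltry _).
by rewrite ltNge f0.
Qed.
End BilateralSums.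

Section CauchyNumbers.
Variable R : realType.

Lemma real_cauchy_cvg (u : nat -> R) :
  (forall e : R, 0 < e -> exists N, forall m n, (N <= m)%N -> (N <= n)%N -> `|u m - u n| < e) ->
  cvgn u.
Proof.
move=> H; apply/cauchy_cvgP/cauchy_exP => e /H[N HN]; exists (u N); exists N => //= n /= Nn.
by rewrite /ball /=; exact: HN.
Qed.

Lemma complex_cauchy_cvg (u : nat -> R[i]) :
  (forall e : R, 0 < e -> exists N, forall m n, (N <= m)%N -> (N <= n)%N -> modulus (u m - u n) < e) ->
  exists l, ccvg u l.
Proof.
move=> H.
have cr : cvgn (fun n => Re (u n)).
  apply: real_cauchy_cvg => e /H[N HN]; exists N => m n Nm Nn.
  by apply: le_lt_trans (HN m n Nm Nn); rewrite -cReN -cReD Re_le_modulus.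
have ci : cvgn (fun n => Im (u n)).
  apply: real_cauchy_cvg => e /H[N HN]; exists N => m n Nm Nn.
  by apply: le_lt_trans (HN m n Nm Nn); rewrite -cImN -cImD Im_le_modulus.
by exists (limn (fun n => Re (u n)) +i* limn (fun n => Im (u n))).
Qed.

Lemma ccvg_modulus_sqr (u : nat -> R[i]) l : ccvg u l ->
  (fun n => modulus (u n) ^+ 2) @ \oo --> modulus l ^+ 2.
Proof.
move=> [ur ui]; rewrite modulus_sqr; under eq_fun do rewrite modulus_sqr.
by apply: cvgD; rewrite !expr2; under eq_fun do rewrite expr2; exact: cvgM.
Qed.

Lemma cvg_zsum (f : nat -> int -> R) (g : int -> R) N :
  (forall n, (fun k => f k n) @ \oo --> g n) ->
  (fun k => zsum (f k) N) @ \oo --> zsum g N.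
Proof.
move=> fg; elim: N => [|N IH].
  by rewrite zsum0; under eq_fun do rewrite zsum0; exact: cvg_cst.
rewrite zsumS; under eq_fun do rewrite zsumS.
by apply: cvgD => //; apply: cvgD.
Qed.
(** The source of two limits: the values at zero of a lattice function and the pointwise limits in
    the completeness of [L2]. *)
Lemma bounded_variation_cvg (u : nat -> R[i]) (M : R) :
  (forall N, \sum_(0 <= k < N) modulus (u k.+1 - u k) <= M) ->
  exists2 l, ccvg u l & modulus l <= modulus (u 0%N) + M.
Proof.
move=> HM; pose d k := u k.+1 - u k.
have uE N : u N = u 0%N + \sum_(0 <= k < N) d k.
  elim: N => [|N IH]; first by rewrite big_geq ?addr0.
  by rewrite big_nat_recr //= addrA -IH /d addrC subrK.
have c1 (s : R[i] -> R) : (forall w, `|s w| <= modulus w) -> cvgn (series (fun k => s (d k))).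
  move=> sle; apply: normed_cvg; apply: nondecreasing_is_cvgn.
    by apply/nondecreasing_seqP => n; rewrite /series /= [leRHS]big_nat_recr //= lerDl.
  by exists M => _ [n _ <-]; apply: le_trans (HM n); rewrite /series /= ler_sum.
pose l0 := limn (series (fun k => Re (d k))) +i* limn (series (fun k => Im (d k))).
have dl : ccvg (fun N => \sum_(0 <= k < N) d k) l0.
  split; rewrite /=.
    under eq_fun do rewrite raddf_sum; exact: (c1 _ (@Re_le_modulus R)).
  under eq_fun do rewrite raddf_sum; exact: (c1 _ (@Im_le_modulus R)).
exists (u 0%N + l0).
  have := ccvgD (ccvg_cst (u 0%N)) dl; congr (ccvg _ _).
  by apply/funext => N; rewrite -uE.
apply: le_trans (le_normcD _ _) _; rewrite lerD2l.
have M0 : 0 <= M by have := HM 0%N; rewrite big_geq.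
rewrite -(@ler_pXn2r _ 2) ?nnegrE ?modulus_ge0 //.
have lim := ccvg_modulus_sqr dl.
rewrite -(cvg_lim (@Rhausdorff R) lim); apply: limr_le; first by apply/cvg_ex; eexists; exact: lim.
apply: nearW => N; rewrite ler_pXn2r ?nnegrE ?modulus_ge0 //.
apply: le_trans (HM N); elim: N => [|N IH]; first by rewrite !big_geq // ComplexField.Normc.normc0.
by rewrite !big_nat_recr //=; apply: le_trans (le_normcD _ _) _; rewrite lerD2r.
Qed.
End CauchyNumbers.

(** * The weighted sequence space *)

Section LatticeSpace.
Variables (R : realType) (q : R) (q01 : 0 < q < 1).
Local Notation C := R[i].
Local Notation H := (Lq2 q01).
Implicit Types (y z : H) (n : int) (N : nat).

(** The mass of the point [q ^ n] in the Jackson integral. *)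
Definition wt n : R := (1 - q) * q ^ n.

Lemma wt_gt0 n : 0 < wt n.
Proof. by have [q0 q1] := andP q01; rewrite mulr_gt0 ?subr_gt0 ?exprz_gt0. Qed.
Lemma wt_neq0 n : wt n != 0. Proof. by rewrite gt_eqF // wt_gt0. Qed.
Lemma wtC_neq0 n : (wt n)%:C != 0 :> C.
Proof. by apply/eqP => /(congr1 (@complex.Re R)) /= /eqP; rewrite (negbTE (wt_neq0 n)). Qed.

Definition nsq (z : C * C) : R := modulus z.1 ^+ 2 + modulus z.2 ^+ 2.
Definition cdot (w z : C * C) : C := w.1 * conjc z.1 + w.2 * conjc z.2.

Lemma nsq_ge0 w : 0 <= nsq w. Proof. by rewrite addr_ge0 // sqr_ge0. Qed.
Lemma cdotxx w : cdot w w = (nsq w)%:C.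
Proof.
rewrite /cdot /nsq !modulus_sqr; apply: complex_eq;
  rewrite !(complexE_parts, raddfD) /=; ring.
Qed.
Lemma modulusJ (w : C) : modulus (conjc w) = modulus w.
Proof. by case: w => a b; rewrite /= sqrrN. Qed.
Lemma modulus_cdot (w z : C * C) : modulus (cdot w z) <= nsq w + nsq z.
Proof.
apply: le_trans (le_normcD _ _) _; rewrite !ComplexField.Normc.normcM !modulusJ /nsq.
have AG (a b : R) : a * b <= a ^+ 2 + b ^+ 2.
  by have := sqr_ge0 (a - b); have := sqr_ge0 a; have := sqr_ge0 b; lra.
by have := AG (modulus w.1) (modulus z.1); have := AG (modulus w.2) (modulus z.2); lra.
Qed.
Lemma nsqB (w z : C * C) : nsq (w - z) = nsq (z - w).
Proof. by rewrite -(opprB z w) /nsq /= !normcN. Qed.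

Lemma Lq2funP (f : int -> C * C) :
  f \in Lq2fun q01 <-> zbounded (fun n => wt n * nsq (f n)).
Proof.
have [q0 q1] := andP q01.
have g0 n : 0 <= q ^ n * nsq (f n) by rewrite mulr_ge0 ?nsq_ge0 ?exprz_ge0 // ltW.
transitivity (jackson_ge0 q (fun n => nsq (f n)) < +oo)%E; first by rewrite inE.
transitivity (\esum_(n in [set: int]) (q ^ n * nsq (f n))%:E < +oo)%E.
  rewrite /jackson_ge0; split=> [|fin]; last first.
    by rewrite lte_mul_pinfty // lee_fin subr_ge0 ltW.
  have : (0 <= \esum_(n in [set: int]) (q ^ n * nsq (f n))%:E)%E.
    by apply: esum_ge0 => n _; rewrite lee_fin.
  case: (\esum_(_ in _) _)%E => [r||] // _; first by move=> _; exact: ltry.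
  by rewrite gt0_muley // lte_fin subr_gt0.
rewrite esum_int_fin //; split=> [/(@zboundedZ _ (1 - q))|/(@zboundedZ _ (1 - q)^-1)].
  move=> /(_ _); rewrite subr_ge0 ltW // => /(_ isT).
  by apply: zbounded_le => n; rewrite mulrA.
rewrite invr_ge0 subr_ge0 ltW // => /(_ isT); apply: zbounded_le => n.
by rewrite /wt !mulrA mulVf ?mul1r // subr_eq0 gt_eqF.
Qed.

Lemma Lq2P y : zbounded (fun n => wt n * nsq (y n)).
Proof. exact/Lq2funP/valP. Qed.

(** [jackson] is made of values of [limn], which are meaningful only for convergent series.
    Domination by a summable function makes both halves converge, hence also the symmetric sums. *)
Lemma jackson_ccvg (F : int -> C) (G : int -> R) :
  (forall n, modulus ((wt n)%:C * F n) <= G n) -> zbounded G ->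
  ccvg (zsum (fun n => (wt n)%:C * F n)) (jackson q F).
Proof.
move=> FG Gb; have [q0 q1] := andP q01.
pose g n := (wt n)%:C * F n.
have [rp rn] := zbounded_half (fun n => le_trans (Re_le_modulus _) (FG n)) Gb.
have [ip' in'] := zbounded_half (fun n => le_trans (Im_le_modulus _) (FG n)) Gb.
pose h n : C := (q ^ n)%:C * F n.
have gh n : g n = (1 - q)%:C * h n by rewrite /g /h mulrA -rmorphM.
have hg n : h n = (1 - q)^-1%:C * g n.
  by rewrite gh mulrA -rmorphM mulVf ?rmorph1 ?mul1r // subr_eq0 gt_eqF.
have half (s : nat -> int) : cvgn (series (fun k => Re (g (s k)))) ->
    cvgn (series (fun k => Im (g (s k)))) ->
    exists2 l, ccvg (series (fun k => h (s k))) l & ccvg (series (fun k => g (s k))) ((1 - q)%:C * l).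
  move=> cr ci.
  have gl : ccvg (series (fun k => g (s k)))
      (limn (series (fun k => Re (g (s k)))) +i* limn (series (fun k => Im (g (s k))))).
    have E N : series (fun k => g (s k)) N =
        series (fun k => Re (g (s k))) N +i* series (fun k => Im (g (s k))) N.
      rewrite /series /=; elim: N => [|N IH]; first by rewrite !big_geq.
      rewrite !big_nat_recr //= IH; apply: complex_eq; by rewrite !complexE_parts.
    by split; under eq_fun do rewrite E.
  set l := _ +i* _ in gl; exists ((1 - q)^-1%:C * l).
    have := ccvgZ (1 - q)^-1%:C gl; congr (ccvg _ _); apply/funext => N.
    by rewrite /series /= mulr_sumr; apply: eq_bigr => k _; rewrite -hg.
  by rewrite mulrA -rmorphM divff ?rmorph1 ?mul1r // subr_eq0 gt_eqF.
have [l1 hl1 gl1] := half _ rp ip'; have [l2 hl2 gl2] := half _ rn in'.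
have -> : jackson q F = (1 - q)%:C * l1 + (1 - q)%:C * l2.
  by rewrite /jackson -mulrDr; congr (_ * (_ + _)); exact: ccvg_lim.
exact: ccvgD gl1 gl2.
Qed.

Lemma dot_ccvg y z : ccvg (zsum (fun n => (wt n)%:C * cdot (y n) (z n))) (dotLq2 y z).
Proof.
apply: (@jackson_ccvg _ (fun n => wt n * nsq (y n) + wt n * nsq (z n))); last first.
  by apply: zboundedD; exact: Lq2P.
move=> n; rewrite ComplexField.Normc.normcM modulus_real gtr0_norm ?wt_gt0 //.
by rewrite -mulrDr ler_wpM2l ?modulus_cdot // ltW // wt_gt0.
Qed.

Lemma sqnorm_cvg y : zsum (fun n => wt n * nsq (y n)) @ \oo --> Re (dotLq2 y y).
Proof.
have -> : zsum (fun n => wt n * nsq (y n)) =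
    fun N => Re (zsum (fun n => (wt n)%:C * cdot (y n) (y n)) N).
  apply/funext => N; rewrite Re_zsum; congr (zsum _ N); apply/funext => n.
  by rewrite cdotxx -rmorphM.
by have [] := dot_ccvg y y.
Qed.

Lemma wnsq_ge0 (w : C * C) n : 0 <= wt n * nsq w.
Proof. by rewrite mulr_ge0 ?nsq_ge0 // ltW // wt_gt0. Qed.

Lemma zsum_le_sqnorm y N : zsum (fun n => wt n * nsq (y n)) N <= Re (dotLq2 y y).
Proof.
rewrite -(cvg_lim (@Rhausdorff R) (@sqnorm_cvg y)); apply: nondecreasing_cvgn_le.
  by apply: zsum_nondecreasing => n; exact: wnsq_ge0.
by apply/cvg_ex; exists (Re (dotLq2 y y)); exact: sqnorm_cvg.
Qed.

Lemma sqnorm_le y M : (forall N, zsum (fun n => wt n * nsq (y n)) N <= M) ->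
  Re (dotLq2 y y) <= M.
Proof.
move=> HM; rewrite -(cvg_lim (@Rhausdorff R) (@sqnorm_cvg y)).
apply: limr_le; first by apply/cvg_ex; exists (Re (dotLq2 y y)); exact: sqnorm_cvg.
by apply: nearW.
Qed.

Lemma Lq2D y z n : (y + z) n = y n + z n. Proof. by []. Qed.

Lemma Lq2Z (a : C) y n : (a *: y) n = (a * (y n).1, a * (y n).2).
Proof. by []. Qed.
Lemma Lq2_eq y z : (forall n, y n = z n) -> y = z.
Proof. by move=> yz; apply: val_inj; apply/funext. Qed.

Lemma dotLq2_inner : inner_product (@dotLq2 R q q01).
Proof.
split=> [a x y z|x y|x|x x0].
- apply: ccvg_unique (dot_ccvg _ _) _.
  have := ccvgD (ccvgZ a (dot_ccvg x z)) (dot_ccvg y z); congr (ccvg _ _).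
  apply/funext => N; rewrite -zsumZ -zsumD; congr (zsum _ N); apply/funext => n.
  by rewrite Lq2D Lq2Z /cdot /=; ring.
- apply: ccvg_unique (dot_ccvg _ _) _.
  have := ccvgJ (dot_ccvg x y); congr (ccvg _ _).
  apply/funext => N; rewrite zsumJ; congr (zsum _ N); apply/funext => n.
  by apply: complex_eq; rewrite /cdot !complexE_parts /=; ring.
- by apply: le_trans (zsum_le_sqnorm x 0); rewrite zsum0.
- apply: Lq2_eq => n.
  have wn : wt n * nsq (x n) <= 0.
    rewrite -x0; apply: le_trans (zsum_le_sqnorm x (`|n|%N.+1)).
    by apply: (zsum_term_le (f := fun n => wt n * nsq (x n))) => // k; exact: wnsq_ge0.
  have : nsq (x n) = 0.
    by apply/le_anti; rewrite nsq_ge0 andbT -(pmulr_rle0 _ (wt_gt0 n)).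
  move/eqP; rewrite paddr_eq0 ?sqr_ge0 // !sqrf_eq0 => /andP[/eqP h1 /eqP h2].
  by apply: injective_projections; exact: ComplexField.Normc.eq0_normc.
Qed.
End LatticeSpace.

Section LatticeComplete.
Variables (R : realType) (q : R) (q01 : 0 < q < 1).
Local Notation C := R[i].
Local Notation H := (Lq2 q01).
Local Notation norm := (hnorm (@dotLq2 R q q01)).
Local Notation wt := (wt q).

Lemma nsqD (w z : C * C) : nsq (w + z) <= 2 * nsq w + 2 * nsq z.
Proof.
have := modulus_sqrD w.1 z.1; have := modulus_sqrD w.2 z.2.
by rewrite /nsq [(w + z).1]/(w.1 + z.1) [(w + z).2]/(w.2 + z.2); lra.
Qed.

Lemma hnormLq2_sqr (y : H) : norm y ^+ 2 = Re (dotLq2 y y).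
Proof. exact: (hnorm_sqr (dotLq2_inner q01)). Qed.

Lemma wnsq_le (y : H) n : wt n * nsq (y n) <= norm y ^+ 2.
Proof.
rewrite hnormLq2_sqr; apply: le_trans (zsum_le_sqnorm y (`|n|%N.+1)).
by apply: (zsum_term_le (f := fun n => wt n * nsq (y n))) => // k; exact: wnsq_ge0.
Qed.

(** Evaluation at a point is continuous because the point has positive mass. *)
Lemma component_le (y : H) n (e : R) : 0 < e -> norm y < Num.sqrt (wt n) * e ->
  modulus (y n).1 < e /\ modulus (y n).2 < e.
Proof.
move=> e0 ye; have w0 := wt_gt0 q01 n.
have h : nsq (y n) < e ^+ 2.
  rewrite -(ltr_pM2l w0); apply: le_lt_trans (wnsq_le y n) _.
  rewrite -[wt n]sqr_sqrtr ?ltW // -exprMn ltr_pXn2r ?nnegrE ?hnorm_ge0 //.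
  by rewrite mulr_ge0 ?sqrtr_ge0 // ltW.
by split; rewrite -(@ltr_pXn2r _ 2) ?nnegrE ?modulus_ge0 ?(ltW e0) //;
  apply: le_lt_trans h; rewrite /nsq ?lerDl ?lerDr sqr_ge0.
Qed.

Lemma ncvg_component (u : nat -> H) l n : ncvg (@dotLq2 R q q01) u l ->
  ccvg (fun k => (u k n).1) (l n).1 /\ ccvg (fun k => (u k n).2) (l n).2.
Proof.
move=> ul; have w0 : 0 < Num.sqrt (wt n) by rewrite sqrtr_gt0 (wt_gt0 q01).
have near (e : R) : 0 < e -> \forall k \near \oo,
    modulus ((u k - l) n).1 < e /\ modulus ((u k - l) n).2 < e.
  move=> e0; have [N HN] := ul _ (mulr_gt0 w0 e0); exists N => //= k Nk.
  exact: component_le (HN k Nk).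
split; split; apply/cvgrPdist_lt => e /near; apply: filterS => k [h1 h2]; rewrite distrC.
- by apply: le_lt_trans h1; rewrite -cReN -cReD Re_le_modulus.
- by apply: le_lt_trans h1; rewrite -cImN -cImD Im_le_modulus.
- by apply: le_lt_trans h2; rewrite -cReN -cReD Re_le_modulus.
- by apply: le_lt_trans h2; rewrite -cImN -cImD Im_le_modulus.
Qed.

Lemma Lq2_complete : norm_complete (@dotLq2 R q q01).
Proof.
move=> u cu.
have cauchy_at n : exists w : C * C,
    ccvg (fun k => (u k n).1) w.1 /\ ccvg (fun k => (u k n).2) w.2.
  have w0 : 0 < Num.sqrt (wt n) by rewrite sqrtr_gt0 (wt_gt0 q01).
  have [l1 H1] : exists l, ccvg (fun k => (u k n).1) l.
    apply: complex_cauchy_cvg => e e0; have [N HN] := cu _ (mulr_gt0 w0 e0).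
    by exists N => a b Na Nb; have [] := component_le e0 (HN a b Na Nb).
  have [l2 H2] : exists l, ccvg (fun k => (u k n).2) l.
    apply: complex_cauchy_cvg => e e0; have [N HN] := cu _ (mulr_gt0 w0 e0).
    by exists N => a b Na Nb; have [] := component_le e0 (HN a b Na Nb).
  by exists (l1, l2).
pose f n := proj1_sig (cid (cauchy_at n)).
have fP n := proj2_sig (cid (cauchy_at n)).
(* The bound on a finite sum is kept while [b] tends to infinity; only then may [K] grow. *)
have close (e : R) N : (forall a b, (N <= a)%N -> (N <= b)%N -> norm (u a - u b) < e) ->
    forall a, (N <= a)%N -> forall K, zsum (fun n => wt n * nsq (u a n - f n)) K <= e ^+ 2.
  move=> HN a Na K.
  have lim : (fun b => zsum (fun n => wt n * nsq (u a n - u b n)) K) @ \oo -->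
      zsum (fun n => wt n * nsq (u a n - f n)) K.
    apply: cvg_zsum => n; apply: cvgM; first exact: cvg_cst.
    have [h1 h2] := fP n; apply: cvgD; apply: ccvg_modulus_sqr.
      exact: ccvgB (ccvg_cst _) h1.
    exact: ccvgB (ccvg_cst _) h2.
  rewrite -(cvg_lim (@Rhausdorff R) lim); apply: limr_le; first by apply/cvg_ex; eexists; exact: lim.
  exists N => //= b Nb; apply: le_trans (zsum_le_sqnorm (u a - u b) K) _.
  rewrite -hnormLq2_sqr ler_pXn2r ?nnegrE ?hnorm_ge0 ?(ltW (HN a b Na Nb)) //.
  by apply: le_trans (ltW (HN a b Na Nb)); exact: hnorm_ge0.
have fL : f \in Lq2fun q01.
  apply/Lq2funP; have [N HN] := cu 1 ltr01.
  have hb : zbounded (fun n => wt n * nsq (u N n - f n)).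
    by exists (1 ^+ 2) => K; exact: close HN N (leqnn N) K.
  have := zboundedD (zboundedZ (ler0n _ 2) (Lq2P (u N))) (zboundedZ (ler0n _ 2) hb).
  apply: zbounded_le => n; have := nsqD (u N n) (f n - u N n).
  rewrite addrC subrK nsqB => h; have := wt_gt0 q01 n.
  by move: h; set a := nsq _; set b := nsq _; set c := nsq _; nra.
pose l : H := MkLq2 fL; exists l => e e0.
have e2 : 0 < e / 2 by rewrite divr_gt0.
have [N HN] := cu _ e2; exists N => a Na.
apply: le_lt_trans (_ : e / 2 < e); last by lra.
rewrite -(@ler_pXn2r _ 2) ?nnegrE ?hnorm_ge0 ?(ltW e2) // hnormLq2_sqr.
by apply: sqnorm_le => K; exact: close HN a Na K.
Qed.
End LatticeComplete.

(** * Green's formula and resolvents of the lattice operator *)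

Section LatticeOperator.
Variables (R : realType) (q : R) (q01 : 0 < q < 1) (p r : int -> R).
Local Notation C := R[i].
Local Notation H := (Lq2 q01).
Local Notation dot := (@dotLq2 R q q01).
Local Notation norm := (hnorm dot).
Local Notation wt := (wt q).
Local Notation L := (l1 q p r).
Implicit Types (f g : int -> C * C) (y z : H) (n : int) (N : nat).

(** The weight cancels all powers of [q]: up to the potential terms, [l1] becomes a pair of first
    differences. *)
Lemma wt_l1_1 f n : (wt n)%:C * (L f n).1 = (f n).2 - (f (n - 1)).2 + (wt n)%:C * (p n)%:C * (f n).1.
Proof.
have [q0 q1] := andP q01.
rewrite /l1 /= /Dqinv mulrDr; congr (_ + _); last by rewrite mulrA.
set d := (f n).2 - _.
transitivity (((wt n)%:C * - (q^-1)%:C * (q ^ n * (1 - q^-1))^-1%:C) * d).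
  by rewrite -fmorphV; ring.
rewrite -rmorphN -!rmorphM (_ : _ * _ = 1 :> R) ?rmorph1 ?mul1r //.
have qn : q ^ n != 0 by rewrite expfz_neq0 ?gt_eqF.
rewrite /wt; move: (q ^ n) qn => a a0; field.
by rewrite a0 gt_eqF //= ?subr_eq0 ?lt_eqF.
Qed.

Lemma wt_l1_2 f n : (wt n)%:C * (L f n).2 = (f n).1 - (f (n + 1)).1 + (wt n)%:C * (r n)%:C * (f n).2.
Proof.
have [q0 q1] := andP q01.
rewrite /l1 /= /Dq mulrDr; congr (_ + _); last by rewrite mulrA.
set d := (f (n + 1)).1 - _; rewrite -[RHS]opprB -/d.
transitivity (((wt n)%:C * (q ^ n * (q - 1))^-1%:C) * d).
  by rewrite -fmorphV; ring.
rewrite -rmorphM (_ : _ * _ = -1 :> R) ?rmorphN1 ?mulN1r //.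
have qn : q ^ n != 0 by rewrite expfz_neq0 ?gt_eqF.
rewrite /wt; move: (q ^ n) qn => a a0; field.
by rewrite a0 /= subr_eq0 lt_eqF.
Qed.

(* The bracket [[f, g]] of the context at the point [q ^ n]. *)
Definition brk f g n : C := (f n).1 * conjc (g (n - 1)).2 - conjc (g n).1 * (f (n - 1)).2.

(** The Lagrange identity; the terms with [p] and [r] cancel because these are real. *)
Lemma green_term f g n : (wt n)%:C * (cdot (L f n) (g n) - cdot (f n) (L g n)) =
  brk f g n - brk f g (n + 1).
Proof.
rewrite /cdot /brk addrK.
transitivity (((wt n)%:C * (L f n).1) * conjc (g n).1 + ((wt n)%:C * (L f n).2) * conjc (g n).2 -
  ((f n).1 * conjc ((wt n)%:C * (L g n).1) + (f n).2 * conjc ((wt n)%:C * (L g n).2))).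
  by rewrite !conjE; ring.
by rewrite !wt_l1_1 !wt_l1_2 !conjE; ring.
Qed.

Lemma green_sum f g N :
  zsum (fun n => (wt n)%:C * (cdot (L f n) (g n) - cdot (f n) (L g n))) N =
  brk f g (- N%:Z) - brk f g N.
Proof. by under eq_fun do rewrite green_term; exact: zsum_telescope. Qed.

Lemma ccvg0 (u : nat -> C) (v : nat -> R) : (forall N, modulus (u N) <= v N) ->
  v @ \oo --> (0 : R) -> ccvg u 0.
Proof.
move=> uv v0; have Nv0 : (fun k => - v k) @ \oo --> (0 : R) by rewrite -oppr0; exact: cvgN.
split; (apply: squeeze_cvgr Nv0 v0; apply: nearW => k; rewrite -ler_norml);
  by apply: le_trans (uv k); rewrite ?Re_le_modulus ?Im_le_modulus.
Qed.

Lemma brk_modulus f g n : modulus (brk f g n) <=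
  nsq (f n) + nsq (f (n - 1)) + nsq (g n) + nsq (g (n - 1)).
Proof.
apply: le_trans (le_normcD _ _) _.
rewrite normcN !ComplexField.Normc.normcM !modulusJ /nsq.
have AG (a b : R) : a * b <= a ^+ 2 + b ^+ 2.
  by have := sqr_ge0 (a - b); have := sqr_ge0 a; have := sqr_ge0 b; lra.
have h1 := AG (modulus (f n).1) (modulus (g (n - 1)).2).
have h2 := AG (modulus (g n).1) (modulus (f (n - 1)).2).
have := sqr_ge0 (modulus (f n).2); have := sqr_ge0 (modulus (f (n - 1)).1).
have := sqr_ge0 (modulus (g n).2); have := sqr_ge0 (modulus (g (n - 1)).1).
lra.
Qed.

Lemma wt_neg N : (wt (- N%:Z))^-1 = q ^+ N / (1 - q).
Proof. by rewrite /wt invfM mulrC -exprnN invrK. Qed.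

(** The mass of [q ^ (- N)] grows, so a single term of the norm gives [|y (q ^ (- N))|^2 <= |y|^2 q
    ^ N / (1 - q)]. This is the limit-point case at infinity. *)
Lemma brk_infty y z : ccvg (fun N => brk y z (- N%:Z)) 0.
Proof.
have [q0 q1] := andP q01.
pose K := 2 * (norm y ^+ 2 + norm z ^+ 2) / (1 - q).
apply: (@ccvg0 _ (fun N => K * q ^+ N)); last first.
  rewrite -[X in _ --> X](mulr0 K); apply: cvgM; first exact: cvg_cst.
  by apply: cvg_expr; rewrite gtr0_norm.
have bnd (w : H) m N : (N <= m)%N -> nsq (w (- m%:Z)) <= norm w ^+ 2 / (1 - q) * q ^+ N.
  move=> Nm; have := wnsq_le w (- m%:Z); rewrite -ler_pdivlMl ?wt_gt0 // wt_neg => /le_trans; apply.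
  rewrite (_ : q ^+ m / (1 - q) * norm w ^+ 2 = norm w ^+ 2 / (1 - q) * q ^+ m); last by ring.
  by rewrite ler_wpM2l ?ler_wiXn2l ?divr_ge0 ?sqr_ge0 ?subr_ge0 // ltW.
move=> N; apply: le_trans (brk_modulus _ _ _) _.
have -> : - N%:Z - 1 = - N.+1%:Z by lia.
have := bnd y N N (leqnn N); have := bnd y N.+1 N (leqnSn N).
have := bnd z N N (leqnn N); have := bnd z N.+1 N (leqnSn N).
rewrite /K; set a := (1 - q)^-1; lra.
Qed.

Lemma brk_zero f g a1 a2 b1 b2 :
  ccvg (fun k : nat => (f k).1) a1 -> ccvg (fun k : nat => (f k).2) a2 ->
  ccvg (fun k : nat => (g k).1) b1 -> ccvg (fun k : nat => (g k).2) b2 ->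
  ccvg (fun N : nat => brk f g N.+1%:Z) (a1 * conjc b2 - conjc b1 * a2).
Proof.
move=> f1 f2 g1 g2; rewrite /brk.
have E (N : nat) : N.+1%:Z - 1 = N%:Z by lia.
under eq_fun do rewrite E.
apply: ccvgB; apply: ccvgM; [exact: (ccvg_shift f1)|exact: ccvgJ|exact: (ccvg_shift (ccvgJ g1))|exact: f2].
Qed.

Lemma green y z (gy gz : H) (a1 a2 b1 b2 : C) : L y = gy :> (int -> C * C) -> L z = gz :> (int -> C * C) ->
  ccvg (fun k : nat => (y k).1) a1 -> ccvg (fun k : nat => (y k).2) a2 ->
  ccvg (fun k : nat => (z k).1) b1 -> ccvg (fun k : nat => (z k).2) b2 ->
  dot gy z - dot y gz = conjc b1 * a2 - a1 * conjc b2.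
Proof.
move=> Ly Lz y1 y2 z1 z2.
have lim1 := ccvg_shift (ccvgB (dot_ccvg gy z) (dot_ccvg y gz)).
have lim2 := ccvgB (ccvg_shift (brk_infty y z)) (brk_zero y1 y2 z1 z2).
rewrite -[RHS]opprB -[RHS]sub0r; apply: ccvg_unique lim1 _; move: lim2; congr (ccvg _ _).
apply/funext => N; rewrite -green_sum Ly Lz.
apply/eqP; rewrite eq_sym subr_eq -zsumD; apply/eqP; congr (zsum _ _); apply/funext => n; ring.
Qed.

Hypothesis p_regular : q_regular p.
Hypothesis r_regular : q_regular r.

Lemma coefficients_bounded : exists2 P : R, 0 <= P & forall k : nat, `|p k| <= P /\ `|r k| <= P.
Proof.
have bnd (s : int -> R) : q_regular s -> exists2 P : R, 0 <= P & forall k : nat, `|s k| <= P.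
  move=> cs; have [M [_ HM]] := cvg_seq_bounded cs.
  exists (Num.max 0 (M + 1)); first by rewrite le_max lexx.
  have M1 : M < M + 1 by rewrite ltrDl.
  by move=> k; have := HM _ M1 k I; rewrite /= le_max => ->; rewrite orbT.
have [P P0 HP] := bnd _ p_regular; have [Q Q0 HQ] := bnd _ r_regular.
exists (P + Q); first exact: addr_ge0.
by move=> k; have := HP k; have := HQ k; lra.
Qed.

Lemma sum_wt_le1 N : \sum_(0 <= k < N) wt k%:Z <= 1.
Proof.
have [q0 q1] := andP q01.
suff -> : \sum_(0 <= k < N) wt k%:Z = 1 - q ^+ N by rewrite gerBl exprn_ge0 // ltW.
elim: N => [|N IH]; first by rewrite big_geq // expr0 subrr.
by rewrite big_nat_recr //= IH /wt exprS -exprnP; ring.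
Qed.

(** The points [q ^ k] with [k >= 0] have total mass at most one, so the inequality
    [a <= m + a^2 / m] can be summed. *)
Lemma sum_wt_le (a : nat -> R) (m : R) N : 0 < m ->
  \sum_(0 <= k < N) wt k%:Z * a k ^+ 2 <= m ^+ 2 -> \sum_(0 <= k < N) wt k%:Z * a k <= 2 * m.
Proof.
move=> m0 H.
apply: (@le_trans _ _ (\sum_(0 <= k < N) (m * wt k%:Z + m^-1 * (wt k%:Z * a k ^+ 2)))).
  apply: ler_sum => k _; have w0 := wt_gt0 q01 k.
  have : a k <= m + m^-1 * a k ^+ 2.
    rewrite -(ler_pM2l m0) mulrDr mulrA divff ?gt_eqF // mul1r.
    by have := sqr_ge0 (a k - m); have := sqr_ge0 (a k); have := sqr_ge0 m; lra.
  by move=> h; have := ler_wpM2l (ltW w0) h; lra.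
rewrite big_split /= -[X in X + _]mulr_sumr -[X in _ + X]mulr_sumr.
have h1 := ler_wpM2l (ltW m0) (sum_wt_le1 N).
have mi : 0 <= m^-1 by rewrite invr_ge0 ltW.
apply: le_trans (lerD h1 (ler_wpM2l mi H)) _.
by rewrite (_ : m^-1 * m ^+ 2 = m); [lra|field; rewrite gt_eqF].
Qed.

Lemma nsq0 : nsq (0 : C * C) = 0.
Proof. by rewrite /nsq !modulus_sqr /= expr0n /= !addr0. Qed.

Lemma half_sum_le (w : H) N : \sum_(0 <= k < N) wt k%:Z * nsq (w k) <= norm w ^+ 2.
Proof.
rewrite hnormLq2_sqr; apply: le_trans (zsum_le_sqnorm w N).
by rewrite /zsum lerDl sumr_ge0 // => k _; exact: wnsq_ge0.
Qed.

(** It is applied with [w] a component of [l1 y] and [v] the same component of [y]; then the weight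
    times [w - b v] is an increment of the other component, and the sum is its variation near
    zero. *)
Lemma perturbed_sum_le P (w v : nat -> C) (y g : H) (b : nat -> R) m N :
  0 <= P -> (forall k, `|b k| <= P) ->
  (forall k, modulus (w k) ^+ 2 <= nsq (g k)) -> (forall k, modulus (v k) ^+ 2 <= nsq (y k)) ->
  0 < m -> norm y <= m -> norm g <= m ->
  \sum_(0 <= k < N) wt k%:Z * modulus (w k - (b k)%:C * v k) <= 2 * ((2 + 2 * P) * m).
Proof.
move=> P0 bP wg vy m0 ym gm.
apply: (@sum_wt_le (fun k => modulus (w k - (b k)%:C * v k))).
  by rewrite mulr_gt0 //; lra.
apply: (@le_trans _ _ (\sum_(0 <= k < N) (2 * (wt k%:Z * nsq (g k)) + 2 * P ^+ 2 * (wt k%:Z * nsq (y k))))).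
  apply: ler_sum => k _; have w0 := wt_gt0 q01 k.
  have h := modulus_sqrD (w k) (- ((b k)%:C * v k)).
  rewrite normcN modulus_sqrM modulus_real real_normK ?num_real // in h.
  have h2 : b k ^+ 2 * modulus (v k) ^+ 2 <= P ^+ 2 * nsq (y k).
    rewrite ler_pM ?sqr_ge0 // -(@real_normK _ (b k)) ?num_real //.
    by rewrite ler_pXn2r ?nnegrE.
  have h3 : modulus (w k - (b k)%:C * v k) ^+ 2 <= 2 * nsq (g k) + 2 * P ^+ 2 * nsq (y k).
    by have := wg k; lra.
  by have := ler_wpM2l (ltW w0) h3; lra.
rewrite big_split /= -[X in X + _]mulr_sumr -[X in _ + X]mulr_sumr.
have h1 := half_sum_le g N; have h2 := half_sum_le y N.
have gm2 : norm g ^+ 2 <= m ^+ 2 by rewrite ler_pXn2r ?nnegrE ?hnorm_ge0 ?(ltW m0).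
have ym2 : norm y ^+ 2 <= m ^+ 2 by rewrite ler_pXn2r ?nnegrE ?hnorm_ge0 ?(ltW m0).
have P2 : 0 <= 2 * P ^+ 2 by rewrite mulr_ge0 ?sqr_ge0.
have k1 := ler_wpM2l P2 (le_trans h2 ym2); have k2 := le_trans h1 gm2.
have m2 : 0 <= m ^+ 2 by exact: sqr_ge0.
have -> : ((2 + 2 * P) * m) ^+ 2 = 4 * m ^+ 2 + 8 * (P * m ^+ 2) + 4 * (P ^+ 2 * m ^+ 2) by ring.
have : 0 <= P * m ^+ 2 by rewrite mulr_ge0.
have : 0 <= P ^+ 2 * m ^+ 2 by rewrite mulr_ge0 ?sqr_ge0.
by lra.
Qed.

(** When [y] and [l1 y] are square summable, [y] has bounded variation near zero; so the boundary
    values exist and are continuous for the graph norm. *)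
Lemma boundary_le : exists2 K : R, 0 < K & forall y g : H, L y = g :> (int -> C * C) ->
  forall m : R, 0 < m -> norm y <= m -> norm g <= m ->
  exists a b : C, [/\ ccvg (fun k : nat => (y k).1) a, ccvg (fun k : nat => (y k).2) b,
    modulus a <= K * m & modulus b <= K * m].
Proof.
have [P P0 HP] := coefficients_bounded.
have s0 : 0 < Num.sqrt (wt 0) by rewrite sqrtr_gt0 (wt_gt0 q01).
(* The first term bounds the value at the point [q ^ 0 = 1], the second the variation from there
   down to zero. *)
pose K := 2 / Num.sqrt (wt 0) + 2 * (2 + 2 * P).
have K0 : 0 < K by rewrite addr_gt0 ?divr_gt0 // mulr_gt0 //; lra.
exists K => // y g Ly m m0 ym gm.
have [y10 y20] : modulus (y 0).1 < 2 / Num.sqrt (wt 0) * m /\ modulus (y 0).2 < 2 / Num.sqrt (wt 0) * m.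
  apply: component_le; first by rewrite !mulr_gt0 ?invr_gt0.
  rewrite (_ : _ * _ = 2 * m); last by field; rewrite gt_eqF.
  by lra.
have le1 (z : C * C) : modulus z.1 ^+ 2 <= nsq z by rewrite /nsq lerDl sqr_ge0.
have le2 (z : C * C) : modulus z.2 ^+ 2 <= nsq z by rewrite /nsq lerDr sqr_ge0.
have [a ya aK] : exists2 a, ccvg (fun k : nat => (y k).1) a &
    modulus a <= modulus (y 0).1 + 2 * ((2 + 2 * P) * m).
  apply: (bounded_variation_cvg (u := fun k : nat => (y k).1)) => N.
  apply: le_trans (@perturbed_sum_le P (fun k => (g k).2) (fun k => (y k).2) y g (fun k => r k) m N P0 (fun k => (HP k).2) (fun k => le2 (g k))
    (fun k => le2 (y k)) m0 ym gm).
  apply: ler_sum => k _; rewrite -[X in _ <= X * _](gtr0_norm (wt_gt0 q01 k)) -modulus_real.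
  rewrite -ComplexField.Normc.normcM mulrBr -Ly wt_l1_2 mulrA addrK.
  by rewrite -normcN opprB (_ : k%:Z + 1 = k.+1%:Z) //; lia.
have [b yb bK] : exists2 b, ccvg (fun k : nat => (y k).2) b &
    modulus b <= modulus (y 0).2 + 2 * ((2 + 2 * P) * m).
  apply: (bounded_variation_cvg (u := fun k : nat => (y k).2)) => N.
  apply: le_trans (@perturbed_sum_le P (fun k => (g k).1) (fun k => (y k).1) y g (fun k => p k) m N.+1 P0 (fun k => (HP k).1) (fun k => le1 (g k))
    (fun k => le1 (y k)) m0 ym gm).
  (* The first component of [l1] is a backward difference: the increment from [k] to [k + 1] sits at
     [k + 1], so the term of index 0 is dropped. *)
  rewrite big_nat_recl //= -[leLHS]add0r; apply: lerD.
    by rewrite mulr_ge0 ?modulus_ge0 // ltW // wt_gt0.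
  apply: ler_sum => k _; rewrite -[X in _ <= X * _](gtr0_norm (wt_gt0 q01 k.+1)) -modulus_real.
  rewrite -ComplexField.Normc.normcM mulrBr -Ly wt_l1_1 mulrA addrK.
  by rewrite (_ : k.+1%:Z - 1 = k%:Z) //; lia.
exists a, b; split=> //.
  by apply: le_trans aK _; rewrite /K; lra.
by apply: le_trans bK _; rewrite /K; lra.
Qed.

Lemma l1_regular y (g : H) : L y = g :> (int -> C * C) ->
  ccvg (fun k : nat => (y k).1) (y1_0 y) /\ ccvg (fun k : nat => (y k).2) (y2_0 y).
Proof.
move=> Ly; have [K K0 HK] := boundary_le.
have m0 : 0 < norm y + norm g + 1 by rewrite ltr_pwDr // addr_ge0 // hnorm_ge0.
have ym : norm y <= norm y + norm g + 1 by have := hnorm_ge0 dot g; lra.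
have gm : norm g <= norm y + norm g + 1 by have := hnorm_ge0 dot y; lra.
have [a [b [ya yb _ _]]] := HK _ _ Ly _ m0 ym gm.
by split; [rewrite /y1_0 (ccvg_at_zero ya)|rewrite /y2_0 (ccvg_at_zero yb)].
Qed.

(** Membership in [Dmax] is recovered from the equation for [l1 y] whenever an element of a graph is
    built. *)
Lemma l1_Dmax y (g : H) : L y = g :> (int -> C * C) -> Dmax p r y.
Proof.
move=> Ly; have [y1 y2] := l1_regular Ly; split; [exact: ccvg_regular y1|exact: ccvg_regular y2|].
by rewrite Ly; exact: valP.
Qed.

Lemma l1_linear (a : C) f g n : L (fun k => (a * (f k).1 + (g k).1, a * (f k).2 + (g k).2)) n =
  (a * (L f n).1 + (L g n).1, a * (L f n).2 + (L g n).2).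
Proof. by rewrite /l1 /Dq /Dqinv /=; congr (_, _); ring. Qed.

Lemma l1_scaleD (a : C) y z (gy gz : H) : L y = gy :> (int -> C * C) -> L z = gz :> (int -> C * C) ->
  L (a *: y + z) = a *: gy + gz :> (int -> C * C).
Proof.
by move=> Ly Lz; apply/funext => n; rewrite [LHS](l1_linear a y z) Ly Lz.
Qed.

Lemma Lq2fun_bounded f M K : (forall n, nsq (f n) <= M) ->
  (forall k : nat, (K <= k)%N -> f (- k.+1%:Z) = 0) -> f \in Lq2fun q01.
Proof.
move=> fM f0; apply/Lq2funP; have M0 : 0 <= M by exact: le_trans (nsq_ge0 _) (fM 0).
exists (M * 1 + \sum_(0 <= k < K) wt (- k.+1%:Z) * nsq (f (- k.+1%:Z))) => N.
apply: lerD.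
  apply: le_trans (ler_wpM2l M0 (sum_wt_le1 N)); rewrite mulr_sumr.
  by apply: ler_sum => k _; rewrite [leRHS]mulrC ler_wpM2l // ltW // wt_gt0.
have [NK|/ltnW KN] := leqP N K.
  rewrite [leRHS](@big_cat_nat _ _ _ N) //= lerDl sumr_ge0 // => k _; exact: wnsq_ge0.
rewrite [leLHS](@big_cat_nat _ _ _ K) //= [X in _ + X]big1_seq ?addr0 // => k /=.
rewrite mem_index_iota => /andP[Kk _].
by rewrite f0 // nsq0 mulr0.
Qed.

(** Functions constant near zero and zero near infinity: a general [c] prescribes boundary values in
    [step_fun], and [c = 0] gives the finitely supported test functions. *)
Lemma test_fun f (K : nat) (c : C * C) : (forall k : nat, (K <= k)%N -> f k = c) ->
  (forall k : nat, (K <= k)%N -> f (- k%:Z) = 0) -> f \in Lq2fun q01 /\ L f \in Lq2fun q01.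
Proof.
move=> fc f0; have [P P0 HP] := coefficients_bounded.
have bnd (g : int -> C * C) J M : 0 <= M -> (forall k : nat, (J <= k)%N -> nsq (g k) <= M) ->
    (forall k : nat, (J <= k)%N -> g (- k%:Z) = 0) -> g \in Lq2fun q01.
  move=> M0 gM g0; apply: (@Lq2fun_bounded _ (zsum (fun n => nsq (g n)) J.+1 + M) J) => [n|k Jk]; last first.
    by apply: g0; exact: leqW.
  have z0 : 0 <= zsum (fun n => nsq (g n)) J.+1 by rewrite addr_ge0 // sumr_ge0 // => k _; exact: nsq_ge0.
  have [nJ|Jn] := ltnP `|n| J.+1.
    apply: le_trans (_ : _ <= zsum (fun n => nsq (g n)) J.+1) _; last by rewrite lerDl.
    by apply: (zsum_term_le (f := fun n => nsq (g n))) => // k; exact: nsq_ge0.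
  case: n Jn => n Jn.
    by apply: le_trans (gM n (ltnW Jn)) _; rewrite lerDr.
  rewrite NegzE g0 ?(ltnW Jn) // nsq0.
  exact: addr_ge0.
split.
  by apply: (bnd _ K (nsq c)) => // [|k Kk]; [exact: nsq_ge0|rewrite fc].
(* Differences reach one neighbour further, hence [K.+1]; near zero only the potential terms
   [(p c.1, r c.2)] remain. *)
apply: (bnd _ K.+1 (P ^+ 2 * nsq c)).
- by rewrite mulr_ge0 ?nsq_ge0 ?sqr_ge0.
- move=> k Kk; have [pP rP] := HP k.
  have k1 : k%:Z - 1 = k.-1%:Z by move: Kk; case: k {pP rP} => // k _; lia.
  have k2 : k%:Z + 1 = k.+1%:Z by lia.
  have Kk1 : (K <= k.-1)%N by case: (k) Kk.
  rewrite /l1 /Dq /Dqinv k1 k2 !fc ?Kk1 ?(ltnW Kk) ?(leqW (ltnW Kk)) //.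
  rewrite !subrr !mul0r mulr0 !add0r /nsq /= !modulus_sqrM !modulus_real mulrDr.
  by apply: lerD; rewrite ler_wpM2r ?sqr_ge0 // ler_pXn2r ?nnegrE.
- move=> k Kk.
  have k1 : - k%:Z - 1 = - k.+1%:Z by lia.
  have k2 : - k%:Z + 1 = - k.-1%:Z by move: Kk; case: k {k1} => // k _; lia.
  have Kk1 : (K <= k.-1)%N by case: (k) Kk.
  rewrite /l1 /Dq /Dqinv k1 k2 !f0 ?Kk1 ?(ltnW Kk) ?(leqW (ltnW Kk)) //.
  by rewrite !subrr !mul0r !mulr0 addr0.
Qed.

Lemma green0 y z (gy gz : H) : L y = gy :> (int -> C * C) -> L z = gz :> (int -> C * C) ->
  dot gy z - dot y gz = conjc (y1_0 z) * y2_0 y - y1_0 y * conjc (y2_0 z).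
Proof.
move=> Ly Lz; have [y1 y2] := l1_regular Ly; have [z1 z2] := l1_regular Lz.
exact: (green Ly Lz y1 y2 z1 z2).
Qed.

Lemma boundary_linear (a : C) y z (gy gz : H) : L y = gy :> (int -> C * C) -> L z = gz :> (int -> C * C) ->
  y1_0 (a *: y + z) = a * y1_0 y + y1_0 z /\ y2_0 (a *: y + z) = a * y2_0 y + y2_0 z.
Proof.
move=> Ly Lz; have [y1 y2] := l1_regular Ly; have [z1 z2] := l1_regular Lz.
split; apply: ccvg_at_zero.
  exact: (ccvgD (ccvgZ a y1) z1).
exact: (ccvgD (ccvgZ a y2) z2).
Qed.

Lemma T_opP h y (g : H) : T_op p r h y g <-> L y = g :> (int -> C * C) /\ y2_0 y = h * y1_0 y.
Proof.
split=> [[_ /eqP + ?]|[Ly bc]]; first by rewrite subr_eq0 => /eqP.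
by split=> //; [exact: l1_Dmax Ly|rewrite bc subrr].
Qed.

Lemma T_op_linear h (a : C) y z (gy gz : H) : T_op p r h y gy -> T_op p r h z gz ->
  T_op p r h (a *: y + z) (a *: gy + gz).
Proof.
move=> /T_opP[Ly by_] /T_opP[Lz bz]; apply/T_opP; split; first exact: l1_scaleD.
by have [-> ->] := boundary_linear a Ly Lz; rewrite by_ bz; ring.
Qed.

Lemma T_op0 h : T_op p r h (0 : H) (0 : H).
Proof.
have L0 : L (0 : H) = (0 : H) :> (int -> C * C).
  by apply/funext => n; rewrite /l1 /Dq /Dqinv /= !subrr !mul0r !mulr0 addr0.
apply/T_opP; split=> //.
by rewrite /y1_0 /y2_0 !(ccvg_at_zero (ccvg_cst 0)) mulr0.
Qed.

Lemma T_op_im h y (g : H) : T_op p r h y g -> Im (dot g y) = Im h * modulus (y1_0 y) ^+ 2.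
Proof.
move=> /T_opP[Ly bc]; have := green0 Ly Ly; rewrite bc (dot_conj (dotLq2_inner q01) g y).
move/(congr1 (@complex.Im R)); rewrite modulus_sqr !complexE_parts; lra.
Qed.

Lemma step_fun (c : C * C) : exists y (g : H), [/\ L y = g :> (int -> C * C), y1_0 y = c.1 & y2_0 y = c.2].
Proof.
pose f (n : int) : C * C := if 0 <= n then c else 0.
have fc (k : nat) : (0 <= k)%N -> f k = c by [].
have f0 (k : nat) : (1 <= k)%N -> f (- k%:Z) = 0 by case: k.
have [fL gL] := @test_fun f 1 c (fun k _ => fc k isT) f0.
exists (MkLq2 fL), (MkLq2 gL); split=> //.
  by apply: ccvg_at_zero; exact: (ccvg_cst c.1).
by apply: ccvg_at_zero; exact: (ccvg_cst c.2).
Qed.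

Lemma zsum_single (T : nmodType) (F : int -> T) (k : int) N : (`|k| < N)%N ->
  (forall n, n != k -> F n = 0) -> zsum F N = F k.
Proof.
have one (G : nat -> T) j M : (j < M)%N -> (forall i, i != j -> G i = 0) ->
    \sum_(0 <= i < M) G i = G j.
  move=> jM G0; rewrite big_mkord (bigD1 (Ordinal jM)) //= big1 ?addr0 // => i ij.
  by apply: G0; apply: contra ij => /eqP ij; apply/eqP/val_inj.
case: k => k kN F0; rewrite /zsum.
  rewrite [X in _ + X]big1 ?addr0 => [|j _]; last by rewrite F0.
  by rewrite (one (fun k => F k%:Z) k) // => i ik; rewrite F0.
rewrite [X in X + _]big1 ?add0r => [|j _]; last by rewrite F0.
by rewrite NegzE (one (fun k => F (- k.+1%:Z)) k) ?(leq_trans _ kN) // => i ik; rewrite F0 //; lia.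
Qed.

(** * Solvability of the lattice boundary problem *)

Section Resolvent.
Variables (h : C) (tau : R).
Hypothesis tau_h : 0 < tau * Im h.

(** The graph of [T_h + i tau]: the equation [l1 y = - i tau (y - g)] asks for [y] with image
    [i tau g]. *)
Let shifted y (x : H) := exists2 g : H, T_op p r h y g & x = g + ('i%C * tau%:C) *: y.

Lemma tau_neq0 : tau != 0.
Proof. by apply/eqP => t0; move: tau_h; rewrite t0 mul0r ltxx. Qed.

(** The imaginary part of [(x, y)] is [Im h |y_1(0)|^2 + tau |y|^2], whose two terms have the same
    sign by [tau_h]. *)
Let shifted_below y x : shifted y x -> `|tau| * norm y <= norm x.
Proof.
have dP := dotLq2_inner q01.
move=> [g Tyg ->]; have im := T_op_im Tyg.
set x' := g + _.
have xE : Im (dot x' y) = Im h * modulus (y1_0 y) ^+ 2 + tau * norm y ^+ 2.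
  by rewrite /x' (dotDl dP) (dotZl dP) cImD cIm_iM im hnormLq2_sqr.
have h1 : `|tau| * norm y ^+ 2 <= `|Im (dot x' y)|.
  rewrite xE; have ti : 0 < tau -> 0 < Im h by move=> t0; rewrite -(pmulr_rgt0 _ t0).
  have tn : tau < 0 -> Im h < 0 by move=> t0; rewrite -(nmulr_rgt0 _ t0).
  have n2 : 0 <= norm y ^+ 2 by exact: sqr_ge0.
  have m2 : 0 <= modulus (y1_0 y) ^+ 2 by exact: sqr_ge0.
  case: (ltrgtP tau 0) => [t0|t0|t0]; last by rewrite t0 normr0 mul0r normr_ge0.
    rewrite ltr0_norm //; have i0 := tn t0; rewrite ler0_norm; first by have := mulr_le0_ge0 (ltW i0) m2; lra.
    by have := mulr_le0_ge0 (ltW i0) m2; have := mulr_le0_ge0 (ltW t0) n2; lra.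
  rewrite gtr0_norm //; have i0 := ti t0; rewrite ger0_norm; first by have := mulr_ge0 (ltW i0) m2; lra.
  by have := mulr_ge0 (ltW i0) m2; have := mulr_ge0 (ltW t0) n2; lra.
have h2 : `|Im (dot x' y)| <= norm x' * norm y.
  have -> : Im (dot x' y) = ip dot x' ('i%C *: y).
    by rewrite /ip (dotZr dP) cReM /=; ring.
  by apply: le_trans (norm_ip_le dP _ _) _; rewrite (hnorm_scale dP) modulus_i mul1r.
have [y0|] := eqVneq (norm y) 0; first by rewrite y0 mulr0 hnorm_ge0.
move=> y0; have yp : 0 < norm y by rewrite lt_def y0 hnorm_ge0.
by rewrite -(ler_pM2r yp) -mulrA -expr2; exact: le_trans h1 h2.
Qed.

Let shifted_linear (a : C) x x' y y' : shifted x x' -> shifted y y' ->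
  shifted (a *: x + y) (a *: x' + y').
Proof.
move=> [gx Tx ->] [gy Ty ->]; exists (a *: gx + gy); first exact: T_op_linear.
lmod_ring R.
Qed.

Let shifted0 : shifted 0 0.
Proof. by exists 0; [exact: T_op0|rewrite scaler0 addr0]. Qed.

Let shifted_closed (u v : nat -> H) x x' : (forall k, shifted (u k) (v k)) ->
  ncvg dot u x -> ncvg dot v x' -> shifted x x'.
Proof.
have dP := dotLq2_inner q01.
move=> Auv ux vx; pose g := x' - ('i%C * tau%:C) *: x.
have [gk Tk gkE] : exists2 gk : nat -> H, (forall k, T_op p r h (u k) (gk k)) &
    forall k, gk k = - ('i%C * tau%:C) *: u k + v k.
  exists (fun k => - ('i%C * tau%:C) *: u k + v k) => // k.
  have [gk Tk ->] := Auv k; rewrite (_ : - _ *: _ + _ = gk) //; lmod_ring R.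
have gg : ncvg dot gk g.
  have := ncvg_linear dP (- ('i%C * tau%:C)) ux vx.
  rewrite (_ : - _ *: x + x' = g); last by rewrite /g; lmod_ring R.
  by move=> H e /H[N HN]; exists N => n /HN; rewrite gkE.
have Lk k : L (u k) = gk k :> (int -> C * C) by have /T_opP[] := Tk k.
have Lx : L x = g :> (int -> C * C).
  apply/funext => n; have wn := wtC_neq0 q01 n.
  have [g1 g2] := ncvg_component n gg.
  have [u1 u2] := ncvg_component n ux.
  have [_ u2'] := ncvg_component (n - 1) ux; have [u1' _] := ncvg_component (n + 1) ux.
  apply: injective_projections; apply: (mulfI wn).
    rewrite wt_l1_1; apply: ccvg_unique (ccvgZ (wt n)%:C g1).
    have := ccvgD (ccvgB u2 u2') (ccvgZ ((wt n)%:C * (p n)%:C) u1).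
    by congr (ccvg _ _); apply/funext => k; rewrite -Lk wt_l1_1.
  rewrite wt_l1_2; apply: ccvg_unique (ccvgZ (wt n)%:C g2).
  have := ccvgD (ccvgB u1 u1') (ccvgZ ((wt n)%:C * (r n)%:C) u2).
  by congr (ccvg _ _); apply/funext => k; rewrite -Lk wt_l1_2.
have [K K0 HK] := boundary_le.
exists g; last by rewrite /g; lmod_ring R.
apply/T_opP; split=> //.
(* Pointwise convergence says nothing about boundary values; [boundary_le] applied to [u k - x]
   carries the boundary condition to the limit. *)
have small (m : R) : 0 < m -> modulus (y2_0 x - h * y1_0 x) <= (1 + modulus h) * (K * m).
  move=> m0; have [N1 H1] := ux _ m0; have [N2 H2] := gg _ m0.
  pose k := maxn N1 N2.
  have {}H1 := ltW (H1 k (leq_maxl _ _)); have {}H2 := ltW (H2 k (leq_maxr _ _)).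
  have Lxk : L (-1 *: x + u k) = -1 *: g + gk k :> (int -> C * C) by apply: l1_scaleD.
  have xkE (w w' : H) : w - w' = -1 *: w' + w by lmod_ring R.
  rewrite xkE in H1; rewrite xkE in H2.
  have [a [b [ya yb aK bK]]] := HK _ _ Lxk m m0 H1 H2.
  have [e1 e2] := boundary_linear (-1) Lx (Lk k).
  rewrite /y1_0 (ccvg_at_zero ya) -/(y1_0 _) -/(y1_0 _) in e1.
  rewrite /y2_0 (ccvg_at_zero yb) -/(y2_0 _) -/(y2_0 _) in e2.
  have /T_opP[_ bk] := Tk k.
  have -> : y2_0 x - h * y1_0 x = h * a - b by rewrite e1 e2 bk; ring.
  apply: le_trans (le_normcD _ _) _; rewrite normcN ComplexField.Normc.normcM.
  have := ler_wpM2l (modulus_ge0 h) aK; lra.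
apply/eqP; rewrite -subr_eq0; apply/eqP/ComplexField.Normc.eq0_normc/le_anti.
rewrite modulus_ge0 andbT; apply/ler_addgt0Pl => e e0; rewrite addr0.
have D0 : 0 < (1 + modulus h) * K by rewrite mulr_gt0 // ltr_pwDl // modulus_ge0.
have := small (e / ((1 + modulus h) * K)) (divr_gt0 e0 D0).
by rewrite mulrA [_ * (e / _)]mulrC divfK // gt_eqF.
Qed.

Let cdot_shift (a b l d : C * C) (m : C) : conjc m = - m ->
  cdot (a + (m * b.1, m * b.2)) d = (cdot a d - cdot b l) + cdot b (l - (m * d.1, m * d.2)).
Proof.
move=> mJ; case: a b l d => [a1 a2] [b1 b2] [l1 l2] [d1 d2].
by rewrite /cdot /= !conjE mJ; ring.
Qed.

(** An orthogonal [z] solves the adjoint problem [l1 z = i tau z] with the conjugate boundary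
    condition, and Green's formula leaves no nonzero solution for this sign of [tau]. *)
Let shifted_dense z : (forall x x', shifted x x' -> dot x' z = 0) -> z = 0.
Proof.
have dP := dotLq2_inner q01.
move=> orth; set mu : C := 'i%C * tau%:C.
have muJ : conjc mu = - mu by rewrite /mu; apply: complex_eq; rewrite !complexE_parts /=; ring.
(* The test function is supported at [n] with value the defect [e] itself, so orthogonality says
   that the weight times [|e|^2] is zero. *)
have Lz n : L z n = (mu *: z) n.
  pose e : C * C := L z n - (mu *: z) n.
  pose f (k : int) : C * C := if k == n then e else 0.
  have far (k : int) : (`|n| < `|k|)%N -> f k = 0.
    by rewrite /f => nk; case: eqP => // kn; rewrite kn ltnn in nk.
  have [fL gL] : f \in Lq2fun q01 /\ L f \in Lq2fun q01.
    by apply: (@test_fun f `|n|.+1 0) => k nk; apply: far; rewrite ?abszN.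
  pose y : H := MkLq2 fL; pose g : H := MkLq2 gL.
  have fl (i : C * C -> C) : i 0 = 0 -> ccvg (fun k : nat => i (f k)) 0.
    move=> i0; rewrite -(_ : i (0 : C * C) = 0) //.
    have H0 : \forall k \near \oo, f (k : nat) = 0.
      by exists `|n|.+1 => // k /= nk; exact: far.
    by split; apply: cvg_near_cst; apply: filterS H0 => k ->.
  have Ty : T_op p r h y g.
    apply/T_opP; split=> //.
    by rewrite /y1_0 /y2_0 (ccvg_at_zero (fl fst erefl)) (ccvg_at_zero (fl snd erefl)) mulr0.
  have := orth y (g + mu *: y) (ex_intro2 _ _ g Ty erefl) => d0.
  pose w n := (wt n)%:C * cdot (f n) (L z n - (mu *: z) n).
  (* The bracket also reads the preceding point, so [N] exceeds [|n| + 1] for both end brackets to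
     vanish. *)
  have E N : (`|n|.+1 < N)%N -> zsum (fun k => (wt k)%:C * cdot ((g + mu *: y) k) (z k)) N = w n.
    move=> nN; have Nn : (`|n| < N)%N by apply: ltn_trans nN.
    rewrite -(zsum_single (F := w) Nn); last first.
      by move=> k kn; rewrite /w /f (negbTE kn) /cdot /=; ring.
    have := green_sum f z N; rewrite /brk.
    have -> : f (- N%:Z) = 0 by apply: far; rewrite abszN.
    have -> : f (- N%:Z - 1) = 0 by apply: far; lia.
    have -> : f N%:Z = 0 by exact: far.
    have -> : f (N%:Z - 1) = 0 by apply: far; lia.
    rewrite !mul0r !mulr0 !subr0 => G0.
    rewrite -[LHS]subr0 -G0; apply/eqP; rewrite subr_eq -zsumD; apply/eqP.
    by congr (zsum _ N); apply/funext => k; rewrite /w Lq2D !Lq2Z (cdot_shift _ _ (L z k) _ muJ) -mulrDr addrC.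
  have w0 : w n = 0.
    have lim := dot_ccvg (g + mu *: y) z; rewrite d0 in lim.
    apply: ccvg_unique lim; have H0 : \forall N \near \oo, zsum (fun k => (wt k)%:C * cdot ((g + mu *: y) k) (z k)) N = w n.
      by exists `|n|.+2 => // N /= nN; exact: E.
    by split; apply: cvg_near_cst; apply: filterS H0 => N ->.
  have e0 : nsq e = 0.
    move: w0; rewrite /w /f eqxx -/e cdotxx => /eqP; rewrite mulf_eq0 (negbTE (wtC_neq0 q01 n)) /=.
    by move/eqP/(congr1 (@complex.Re R)).
  apply/eqP; rewrite -subr_eq0 -/e; move/eqP: e0; rewrite /nsq paddr_eq0 ?sqr_ge0 // !sqrf_eq0.
  by move=> /andP[/eqP h1 /eqP h2]; apply/eqP/injective_projections; exact: ComplexField.Normc.eq0_normc.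
have Lz' : L z = (mu *: z : H) :> (int -> C * C) by apply/funext.
(* An element of the domain with [y_1(0) = 1]; orthogonality now gives the adjoint condition that
   [z_2(0)] is [z_1(0)] times the conjugate of [h]. *)
have [y [g [Ly b1 b2]]] := step_fun (1, h).
have Ty : T_op p r h y g by apply/T_opP; split=> //; rewrite b1 b2 mulr1.
have := orth y (g + mu *: y) (ex_intro2 _ _ g Ty erefl).
rewrite (dotDl dP) (dotZl dP) => d0.
have bz : conjc (y2_0 z) = h * conjc (y1_0 z).
  have := green0 Ly Lz'; rewrite b1 b2 (dotZr dP) muJ mulNr opprK d0 /= mul1r => /esym/eqP.
  by rewrite subr_eq0 => /eqP <-; rewrite mulrC.
(* For [z] with itself this becomes [2 tau |z|^2 = - 2 Im h |z_1(0)|^2]; after multiplication by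
   [tau] the two sides have opposite signs. *)
have := green0 Lz' Lz'; rewrite (dotZl dP) (dotZr dP) muJ mulNr opprK bz.
rewrite -[y2_0 z]conjcK bz conjE conjcK.
set a := y1_0 z; set d := dot z z => G.
have {}G : 2 * tau * Re d = - (2 * Im h * modulus a ^+ 2).
  move/(congr1 (@complex.Im R)): G; rewrite cImD cIm_iM modulus_sqr.
  by rewrite !complexE_parts; lra.
have d0' : 0 <= Re d by exact: (dot_ge0 dP).
apply: (dot_eq0 dP); rewrite -/d; apply/le_anti; rewrite d0' andbT.
have m2 : 0 <= tau * Im h * modulus a ^+ 2 by rewrite mulr_ge0 ?sqr_ge0 // ltW.
have t2 : 0 < tau ^+ 2 by rewrite exprn_even_gt0 //= tau_neq0.
rewrite -(pmulr_rle0 _ t2).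
have -> : tau ^+ 2 * Re d = - (tau * Im h * modulus a ^+ 2).
  have : tau * (2 * tau * Re d) = tau * - (2 * Im h * modulus a ^+ 2) by rewrite G.
  by rewrite expr2; lra.
by rewrite oppr_le0.
Qed.

(** A step function with boundary values [(0, c)] absorbs the inhomogeneous boundary condition. *)
Lemma lattice_onto (g : H) (c : C) : exists y (w : H),
  [/\ L y = w :> (int -> C * C), w = - ('i%C * tau%:C) *: (y - g) & y2_0 y - h * y1_0 y = c].
Proof.
have [yc [gc [Lc c1 c2]]] := step_fun (0, c).
have t0 : 0 < `|tau| by rewrite normr_gt0 tau_neq0.
have [y [gy Ty yE]] := closed_range_onto (dotLq2_inner q01) (@Lq2_complete R q q01) shifted_linear
  shifted0 t0 shifted_below shifted_closed shifted_dense
  (('i%C * tau%:C) *: g - (gc + ('i%C * tau%:C) *: yc)).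
have /T_opP[Ly by_] := Ty.
have [e1 e2] := boundary_linear 1 Ly Lc.
exists (1 *: y + yc), (1 *: gy + gc); split; first exact: l1_scaleD.
  have -> : gy = (('i%C * tau%:C) *: g - (gc + ('i%C * tau%:C) *: yc)) - ('i%C * tau%:C) *: y by rewrite yE; lmod_ring R.
  lmod_ring R.
by rewrite e1 e2 by_ c1 c2 /=; ring.
Qed.
End Resolvent.

End LatticeOperator.

(** * The space of square integrable classes *)

Section SquareIntegrable.
Variables (R : realType) (D : set (measurableTypeR R)).
Hypothesis mD : measurable D.
Local Notation mu := (@lebesgue_measure R).
Implicit Types f g : R -> R.

Definition sqi f := measurable_fun D f /\ (\int[mu]_(x in D) (f x ^+ 2)%:E < +oo)%E.

Lemma sqi_sqr_integrable f : sqi f -> mu.-integrable D (EFin \o (fun x => f x ^+ 2)).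
Proof.
move=> [mf f2]; apply/integrableP; split; first by apply/measurable_EFinP/measurable_funX.
by under eq_integral do rewrite /= ger0_norm ?sqr_ge0 //.
Qed.

Lemma sqi_mul_integrable f g : sqi f -> sqi g -> mu.-integrable D (EFin \o (fun x => f x * g x)).
Proof.
move=> sf sg; have := integrableD mD (sqi_sqr_integrable sf) (sqi_sqr_integrable sg).
apply: le_integrable => //.
  by apply/measurable_EFinP/measurable_funM; [case: sf|case: sg].
move=> x _; rewrite /= lee_fin normrM [leRHS]ger0_norm ?addr_ge0 ?sqr_ge0 //.
rewrite -(@real_normK _ (f x)) ?num_real // -(@real_normK _ (g x)) ?num_real //.
have := sqr_ge0 (`|f x| - `|g x|); have := sqr_ge0 (`|f x|); have := sqr_ge0 (`|g x|); lra.
Qed.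

Lemma sqi_le f g h : measurable_fun D f -> sqi g -> sqi h ->
  (forall x, D x -> f x ^+ 2 <= g x ^+ 2 + h x ^+ 2) -> sqi f.
Proof.
move=> mf sg sh fle; split=> //.
have /integrableP[_] := integrableD mD (sqi_sqr_integrable sg) (sqi_sqr_integrable sh).
apply: le_lt_trans; apply: ge0_le_integral => //.
- by move=> x _; rewrite lee_fin sqr_ge0.
- by apply/measurable_EFinP/measurable_funX.
- apply: measurableT_comp => //; apply/measurable_EFinP/measurable_funD; apply: measurable_funX; by [case: sg|case: sh].
- by move=> x Dx; rewrite /= lee_fin ger0_norm ?addr_ge0 ?sqr_ge0 // fle.
Qed.

Lemma sqiZ c f : sqi f -> sqi (fun x => c * f x).
Proof.
move=> sf; have [mf f2] := sf; split; first exact: measurable_funM.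
under eq_integral do rewrite exprMn EFinM.
rewrite ge0_integralZl_EFin ?sqr_ge0 //.
- by rewrite lte_mul_pinfty // lee_fin sqr_ge0.
- by move=> x _; rewrite lee_fin sqr_ge0.
- by apply/measurable_EFinP/measurable_funX.
Qed.

Lemma sqiD f g : sqi f -> sqi g -> sqi (fun x => f x + g x).
Proof.
move=> sf sg; apply: sqi_le (sqiZ 2 sf) (sqiZ 2 sg) _.
  by apply: measurable_funD; [case: sf|case: sg].
by move=> x _; have := sqr_ge0 (f x - g x); have := sqr_ge0 (f x); have := sqr_ge0 (g x); lra.
Qed.
End SquareIntegrable.

Section L2Inner.
Variables (R : realType) (I : interval R).
Local Notation C := R[i].
Local Notation mu := (@lebesgue_measure R).
Local Notation D := [set` I].
Local Open Scope quotient_scope.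
Implicit Types (u v : L2 I).

Let mI : measurable (D : set (measurableTypeR R)). Proof. exact: measurable_itv. Qed.

Lemma sqr_integrableP (f : R -> C) :
  sqr_integrable I f <-> sqi D (fun x => Re (f x)) /\ sqi D (fun x => Im (f x)).
Proof.
split=> [[mr mi f2]|[[mr r2] [mi i2]]].
  by split; (split=> //; apply: le_lt_trans f2; apply: ge0_le_integral => //;
    [by move=> x _; rewrite lee_fin sqr_ge0|by apply/measurable_EFinP/measurable_funX|
     exact: measurable_modulus_sqr|
     by move=> x _; rewrite lee_fin modulus_sqr ?lerDl ?lerDr sqr_ge0]).
split=> //; under eq_integral do rewrite modulus_sqr EFinD.
rewrite ge0_integralD //.
- exact: lte_add_pinfty.
- by move=> x _; rewrite lee_fin sqr_ge0.
- by apply/measurable_EFinP/measurable_funX.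
- by move=> x _; rewrite lee_fin sqr_ge0.
- by apply/measurable_EFinP/measurable_funX.
Qed.

Lemma L2_sqi u : sqi D (fun x => Re (repr u x)) /\ sqi D (fun x => Im (repr u x)).
Proof. by apply/sqr_integrableP; have := valP (repr u : L2rep I); rewrite inE. Qed.

Definition aeI (P : R -> Prop) := {ae mu, forall x, x \in I -> P x}.

Lemma aeI1 (P Q : R -> Prop) : (forall x, x \in I -> P x -> Q x) -> aeI P -> aeI Q.
Proof.
have F := @ae_filter_ringOfSetsType _ _ R mu.
by move=> PQ; rewrite /aeI; apply: filterS => x Px xI; exact: PQ xI (Px xI).
Qed.

Lemma aeI2 (P Q S : R -> Prop) : (forall x, x \in I -> P x -> Q x -> S x) -> aeI P -> aeI Q -> aeI S.
Proof.
have F := @ae_filter_ringOfSetsType _ _ R mu.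
by move=> PQ; rewrite /aeI; apply: filterS2 => x Px Qx xI; exact: PQ xI (Px xI) (Qx xI).
Qed.

Lemma pi_eqP (f g : L2rep I) : \pi_(L2 I) f = \pi_(L2 I) g <-> aeI (fun x => f x = g x).
Proof.
have E : (\pi_(L2 I) f == \pi_(L2 I) g) = (f - g \in @L2null R I) by rewrite -Quotient.idealrBE.
split=> [/eqP|fg].
  by rewrite E inE; apply: aeI1 => x _ /eqP; rewrite subr_eq0 => /eqP.
apply/eqP; rewrite E inE; move: fg; apply: aeI1 => x _ fg.
by rewrite -[LHS]/(f x - g x) fg subrr.
Qed.

Lemma repr_pi (f : L2rep I) : aeI (fun x => repr (\pi_(L2 I) f) x = f x).
Proof. by apply/pi_eqP; rewrite reprK. Qed.

Lemma L2_ext u v : aeI (fun x => repr u x = repr v x) -> u = v.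
Proof. by move=> /pi_eqP; rewrite !reprK. Qed.

Lemma repr_linear (a : C) u v : aeI (fun x => repr (a *: u + v) x = a * repr u x + repr v x).
Proof.
have -> : a *: u + v = \pi_(L2 I) (a *: repr u + repr v).
  by rewrite pi_L2D reprK.
exact: repr_pi.
Qed.

Lemma repr0 : aeI (fun x => repr (0 : L2 I) x = 0).
Proof.
have := repr_linear (-1) 0 0; rewrite scaler0 addr0.
by apply: aeI1 => x _ ->; rewrite mulN1r addNr.
Qed.

Definition wRe u v x := Re (repr u x) * Re (repr v x) + Im (repr u x) * Im (repr v x).
Definition wIm u v x := Im (repr u x) * Re (repr v x) - Re (repr u x) * Im (repr v x).

Lemma wRe_integrable u v : mu.-integrable D (EFin \o wRe u v).
Proof.
have [ur ui] := L2_sqi u; have [vr vi] := L2_sqi v.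
have := integrableD mI (sqi_mul_integrable mI ur vr) (sqi_mul_integrable mI ui vi).
exact: eq_integrable.
Qed.

Lemma wIm_integrable u v : mu.-integrable D (EFin \o wIm u v).
Proof.
have [ur ui] := L2_sqi u; have [vr vi] := L2_sqi v.
have := integrableB mI (sqi_mul_integrable mI ui vr) (sqi_mul_integrable mI ur vi).
exact: eq_integrable.
Qed.

Lemma dotL2E u v : dotL2 u v = (\int[mu]_(x in D) wRe u v x) +i* (\int[mu]_(x in D) wIm u v x).
Proof.
apply: complex_eq; rewrite /dotL2 !complexE_parts /= !(mul0r, mul1r, mulr0, addr0, subr0, add0r);
  congr (Rintegral _ _ _); apply/funext => x; rewrite !complexE_parts /wRe /wIm; ring.
Qed.

Lemma ae_Rintegral (f g : R -> R) : mu.-integrable D (EFin \o f) -> mu.-integrable D (EFin \o g) ->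
  aeI (fun x => f x = g x) -> (\int[mu]_(x in D) f x = \int[mu]_(x in D) g x)%R.
Proof.
move=> fi gi fg; rewrite /Rintegral; congr fine; apply: ae_eq_integral => //.
- exact: measurable_int fi.
- exact: measurable_int gi.
- have F := @ae_filter_ringOfSetsType _ _ R mu.
  by move: fg; rewrite /aeI; apply: filterS => x fg Dx; rewrite /= fg.
Qed.

Lemma dotL2_conj u v : dotL2 v u = conjc (dotL2 u v).
Proof.
rewrite !dotL2E /=; apply: complex_eq => /=.
  by congr (Rintegral _ _ _); apply/funext => x; rewrite /wRe; ring.
have -> : (\int[mu]_(x in D) wIm v u x = \int[mu]_(x in D) (-1 * wIm u v x))%R.
  by congr (Rintegral _ _ _); apply/funext => x; rewrite /wIm; ring.
by rewrite RintegralZl ?mulN1r //; exact: wIm_integrable.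
Qed.

Lemma dotL2_linear (a : C) u v w : dotL2 (a *: u + v) w = a * dotL2 u w + dotL2 v w.
Proof.
have EI (c : R) f : mu.-integrable D (EFin \o f) -> mu.-integrable D (EFin \o (fun x => c * f x)).
  by move=> /(integrableZl mI c); exact: eq_integrable.
have DI f g : mu.-integrable D (EFin \o f) -> mu.-integrable D (EFin \o g) -> mu.-integrable D (EFin \o (fun x => f x + g x)).
  by move=> If /(integrableD mI If); exact: eq_integrable.
have r1 := wRe_integrable u w; have r2 := wRe_integrable v w.
have i1 := wIm_integrable u w; have i2 := wIm_integrable v w.
have ae1 := repr_linear a u v.
rewrite !dotL2E; apply: complex_eq; rewrite !complexE_parts /=.
  rewrite (@ae_Rintegral _ (fun x => (Re a * wRe u w x + - Im a * wIm u w x) + wRe v w x)).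
  - have j1 := EI (Re a) _ r1; have j2 := EI (- Im a) _ i1.
    by rewrite (RintegralD mI (DI _ _ j1 j2) r2) (RintegralD mI j1 j2) (RintegralZl _ mI r1) (RintegralZl _ mI i1) mulNr.
  - exact: wRe_integrable.
  - exact: (DI _ _ (DI _ _ (EI _ _ r1) (EI _ _ i1)) r2).
  - by move: ae1; apply: aeI1 => x _; rewrite /wRe /wIm => ->; rewrite !complexE_parts; ring.
rewrite (@ae_Rintegral _ (fun x => (Re a * wIm u w x + Im a * wRe u w x) + wIm v w x)).
- have j1 := EI (Re a) _ i1; have j2 := EI (Im a) _ r1.
  by rewrite (RintegralD mI (DI _ _ j1 j2) i2) (RintegralD mI j1 j2) (RintegralZl _ mI r1) (RintegralZl _ mI i1).
- exact: wIm_integrable.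
- exact: (DI _ _ (DI _ _ (EI _ _ i1) (EI _ _ r1)) i2).
- by move: ae1; apply: aeI1 => x _; rewrite /wRe /wIm => ->; rewrite !complexE_parts; ring.
Qed.

Lemma Re_dotL2 u : Re (dotL2 u u) = fine (\int[mu]_(x in D) (modulus (repr u x) ^+ 2)%:E)%E.
Proof.
rewrite dotL2E /= /Rintegral; congr fine; apply: eq_integral => x _.
by rewrite modulus_sqr /wRe !expr2.
Qed.

Lemma L2_sqr_fin u : (\int[mu]_(x in D) (modulus (repr u x) ^+ 2)%:E < +oo)%E.
Proof. by have /sqr_integrableP[] := L2_sqi u. Qed.

Lemma L2_sqr_E u : (\int[mu]_(x in D) (modulus (repr u x) ^+ 2)%:E = (Re (dotL2 u u))%:E)%E.
Proof.
rewrite Re_dotL2 fineK // ge0_fin_numE ?L2_sqr_fin //.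
by apply: integral_ge0 => x _; rewrite lee_fin sqr_ge0.
Qed.

Lemma dotL2_inner : inner_product (@dotL2 R I).
Proof.
split; [exact: dotL2_linear|by move=> u v; exact: dotL2_conj| |] => u.
  rewrite Re_dotL2 fine_ge0 //.
  by apply: integral_ge0 => x _; rewrite lee_fin sqr_ge0.
move=> u0; have := L2_sqr_E u; rewrite u0 => I0.
have [ur ui] := L2_sqi u.
have /(ae_eq_integral_abs _ mI) Z : measurable_fun D (EFin \o (fun x => modulus (repr u x) ^+ 2)%R).
  by apply: measurable_modulus_sqr; [case: ur|case: ui].
have /Z H : (\int[mu]_(x in D) `|(EFin \o (fun x => modulus (repr u x) ^+ 2)%R) x| = 0)%E.
  by apply: etrans I0; apply: eq_integral => x _; rewrite /= ger0_norm // sqr_ge0.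
have H1 : aeI (fun x => repr u x = 0).
  have F := @ae_filter_ringOfSetsType _ _ R mu.
  move: H; rewrite /aeI; apply: filterS => x /= H xI; have [] := H xI.
  by move/eqP; rewrite sqrf_eq0 => /eqP/ComplexField.Normc.eq0_normc.
by apply: L2_ext; apply: aeI2 H1 repr0 => x _ -> ->.
Qed.
End L2Inner.

(** * Completeness of the space of classes *)

Section L2Complete.
Variables (R : realType) (I : interval R).
Local Notation C := R[i].
Local Notation mu := (@lebesgue_measure R).
Local Notation D := ([set` I] : set (measurableTypeR R)).
Local Notation norm := (hnorm (@dotL2 R I)).
Local Open Scope quotient_scope.

Let mI : measurable D. Proof. exact: measurable_itv. Qed.

Lemma measurable_ReB (f g : R -> C) : measurable_fun D (fun x => Re (f x)) ->
  measurable_fun D (fun x => Re (g x)) -> measurable_fun D (fun x => Re (f x - g x)).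
Proof.
move=> mf mg; rewrite (_ : (fun x => _) = (fun x => Re (f x) - Re (g x))); first exact: measurable_funB.
by apply/funext => x; rewrite cReD cReN.
Qed.

Lemma measurable_ImB (f g : R -> C) : measurable_fun D (fun x => Im (f x)) ->
  measurable_fun D (fun x => Im (g x)) -> measurable_fun D (fun x => Im (f x - g x)).
Proof.
move=> mf mg; rewrite (_ : (fun x => _) = (fun x => Im (f x) - Im (g x))); first exact: measurable_funB.
by apply/funext => x; rewrite cImD cImN.
Qed.

Lemma L2_norm_sqr (u : L2 I) (f : R -> C) : measurable_fun D (fun x => Re (f x)) ->
  measurable_fun D (fun x => Im (f x)) -> aeI I (fun x => repr u x = f x) ->
  (\int[mu]_(x in D) (modulus (f x) ^+ 2)%:E = (norm u ^+ 2)%:E)%E.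
Proof.
move=> mr mi uf; have [ur ui] := L2_sqi u.
rewrite (hnorm_sqr (dotL2_inner I)) -[RHS](L2_sqr_E u); apply: ge0_ae_eq_integral => //.
- exact: measurable_modulus_sqr.
- by apply: measurable_modulus_sqr; [case: ur|case: ui].
- by move=> x _; rewrite lee_fin sqr_ge0.
- by move=> x _; rewrite lee_fin sqr_ge0.
- have F := @ae_filter_ringOfSetsType _ _ R mu.
  by move: uf; rewrite /aeI; apply: filterS => x uf Dx; rewrite uf.
Qed.

Lemma repr_sub (u v : L2 I) : aeI I (fun x => repr (u - v) x = repr u x - repr v x).
Proof.
have -> : u - v = -1 *: v + u by rewrite scaleN1r addrC.
by have := repr_linear (-1) v u; apply: aeI1 => x _ ->; rewrite mulN1r addrC.
Qed.

Definition q4 k : R := 4^-1 ^+ k.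
Lemma q4_gt0 k : 0 < q4 k. Proof. by rewrite exprn_gt0. Qed.
Lemma sum_geometric (a : R) N : 0 <= a -> a <= 2^-1 -> \sum_(0 <= k < N) a ^+ k <= 2.
Proof.
move=> a0 a2; have a1 : 0 < 1 - a by lra.
have E : (1 - a) * \sum_(0 <= k < N) a ^+ k = 1 - a ^+ N.
  elim: N => [|N IH]; first by rewrite big_geq // mulr0 expr0 subrr.
  by rewrite big_nat_recr //= mulrDr IH exprS; ring.
rewrite -(ler_pM2l a1) E; have : 0 <= a ^+ N by exact: exprn_ge0.
by lra.
Qed.

Section FastCauchy.
Variable f : nat -> R -> C.
Hypothesis mRe : forall k, measurable_fun D (fun x => Re (f k x)).
Hypothesis mIm : forall k, measurable_fun D (fun x => Im (f k x)).
Hypothesis fast : forall k,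
  (\int[mu]_(x in D) (modulus (f k.+1 x - f k x) ^+ 2)%:E <= (q4 k ^+ 2)%:E)%E.

(** The factor [4 ^ k] lies between 1 and the decay [16 ^ (- k)] of the integrals: the sum [G] is
    integrable, while its finiteness forces geometric pointwise convergence. *)
Let g k x : \bar R := ((4 ^+ k) * modulus (f k.+1 x - f k x) ^+ 2)%:E.
Let G x := (\sum_(0 <= k <oo) g k x)%E.

Let g0 k x : (0 <= g k x)%E. Proof. by rewrite lee_fin mulr_ge0 ?sqr_ge0 ?exprn_ge0. Qed.

Let mdiff k : measurable_fun D (EFin \o (fun x => modulus (f k.+1 x - f k x) ^+ 2)).
Proof.
apply: measurable_modulus_sqr.
  exact: measurable_ReB.
exact: measurable_ImB.
Qed.

Let mg k : measurable_fun D (g k).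
Proof. by apply/measurable_EFinP/measurable_funM => //; apply/measurable_EFinP; exact: mdiff. Qed.

Let mG : measurable_fun D G.
Proof. by apply: (ge0_emeasurable_sum (P := xpredT)) => // k _; exact: mg. Qed.

Let intG : (\int[mu]_(x in D) G x <= 2%:E)%E.
Proof.
rewrite integral_nneseries //; apply: lime_le.
  by apply: is_cvg_nneseries => k _ _; apply: integral_ge0.
apply: nearW => N; apply: (@le_trans _ _ (\sum_(0 <= k < N) (q4 k)%:E)%E).
  apply: lee_sum => k _.
  rewrite (_ : (\int[mu]_(x in D) g k x)%E = (4 ^+ k)%:E * \int[mu]_(x in D) (modulus (f k.+1 x - f k x) ^+ 2)%:E)%E; last first.
    rewrite -ge0_integralZl_EFin ?exprn_ge0 // => [x _|]; last exact: mdiff.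
    by rewrite lee_fin sqr_ge0.
  apply: le_trans (lee_wpmul2l _ (fast k)) _; first by rewrite lee_fin exprn_ge0.
  by rewrite -EFinM lee_fin /q4 expr2 mulrA -exprMn divff // expr1n mul1r.
by rewrite sumEFin lee_fin; apply: sum_geometric; lra.
Qed.

(** The increments at [x] are at most [sqrt (G x) / 2 ^ j], and those from [k] on sum to at most
    twice the first of these bounds. *)
Let tail x k : (G x < +oo)%E -> exists2 l, ccvg (fun j => f j x) l &
  modulus (l - f k x) ^+ 2 <= 4 * q4 k * fine (G x).
Proof.
move=> Gx; have G0 : (0 <= G x)%E by apply: nneseries_ge0.
have Gfin : G x \is a fin_num by rewrite ge0_fin_numE.
set M := fine (G x); have M0 : 0 <= M by exact: fine_ge0.
have term j : modulus (f j.+1 x - f j x) <= Num.sqrt M * 2^-1 ^+ j.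
  rewrite -(@ler_pXn2r _ 2) ?nnegrE ?modulus_ge0 ?mulr_ge0 ?sqrtr_ge0 ?exprn_ge0 //.
  rewrite exprMn sqr_sqrtr // -exprM mulnC exprM.
  have gM : (g j x <= M%:E)%E.
    rewrite /M fineK //; apply: le_trans (nneseries_lim_ge j.+1 _) => //.
    by rewrite big_nat_recr //= leeDr // sume_ge0.
  rewrite lee_fin mulrC -ler_pdivlMr ?exprn_gt0 // in gM.
  apply: le_trans gM _; rewrite ler_wpM2l // -exprVn.
  by rewrite (_ : 2^-1 ^+ 2 = 4^-1 :> R) //; field.
pose v j := f (j + k)%N x - f k x.
have [l vl lM] : exists2 l, ccvg v l & modulus l <= modulus (v 0%N) + Num.sqrt M * 2^-1 ^+ k * 2.
  apply: bounded_variation_cvg => N.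
  apply: (@le_trans _ _ (\sum_(0 <= j < N) (Num.sqrt M * 2^-1 ^+ k) * 2^-1 ^+ j)).
    apply: ler_sum => j _; rewrite /v opprB addrA subrK.
    by apply: le_trans (term (j + k)%N) _; rewrite exprD -mulrA [2^-1 ^+ k * _]mulrC.
  rewrite -mulr_sumr ler_wpM2l ?mulr_ge0 ?sqrtr_ge0 ?exprn_ge0 //.
  by apply: sum_geometric; lra.
exists (l + f k x).
  have := ccvgD vl (ccvg_cst (f k x)); rewrite /v => -[hr hi]; split.
    move: hr; under eq_fun do rewrite subrK.
    by rewrite (cvg_shiftn k (fun j => Re (f j x))).
  move: hi; under eq_fun do rewrite subrK.
  by rewrite (cvg_shiftn k (fun j => Im (f j x))).
rewrite addrK; move: lM; rewrite /v add0n subrr ComplexField.Normc.normc0 add0r => lM.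
have : modulus l ^+ 2 <= (Num.sqrt M * 2^-1 ^+ k * 2) ^+ 2.
  by rewrite ler_pXn2r ?nnegrE ?modulus_ge0 ?mulr_ge0 ?sqrtr_ge0 ?exprn_ge0.
rewrite !exprMn sqr_sqrtr // -exprM mulnC exprM (_ : 2^-1 ^+ 2 = 4^-1 :> R); last by field.
by rewrite /q4 (_ : 2 ^+ 2 = 4 :> R); [lra|ring].
Qed.

(** Cutting off where [G] is infinite makes the sequence converge everywhere, so that the limit is
    measurable. *)
Let f' k x : C := if (G x < +oo)%E then f k x else 0.

Let f'_cvg x : exists l, ccvg (f' ^~ x) l.
Proof.
have [Gx|Gx] := boolP (G x < +oo)%E.
  by have [l fl _] := tail 0 Gx; exists l; rewrite /f' Gx.
by exists 0; rewrite /f' (negbTE Gx); exact: ccvg_cst.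
Qed.

Lemma fast_cauchy_limit : exists F : R -> C, [/\ measurable_fun D (fun x => Re (F x)),
  measurable_fun D (fun x => Im (F x)) &
  forall k, (\int[mu]_(x in D) (modulus (F x - f k x) ^+ 2)%:E <= (8 * q4 k)%:E)%E].
Proof.
pose F x := proj1_sig (cid (f'_cvg x)).
have FP x : ccvg (f' ^~ x) (F x) := proj2_sig (cid (f'_cvg x)).
have mP : measurable_fun D (fun x => (G x < +oo)%E) by apply: measurable_fun_lte.
have mF (s : C -> R) : s 0 = 0 -> (forall k, measurable_fun D (fun x => s (f k x))) ->
    (forall x, (fun k => s (f' k x)) @ \oo --> s (F x)) -> measurable_fun D (fun x => s (F x)).
  move=> s0 ms cs; apply: (@measurable_fun_cvg _ _ _ D (fun k x => s (f' k x))); last by move=> x _; exact: cs.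
  move=> k; rewrite (_ : (fun x => _) = (fun x => if (G x < +oo)%E then s (f k x) else 0)); last first.
    by apply/funext => x; rewrite /f'; case: ifP.
  apply: measurable_fun_if => //.
  by apply: measurable_funS (ms k) => //; exact: subIsetl.
have mFr : measurable_fun D (fun x => Re (F x)) by apply: mF => // x; case: (FP x).
have mFi : measurable_fun D (fun x => Im (F x)) by apply: mF => // x; case: (FP x).
exists F; split=> // k.
have md : measurable_fun D (EFin \o (fun x => modulus (F x - f k x) ^+ 2)).
  apply: measurable_modulus_sqr.
    exact: measurable_ReB.
  exact: measurable_ImB.
apply: (@le_trans _ _ (\int[mu]_(x in D) ((4 * q4 k)%:E * G x))%E).
  apply: ge0_le_integral => //.
  - by move=> x _; rewrite lee_fin sqr_ge0.
  - exact: measurable_funeM.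
  move=> x _; have G0 : (0 <= G x)%E by apply: nneseries_ge0.
  have q0 : 0 < 4 * q4 k by rewrite mulr_gt0 // q4_gt0.
  (* Where [G] is infinite the right-hand side is infinite too. *)
  have [Gx|] := boolP (G x < +oo)%E; last first.
    by rewrite ltey negbK => /eqP ->; rewrite gt0_muley ?leey // lte_fin.
  have [l fl lk] := tail k Gx.
  have -> : F x = l.
    by apply: ccvg_unique (FP x) _; rewrite /f' Gx.
  by rewrite -[G x]fineK ?ge0_fin_numE // -EFinM lee_fin.
have q0 : (0 <= 4 * q4 k)%R by rewrite mulr_ge0 // ltW // q4_gt0.
rewrite ge0_integralZl_EFin //; last by move=> x _; apply: nneseries_ge0.
apply: le_trans (lee_wpmul2l _ intG) _; first by rewrite lee_fin.
by rewrite -EFinM lee_fin; lra.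
Qed.
End FastCauchy.

Lemma L2_complete : norm_complete (@dotL2 R I).
Proof.
have dP := dotL2_inner I.
move=> u cu; have [N HN] := choice (fun k => cu _ (q4_gt0 k)).
(* Partial sums make the subsequence nondecreasing while keeping [N k] below both [idx k] and
   [idx k.+1]. *)
pose idx k := (\sum_(0 <= j < k.+1) N j)%N.
have Nidx k : (N k <= idx k)%N by rewrite /idx big_nat_recr //= leq_addl.
have Nidx1 k : (N k <= idx k.+1)%N.
  by rewrite /idx big_nat_recr //=; apply: leq_trans (Nidx k) (leq_addr _ _).
pose f k x := repr (u (idx k)) x.
have mr k : measurable_fun D (fun x => Re (f k x)) by case: (L2_sqi (u (idx k))) => -[].
have mi k : measurable_fun D (fun x => Im (f k x)) by case: (L2_sqi (u (idx k))) => _ [].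
have fast k : (\int[mu]_(x in D) (modulus (f k.+1 x - f k x) ^+ 2)%:E <= (q4 k ^+ 2)%:E)%E.
  rewrite (L2_norm_sqr _ _ (repr_sub (u (idx k.+1)) (u (idx k)))).
  - rewrite lee_fin ler_pXn2r ?nnegrE ?hnorm_ge0 ?(ltW (q4_gt0 _)) // ltW //.
    exact: HN.
  - exact: (measurable_ReB (mr k.+1) (mr k)).
  - exact: (measurable_ImB (mi k.+1) (mi k)).
have [F [mFr mFi Fk]] := fast_cauchy_limit mr mi fast.
have dL : (fun x => F x - f 0%N x) \in @L2fun R I.
  rewrite inE; split.
  - exact: (measurable_ReB mFr (mr 0%N)).
  - exact: (measurable_ImB mFi (mi 0%N)).
  - exact: le_lt_trans (Fk 0%N) (ltry _).
have FL : F \in @L2fun R I.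
  rewrite (_ : F = (fun x => F x - f 0%N x) + f 0%N); last by apply/funext => x; rewrite /GRing.add /= subrK.
  exact: (rpredD dL (valP (repr (u (idx 0%N)) : L2rep I))).
pose l := \pi_(L2 I) (MkL2rep FL).
have close k : norm (l - u (idx k)) ^+ 2 <= 8 * q4 k.
  rewrite -lee_fin; apply: le_trans (Fk k); rewrite -(L2_norm_sqr (u := l - u (idx k)) (f := fun x => F x - f k x)) //.
  - exact: (measurable_ReB mFr (mr k)).
  - exact: (measurable_ImB mFi (mi k)).
  - by apply: aeI2 (repr_sub l (u (idx k))) (repr_pi (MkL2rep FL)) => x _ -> ->.
(* With [w = 2 ^ (- k)], the Cauchy bound is [w ^ 2 <= w] and the distance to the limit at most
   [sqrt 8 w <= 3 w], so [4 w < e] suffices. *)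
exists l => e e0; have [k Hk] := pow2_small (divr_gt0 e0 (ltr0n R 4)).
have {Hk} := Hk k (leqnn k); set w := (2 ^ k)%:R^-1 => Hw.
have w0 : 0 < w by rewrite invr_gt0 ltr0n expn_gt0.
have w1 : w <= 1 by rewrite invf_le1 ?ltr0n ?expn_gt0 // ler1n expn_gt0.
have q4E : q4 k = w ^+ 2.
  by rewrite /q4 /w natrX -exprVn -exprM mulnC exprM; congr (_ ^+ _); field.
exists (N k) => n Nn.
apply: le_lt_trans (hnorm_tri dP _ (u (idx k)) _) _.
have h1 := HN k n (idx k) Nn (Nidx k).
have h2 : norm (u (idx k) - l) <= 3 * w.
  rewrite (hnorm_distC dP) -(@ler_pXn2r _ 2) ?nnegrE ?hnorm_ge0 ?mulr_ge0 ?(ltW w0) //.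
  by apply: le_trans (close k) _; rewrite q4E exprMn; have := sqr_ge0 w; lra.
have h3 : q4 k <= w by rewrite q4E expr2 ger_pMl.
lra.
Qed.
End L2Complete.

(** * Absolutely continuous functions *)

Section AbsoluteContinuity.
Variable R : realType.
Local Notation mu := (@lebesgue_measure R).
Implicit Types (f g : R -> R) (a b x e : R) (s : seq (R * R)).

Definition subdivision a b s :=
  all (fun J => (a <= J.1) && (J.1 <= J.2) && (J.2 <= b)) s /\
  pairwise (fun J K => (J.2 <= K.1) || (K.2 <= J.1)) s.

Definition rac a b f := forall e, 0 < e -> exists2 d : R, 0 < d &
  forall s, subdivision a b s -> \sum_(J <- s) (J.2 - J.1) < d ->
    \sum_(J <- s) `|f J.2 - f J.1| < e.

Lemma abs_continuousP a b (f : R -> R[i]) :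
  abs_continuous a b f <-> rac a b (fun x => Re (f x)) /\ rac a b (fun x => Im (f x)).
Proof.
split=> [ac|[acr aci] e e0].
  split=> e /ac[d d0 Hd]; exists d => // s [s1 s2] /(Hd s s1 s2); apply: le_lt_trans;
    by apply: ler_sum => J _; rewrite -?cReN -?cReD -?cImN -?cImD ?Re_le_modulus ?Im_le_modulus.
have e2 : 0 < e / 2 by rewrite divr_gt0.
have [d1 d10 H1] := acr _ e2; have [d2 d20 H2] := aci _ e2.
exists (Num.min d1 d2); first by rewrite lt_min d10.
move=> s s1 s2; rewrite lt_min => /andP[/(H1 s (conj s1 s2)) h1 /(H2 s (conj s1 s2)) h2].
apply: le_lt_trans (_ : _ <= \sum_(J <- s) (`|Re (f J.2) - Re (f J.1)| + `|Im (f J.2) - Im (f J.1)|)) _.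
  by apply: ler_sum => J _; rewrite -!cReN -!cReD -!cImN -!cImD modulus_le_parts.
by rewrite big_split /=; lra.
Qed.

Lemma racD a b f g : rac a b f -> rac a b g -> rac a b (fun x => f x + g x).
Proof.
move=> acf acg e e0; have e2 : 0 < e / 2 by rewrite divr_gt0.
have [d1 d10 H1] := acf _ e2; have [d2 d20 H2] := acg _ e2.
exists (Num.min d1 d2); first by rewrite lt_min d10.
move=> s ss; rewrite lt_min => /andP[/(H1 s ss) h1 /(H2 s ss) h2].
apply: le_lt_trans (_ : _ <= \sum_(J <- s) (`|f J.2 - f J.1| + `|g J.2 - g J.1|)) _.
  by apply: ler_sum => J _; rewrite opprD addrACA ler_normD.
by rewrite big_split /=; lra.
Qed.

Lemma rac_bounded_ratio (M : R) a b f (F : R -> R) : 0 <= M ->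
  (forall u v, a <= u -> u <= v -> v <= b -> `|f v - f u| <= M * `|F v - F u|) ->
  rac a b F -> rac a b f.
Proof.
move=> M0 fF acF e e0; have M1 : 0 < M + 1 by lra.
have [d d0 Hd] := acF _ (divr_gt0 e0 M1); exists d => // s ss /(Hd s ss); rewrite ltr_pdivlMr //.
apply: le_lt_trans; rewrite mulrC mulr_sumr; have [+ _] := ss; elim: s {ss} => [|J s IH] /=.
  by rewrite !big_nil.
move=> /andP[/andP[/andP[h1 h2] h3] /IH{IH} IH]; rewrite !big_cons lerD //.
by apply: le_trans (fF _ _ h1 h2 h3) _; rewrite ler_wpM2r // lerDl.
Qed.

Lemma rac_id a b : rac a b id.
Proof.
move=> e e0; exists e => // s [s1 _]; apply: le_lt_trans; elim: s s1 => [|J s IH] /=.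
  by rewrite !big_nil.
move=> /andP[/andP[/andP[_ h2] _] /IH{IH} IH]; rewrite !big_cons lerD //.
by rewrite ger0_norm // subr_ge0.
Qed.

Lemma rac_lipschitz (M : R) a b f : 0 <= M ->
  (forall u v, a <= u -> u <= v -> v <= b -> `|f v - f u| <= M * (v - u)) -> rac a b f.
Proof.
move=> M0 fM; apply: rac_bounded_ratio M0 _ (rac_id a b) => u v au uv vb.
by rewrite [X in _ <= M * X]ger0_norm ?subr_ge0 // fM.
Qed.

Lemma racZ (c : R) a b f : rac a b f -> rac a b (fun x => c * f x).
Proof.
apply: (@rac_bounded_ratio `|c|) => // u v _ _ _.
by rewrite -mulrBr normrM.
Qed.

Lemma rac_single a b f e : 0 < e -> rac a b f -> exists2 d : R, 0 < d &
  forall u v, a <= u -> u <= v -> v <= b -> v - u < d -> `|f v - f u| < e.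
Proof.
move=> e0 /(_ e e0)[d d0 Hd]; exists d => // u v au uv vb uvd.
have := Hd [:: (u, v)]; rewrite !big_seq1 /=; apply=> //.
by split; rewrite /= ?au ?uv ?vb.
Qed.

Lemma rac_bounded a b f : rac a b f -> exists2 M : R, 0 <= M &
  forall x, a <= x -> x <= b -> `|f x| <= M.
Proof.
move=> acf; have [d d0 Hd] := rac_single ltr01 acf.
have d2 : 0 < d / 2 by rewrite divr_gt0.
(* Walking from [a] in steps of length [d / 2], each changes [f] by less than one. *)
have step n : forall x, a <= x -> x <= b -> x - a <= n%:R * (d / 2) -> `|f x - f a| <= n%:R.
  elim: n => [|n IH] x ax xb.
    by rewrite mul0r subr_le0 => xa; rewrite (_ : x = a) ?subrr ?normr0 //; apply/le_anti; rewrite ax xa.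
  rewrite -[n.+1]addn1 natrD mulrDl mul1r => xn.
  have [xs|xs] := lerP x (a + d / 2).
    apply: le_trans (ltW (Hd a x _ _ _ _)) _ => //; first by lra.
    by rewrite lerDr.
  have h1 : `|f (x - d / 2) - f a| <= n%:R by apply: IH; lra.
  have h2 : `|f x - f (x - d / 2)| < 1 by apply: Hd; lra.
  have := ler_distD (f (x - d / 2)) (f x) (f a); lra.
exists (`|f a| + (Num.bound ((b - a) / (d / 2)))%:R); first by rewrite addr_ge0.
move=> x ax xb; have ab : 0 <= b - a by lra.
set n := Num.bound _.
have : (b - a) / (d / 2) < n%:R by apply: archi_boundP; rewrite divr_ge0 // ltW.
rewrite ltr_pdivrMr // => Hn; have h := step n x ax xb.
have {}h : `|f x - f a| <= n%:R by apply: h; move: Hn; clearbody n; lra.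
have : `|f x| <= `|f x - f a| + `|f a| by rewrite -{1}(subrK (f a) (f x)) ler_normD.
by move: h; clearbody n; lra.
Qed.

Lemma racM a b f g : rac a b f -> rac a b g -> rac a b (fun x => f x * g x).
Proof.
move=> acf acg; have [M M0 HM] := rac_bounded acf; have [K K0 HK] := rac_bounded acg.
have T0 : 0 < M + K + 1 by lra.
move=> e e0; have e2 : 0 < e / 2 / (M + K + 1) by rewrite !divr_gt0.
have [d1 d10 H1] := acf _ e2; have [d2 d20 H2] := acg _ e2.
exists (Num.min d1 d2); first by rewrite lt_min d10.
move=> s ss; rewrite lt_min => /andP[/(H1 s ss) h1 /(H2 s ss) h2].
apply: le_lt_trans (_ : _ <= (M + K + 1) * (\sum_(J <- s) `|f J.2 - f J.1| + \sum_(J <- s) `|g J.2 - g J.1|)) _; last first.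
  by rewrite -ltr_pdivlMl // mulrC; lra.
rewrite -big_split mulr_sumr /=; have [+ _] := ss; elim: s {ss h1 h2} => [|J s IH] /=.
  by rewrite !big_nil.
move=> /andP[/andP[/andP[j1 j2] j3] /IH{IH} IH]; rewrite !big_cons lerD //.
have -> : f J.2 * g J.2 - f J.1 * g J.1 = f J.2 * (g J.2 - g J.1) + g J.1 * (f J.2 - f J.1) by ring.
apply: le_trans (ler_normD _ _) _; rewrite !normrM.
have k1 := HM _ (le_trans j1 j2) j3; have k2 := HK _ j1 (le_trans j2 j3).
have p1 : `|f J.2| * `|g J.2 - g J.1| <= (M + K + 1) * `|g J.2 - g J.1| by rewrite ler_wpM2r //; lra.
have p2 : `|g J.1| * `|f J.2 - f J.1| <= (M + K + 1) * `|f J.2 - f J.1| by rewrite ler_wpM2r //; lra.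
lra.
Qed.
End AbsoluteContinuity.

(** * The fundamental theorem for absolutely continuous functions *)

Section FundamentalTheorem.
Variable R : realType.
Local Notation mu := (@lebesgue_measure R).
Implicit Types (f g w : R -> R) (a b x e : R) (s : seq (R * R)).

Lemma is_derive0_near f x e : 0 < e -> is_derive x (1 : R) f 0 ->
  exists2 d : R, 0 < d & forall y, `|y - x| < d -> `|f y - f x| <= e * `|y - x|.
Proof.
move=> e0 [fx dfx].
have := fx; rewrite /derivable -/(derive f x 1) dfx.
move=> /cvgrPdist_lt /(_ e e0); rewrite near_withinE => /nbhs_ballP[d /= d0 Hd].
exists d => // y yx; have [->|y0] := eqVneq y x; first by rewrite !subrr normr0 mulr0.
have := Hd (y - x); rewrite /ball /= sub0r normrN => /(_ yx).
rewrite subr_eq0 => /(_ y0); rewrite sub0r normrN /shift /= /GRing.scale /= mulr1 subrK.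
rewrite normrM normfV mulrC ltr_pdivrMr ?normr_gt0 ?subr_eq0 //.
exact: ltW.
Qed.

Lemma lebesgue_measure_ocitv a b : a <= b -> (mu `]a, b]%classic = (b - a)%:E)%E.
Proof.
move=> ab; rewrite lebesgue_measure_itv /= lte_fin; case: ltP => [_|ba]; first by rewrite -EFinD.
have -> : a = b by apply/le_anti; rewrite ab ba.
by rewrite subrr.
Qed.

Lemma negligible_open_cover (P : set R) e : 0 < e -> mu.-negligible P ->
  exists U : set R, [/\ open U, P `<=` U & (mu U < e%:E)%E].
Proof.
move=> e0 [N [mN N0 PN]].
have Nfin : (mu N < +oo)%E by rewrite N0.
have [U [oU NU UN]] := lebesgue_regularity_outer mN Nfin e0.
exists U; split=> //; first exact: subset_trans PN NU.
have mU : measurable U by exact: open_measurable.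
apply: (@le_lt_trans _ _ (mu N + mu (U `\` N))%E); last by rewrite N0 add0e.
by rewrite -{1}(setDUK NU) measureU2 //; exact: measurableD.
Qed.

(* Real induction; [G] will be an open set of small measure containing the
   points where [f] is not differentiable. *)
Lemma small_increments f a b e (G : set R) : 0 <= e -> a <= b -> open G ->
  (forall x, a <= x -> x <= b -> G x \/
     exists2 d : R, 0 < d & forall y, `|y - x| < d -> `|f y - f x| <= e * `|y - x|) ->
  exists s, [/\ subdivision a b s, `|f b - f a| <= e * (b - a) + \sum_(J <- s) `|f J.2 - f J.1| &
    ((\sum_(J <- s) (J.2 - J.1))%:E <= mu (G `&` `]a, b]))%E].
Proof.
move=> e0 ab oG gauge.
have mG : measurable G by exact: open_measurable.
pose S x := a <= x /\ x <= b /\ exists s, [/\ subdivision a x s,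
  `|f x - f a| <= e * (x - a) + \sum_(J <- s) `|f J.2 - f J.1| &
  ((\sum_(J <- s) (J.2 - J.1))%:E <= mu (G `&` `]a, x]))%E].
(* An interval of small slope is charged to the linear term, an interval inside [G] is added to the
   list; half-open intervals keep the measures additive. *)
have extend u v : S u -> u <= v -> v <= b ->
    `|f v - f u| <= e * (v - u) \/ `]u, v] `<=` G -> S v.
  move=> [au [ub [s [[s1 s2] sf sm]]]] uv vb H; split; [exact: le_trans uv|split=> //].
  have s1v : all (fun J => (a <= J.1) && (J.1 <= J.2) && (J.2 <= v)) s.
    by apply: sub_all s1 => J /andP[-> h] /=; exact: le_trans h uv.
  have mono (A B : set R) : measurable A -> measurable B -> A `<=` B -> (mu A <= mu B)%E.
    by move=> mA mB AB; rewrite le_measure ?inE.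
  have tri := ler_distD (f u) (f v) (f a).
  case: H => [good|bad].
    exists s; split=> //; first by rewrite (_ : v - a = (v - u) + (u - a)); [lra|ring].
    apply: le_trans sm _; apply: mono; [exact: measurableI|exact: measurableI|].
    by apply: setIS; apply: subset_itvl; rewrite bnd_simp.
  exists ((u, v) :: s); split.
  - split=> /=; first by rewrite au uv lexx s1v.
    rewrite s2 andbT; apply: sub_all s1 => J /= /andP[_ ->]; exact: orbT.
  - rewrite big_cons /= mulrBr in sf *; rewrite mulrBr.
    by have := ler_wpM2l e0 uv; lra.
  - rewrite big_cons /= EFinD -(lebesgue_measure_ocitv uv).
    have -> : G `&` `]a, v] = `]u, v] `|` (G `&` `]a, u]).
      apply/seteqP; split=> x /=; rewrite !in_itv /=.
        by move=> [Gx /andP[ax xv]]; case: (lerP x u) => xu; [right; rewrite ax|left; rewrite xv].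
      move=> [/andP[ux xv]|[Gx /andP[ax xu]]].
        by split; [apply: bad; rewrite /= in_itv /= ux xv|rewrite (le_lt_trans au ux) xv].
      by split=> //; rewrite ax (le_trans xu uv).
    rewrite measureU ?leeD2l //; first exact: measurableI.
    apply/seteqP; split=> x //= [].
    by rewrite !in_itv /= => /andP[ux _] [_ /andP[_ xu]]; rewrite ltNge xu in ux.
have Sa : S a.
  split=> //; split=> //; exists [::]; split=> //.
    by rewrite !subrr normr0 mulr0 big_nil addr0.
  by rewrite big_nil.
have supS : has_sup [set x | S x] by split; [exists a|exists b => x [_ []]].
set c := sup [set x | S x].
have ac : a <= c by apply: ub_le_sup => //; case: supS.
have cb : c <= b by apply: ge_sup; [exists a|move=> x [_ []]].
(* Whichever alternative holds at [c], every short interval with [c] as an end point is admissible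
   for [extend]: on the left to reach [c], on the right to pass it. *)
have [d d0 Hd] : exists2 d : R, 0 < d & forall u v, c - d < u -> u <= v -> v < c + d ->
    u = c \/ v = c -> `|f v - f u| <= e * (v - u) \/ `]u, v] `<=` G.
  have [Gc|[d d0 Hd]] := gauge c ac cb.
    have /nbhs_ballP[d /= d0 Hd] := open_nbhs_nbhs (conj oG Gc).
    exists d => // u v cu uv vc _; right=> x /=; rewrite in_itv /= => /andP[ux xv].
    by apply: Hd; rewrite /ball /= ltr_norml; lra.
  exists d => // u v cu uv vc H; left; case: H => E.
    have := Hd v; rewrite -E ger0_norm ?subr_ge0 //; apply; rewrite E; lra.
  have := Hd u; rewrite -E (distrC u v) (distrC (f u)) ger0_norm ?subr_ge0 //; apply; rewrite E; lra.
have Sc : S c.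
  have [u Su cu] := sup_adherent d0 supS.
  have uc : u <= c by apply: ub_le_sup => //; case: supS.
  by apply: (extend u c) => //; apply: Hd => //; [lra|right].
suff -> : b = c by case: Sc => _ [].
apply/le_anti; rewrite cb andbT leNgt; apply/negP => cltb.
pose v := Num.min b (c + d / 2).
have cv : c < v by rewrite lt_min cltb /=; lra.
have Sv : S v.
  apply: (extend c v) => //; [exact: ltW|by rewrite ge_min lexx|].
  apply: Hd; [lra|exact: ltW| |by left].
  by apply: le_lt_trans (_ : v <= c + d / 2) _; [rewrite ge_min lexx orbT|lra].
have : v <= c by apply: ub_le_sup => //; case: supS.
by rewrite leNgt cv.
Qed.

Lemma ae_itv (a b : R) (P : R -> Prop) : {ae mu, forall x, x \in `[a, b] -> P x} ->
  mu.-negligible [set x | a <= x /\ x <= b /\ ~ P x].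
Proof.
move=> [N [mN N0 PN]]; exists N; split=> // x /= [ax [xb nP]]; apply: PN => /= H.
by apply: nP; apply: H; rewrite in_itv /= ax.
Qed.

(** The exceptional null set is covered by an open set of measure below the [d] of absolute
    continuity, so the bad intervals contribute less than [e / 2]; the small slopes elsewhere
    contribute at most [e / 2]. *)
Lemma rac_derive0_constant f a b : a <= b -> rac a b f ->
  {ae mu, forall x, x \in `[a, b] -> is_derive x (1 : R) f 0} -> f b = f a.
Proof.
move=> ab acf /ae_itv neg.
apply/eqP; rewrite -subr_eq0 -normr_eq0; apply/eqP/le_anti; rewrite normr_ge0 andbT.
apply/ler_addgt0Pl => e e0; rewrite addr0.
have ba1 : 0 < b - a + 1 by lra.
have e1 : 0 < e / 2 / (b - a + 1) by rewrite !divr_gt0.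
have e2 : 0 < e / 2 by rewrite divr_gt0.
have [d d0 Hd] := acf _ e2.
have [G [oG NG Gd]] := negligible_open_cover d0 neg.
have [|s [ss sf sm]] := @small_increments f a b (e / 2 / (b - a + 1)) G (ltW e1) ab oG.
  move=> x ax xb; have [D|nD] := pselect (is_derive x (1 : R) f 0).
    by right; exact: is_derive0_near.
  by left; apply: NG.
have sd : \sum_(J <- s) (J.2 - J.1) < d.
  rewrite -lte_fin; apply: le_lt_trans sm _; apply: le_lt_trans Gd.
  have mG : measurable G by exact: open_measurable.
  by rewrite le_measure ?inE //; exact: measurableI.
have h1 := Hd s ss sd.
have h2 : e / 2 / (b - a + 1) * (b - a) <= e / 2.
  by rewrite mulrAC ler_pdivrMr // ler_wpM2l ?(ltW e2) // lerDl.
lra.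
Qed.

(** A sum of integrals over the pieces becomes one integral over a set of small measure, to which
    absolute continuity of the integral applies. Half-open pieces are disjoint even when
    adjacent. *)
Lemma subdivision_union (w : R -> R) (c a b : R) s : mu.-integrable `]-oo, c] (EFin \o w) -> b <= c ->
  subdivision a b s -> exists A : set R, [/\ measurable A, A `<=` `]a, b],
    (forall x, A x -> exists2 J, J \in s & J.1 < x /\ x <= J.2),
    (mu A <= (\sum_(J <- s) (J.2 - J.1))%:E)%E &
    \sum_(J <- s) (\int[mu]_(x in `]J.1, J.2]) `|w x|)%R = (\int[mu]_(x in A) `|w x|)%R].
Proof.
move=> wi bc [s1 s2]; elim: s s1 s2 => [|J s IH] /=.
  by move=> _ _; exists set0; split=> //; rewrite !big_nil ?measure0 ?Rintegral_set0.
move=> /andP[/andP[/andP[j1 j2] j3] /IH{IH}IH] /andP[p1 /IH{IH}[A [mA Aab AJ Am AI]]].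
exists (`]J.1, J.2] `|` A); split.
- exact: measurableU.
- move=> x [|/Aab//] /=; rewrite !in_itv /= => /andP[h1 h2].
  by rewrite (le_lt_trans j1 h1) (le_trans h2 j3).
- move=> x [|/AJ[K Ks xK]]; last by exists K => //; rewrite inE Ks orbT.
  by rewrite /= in_itv /= => /andP[h1 h2]; exists J => //; rewrite inE eqxx.
- rewrite big_cons EFinD; apply: (@le_trans _ _ (mu `]J.1, J.2]%classic + mu A)%E); first exact: measureU2.
  by rewrite leeD // lebesgue_measure_ocitv.
have disj : [disjoint (`]J.1, J.2] : set R) & A].
  apply/disj_setPS => x /= []; rewrite in_itv /= => /andP[h1 h2] /AJ[K Ks [k1 k2]].
  have /orP[JK|KJ] := allP p1 _ Ks.
    by have := le_lt_trans (le_trans h2 JK) k1; rewrite ltxx.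
  by have := le_lt_trans (le_trans k2 KJ) h1; rewrite ltxx.
rewrite big_cons AI Rintegral_setU //.
have -> : EFin \o (fun x => `|w x|) = abse \o (EFin \o w) by [].
apply: integrable_abse; apply: integrableS wi => //; first exact: measurableU.
move=> x [|/Aab] /=; rewrite !in_itv /= => /andP[_ h].
  by rewrite (le_trans h) // (le_trans j3).
by rewrite (le_trans h).
Qed.

Definition primitive w x : R := (\int[mu]_(t in `]-oo, x]) w t)%R.

Lemma primitiveB w (c u v : R) : mu.-integrable `]-oo, c] (EFin \o w) -> u <= v -> v <= c ->
  primitive w v - primitive w u = (\int[mu]_(t in `]u, v]) w t)%R.
Proof.
move=> wi uv vc; rewrite /primitive Rintegral_itvB //.
by apply: integrableS wi => //; apply: subset_itvl; rewrite bnd_simp.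
Qed.

Lemma primitive_rac w (a b : R) : mu.-integrable `]-oo, b] (EFin \o w) -> rac a b (primitive w).
Proof.
move=> wi e e0.
have wT : mu.-integrable setT (EFin \o (w \_ `]-oo, b])).
  by rewrite -restrict_EFin; apply/integrable_restrict => //=; rewrite setTI.
have [d [d0 Hd]] := integral_normr_continuous wT e0.
exists d => // s ss sd; have [A [mA Aab _ Am AI]] := subdivision_union wi (lexx b) ss.
have /Hd H : (mu A < d%:E)%E by apply: le_lt_trans Am _; rewrite lte_fin.
apply: le_lt_trans (H mA).
have -> : (\int[mu]_(x in A) `|(w \_ `]-oo, b]) x| = \int[mu]_(x in A) `|w x|)%R.
  apply: eq_Rintegral => x xA; rewrite patchE mem_set //.
  by have := Aab x (set_mem xA); rewrite /= !in_itv /= => /andP[].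
rewrite -AI; have [+ _] := ss; elim: s {ss sd A mA Aab Am AI H} => [|J s IH] /=.
  by rewrite !big_nil.
move=> /andP[/andP[/andP[j1 j2] j3] /IH{IH}IH]; rewrite !big_cons lerD //.
rewrite (primitiveB wi j2 j3); apply: le_normr_Rintegral => //.
apply: integrableS wi => // x /=; rewrite !in_itv /= => /andP[_ h].
exact: le_trans h j3.
Qed.

Lemma primitive_derive w : measurable_fun setT w -> (forall y, mu.-integrable `]-oo, y] (EFin \o w)) ->
  {ae mu, forall x, is_derive x (1 : R) (primitive w) (w x)}.
Proof.
move=> mw wi; have F := @ae_filter_ringOfSetsType _ _ R mu.
have lw : locally_integrable [set: R] w.
  split=> //; first exact: openT.
  move=> K _ cK; have [M [_ HM]] := compact_bounded cK.
  have /integrableP[_] := wi (M + 1); apply: le_lt_trans.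
  apply: ge0_subset_integral => //=; first exact: compact_measurable.
    by apply: measurable_funTS; apply/measurable_EFinP; exact: measurableT_comp.
  move=> x Kx /=; rewrite in_itv /=; apply: le_trans (ler_norm _) _.
  by apply: (HM (M + 1)) => //; rewrite ltrDl.
have := FTC1Ny wi lw; apply: filterS => x [dx xE]; apply: DeriveDef; first exact: dx.
by rewrite -derive1E.
Qed.

(** Subtracting a primitive of [g], cut off outside [[a, b]], leaves an absolutely continuous
    function with zero derivative almost everywhere on [[a, b]]. *)
Lemma rac_FTC f g a b : a <= b -> rac a b f -> mu.-integrable `[a, b] (EFin \o g) ->
  {ae mu, forall x, x \in `[a, b] -> is_derive x (1 : R) f (g x)} ->
  f b - f a = (\int[mu]_(x in `[a, b]) g x)%R.
Proof.
move=> ab acf gi fg; pose w := g \_ `[a, b].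
have wT : mu.-integrable setT (EFin \o w).
  by rewrite -restrict_EFin; apply/integrable_restrict => //=; rewrite setTI.
have wi y : mu.-integrable `]-oo, y] (EFin \o w) by exact: integrableS wT.
have mw : measurable_fun setT w by apply/measurable_EFinP; exact: measurable_int wT.
have cst : f b + -1 * primitive w b = f a + -1 * primitive w a.
  apply: (@rac_derive0_constant (fun x => f x + -1 * primitive w x)) => //.
    by apply: racD => //; apply/racZ/primitive_rac.
  have F := @ae_filter_ringOfSetsType _ _ R mu.
  apply: filterS2 fg (primitive_derive mw wi) => x fx px xab.
  have fx' := fx xab; rewrite /w patchE mem_set // in px.
  have := is_deriveD fx' (is_deriveZ (-1) px).
  by rewrite /GRing.scale /= mulN1r subrr.
have <- : primitive w b - primitive w a = (\int[mu]_(x in `[a, b]) g x)%R.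
  rewrite (primitiveB (wi b) ab (lexx b)).
  rewrite Rintegral_itv_obnd_cbnd; last by apply: integrableS wT.
  by apply: eq_Rintegral => x; rewrite inE => xab; rewrite /w patchE mem_set.
lra.
Qed.
End FundamentalTheorem.

(** * Sobolev functions on half-lines *)

Section Reflection.
Variable R : realType.
Local Notation mu := (@lebesgue_measure R).
Local Notation opp := (-%R : measurableTypeR R -> measurableTypeR R).
Implicit Types (D : set (measurableTypeR R)).

Let mopp : measurable_fun setT opp.
Proof. exact: oppr_measurable. Qed.

Lemma measurable_opp D : measurable D -> measurable (opp @^-1` D).
Proof. by move=> mD; rewrite -[X in measurable X]setTI; exact: mopp. Qed.

Lemma measurable_fun_opp D (f : R -> R) : measurable D -> measurable_fun D f ->
  measurable_fun (opp @^-1` D) (fun x => f (- x)).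
Proof.
move=> mD mf; apply: (measurable_comp mD _ mf) => //; first by move=> _ [x Dx <-].
Qed.

Lemma ge0_integral_opp D (f : R -> \bar R) : measurable D -> measurable_fun D f ->
  (forall x, D x -> (0 <= f x)%E) ->
  (\int[mu]_(x in D) f x = \int[mu]_(x in opp @^-1` D) f (- x)%R)%E.
Proof.
move=> mD mf f0; rewrite -(@ge0_integral_pushforward _ _ _ _ _ opp) //; last by move=> x; rewrite inE; exact: f0.
by apply: eq_measure_integral => A mA _; exact/esym/lebesgue_measureN.
Qed.

Lemma Rintegral_opp D (f : R -> R) : measurable D -> measurable_fun D f ->
  (\int[mu]_(x in D) f x = \int[mu]_(x in opp @^-1` D) f (- x))%R.
Proof.
move=> mD /measurable_EFinP mf; rewrite /Rintegral; congr fine.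
rewrite [LHS]integralE [RHS]integralE; congr (_ - _)%E.
  apply: etrans (_ : (\int[mu]_(x in D) (EFin \o f)^\+ x)%E = _) _ => //.
  rewrite (ge0_integral_opp mD (measurable_funepos mf)) //.
  by apply: eq_integral => x _; rewrite !funeposE.
apply: etrans (_ : (\int[mu]_(x in D) (EFin \o f)^\- x)%E = _) _ => //.
rewrite (ge0_integral_opp mD (measurable_funeneg mf)) //.
by apply: eq_integral => x _; rewrite !funenegE.
Qed.

Lemma ae_opp (P : R -> Prop) : {ae mu, forall x, P x} -> {ae mu, forall x, P (- x)}.
Proof.
move=> [N [mN N0 PN]]; exists (opp @^-1` N); split.
- exact: measurable_opp.
- by rewrite -N0 -(lebesgue_measureN mN).
- by move=> x nP; apply: PN.
Qed.

Lemma sqi_opp D (f : R -> R) : measurable D -> sqi D f -> sqi (opp @^-1` D) (fun x => f (- x)).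
Proof.
move=> mD [mf f2]; split; first exact: measurable_fun_opp.
rewrite -(@ge0_integral_opp D (fun x => (f x ^+ 2)%:E)) //.
  by apply/measurable_EFinP/measurable_funX.
by move=> x _; rewrite lee_fin sqr_ge0.
Qed.

Lemma rac_opp (a b : R) f : rac a b f -> rac (- b) (- a) (fun x => f (- x)).
Proof.
move=> acf e e0; have [d d0 Hd] := acf e e0; exists d => // s [s1 s2] sd.
have := Hd [seq (- J.2, - J.1) | J <- s]; rewrite !big_map /=.
rewrite (eq_bigr (fun J => J.2 - J.1)); last by move=> J _; rewrite opprK addrC.
under [X in _ -> _ -> X < _]eq_bigr do rewrite distrC.
apply=> //; split.
  rewrite all_map; apply: sub_all s1 => J /= /andP[/andP[h1 h2] h3].
  by rewrite lerN2 h2 -lerNr h3 -lerNl h1.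
rewrite pairwise_map; apply: sub_pairwise s2 => J K /=.
by rewrite !lerN2 orbC.
Qed.
End Reflection.

Section HalfLines.
Variable R : realType.
Local Notation mu := (@lebesgue_measure R).
Implicit Types (I : interval R) (f g u v d : R -> R).

(* As in [sobolev]: [f] is the continuous representative, and [u], [d] are
   almost everywhere equal to [f] and to its derivative. *)
Definition rsob I f u d := [/\
  (forall a b, a \in I -> b \in I -> a <= b -> rac a b f),
  aeI I (fun x => u x = f x),
  aeI I (fun x => is_derive x (1 : R) f (d x)),
  sqi [set` I] u & sqi [set` I] d].

Lemma rsob_opp I I' f u d : (forall x, (x \in I') = (- x \in I)) -> rsob I f u d ->
  rsob I' (fun x => f (- x)) (fun x => u (- x)) (fun x => -1 * d (- x)).
Proof.
move=> II [ac uf df su sd].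
have F := @ae_filter_ringOfSetsType _ _ R mu.
have mI : measurable ([set` I] : set (measurableTypeR R)) by exact: measurable_itv.
have E : [set` I'] = (-%R : measurableTypeR R -> measurableTypeR R) @^-1` [set` I].
  by apply/seteqP; split=> x /=; rewrite II.
split.
- move=> a b; rewrite !II => aI bI ab.
  by rewrite -[a]opprK -[b]opprK; apply/rac_opp/ac => //; rewrite lerN2.
- by move: (ae_opp uf); rewrite /aeI; apply: filterS => x H; rewrite II; exact: H.
- move: (ae_opp df); rewrite /aeI; apply: filterS => x H; rewrite II => xI.
  have Dx := H xI.
  have Dopp : is_derive x (1 : R) (fun t : R => - t) (-1) by exact: is_deriveNid.
  by rewrite mulrC; exact: (@is_derive1_comp R f (fun t => - t) x _ _ Dx Dopp).
- by rewrite E; exact: sqi_opp.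
- by apply: sqiZ; rewrite E; [exact: measurable_opp|exact: sqi_opp].
Qed.

Definition window (n : nat) : set (measurableTypeR R) := `[- n%:R, n%:R].

Lemma ge0_integral_exhaust (D : set (measurableTypeR R)) (h : R -> R) (M : R) : measurable D ->
  measurable_fun D h -> (forall x, 0 <= h x) ->
  (forall n : nat, (\int[mu]_(x in D `&` window n) (h x)%:E <= M%:E)%E) ->
  (\int[mu]_(x in D) (h x)%:E <= M%:E)%E.
Proof.
move=> mD mh h0 HM; pose F (n : nat) : set (measurableTypeR R) := D `&` window n.
have mF n : measurable (F n) by apply: measurableI; [exact: mD|exact: measurable_itv].
have FD n : F n `<=` D by move=> x [].
have DE : D = \bigcup_n F n.
  apply/seteqP; split=> [x Dx|x [n _ []//]]; exists (Num.bound `|x|) => //; split=> //=.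
  have := @archi_boundP R `|x| (normr_ge0 x).
  by rewrite /window /= in_itv /= ltr_norml => /andP[/ltW -> /ltW ->].
have ndF : nondecreasing_seq F.
  move=> m n mn; apply/subsetPset => x [Dx]; rewrite /window /= in_itv /= => /andP[h1 h2]; split=> //=.
  rewrite /window /= in_itv /= (le_trans h2) ?ler_nat // andbT (le_trans _ h1) // lerN2 ler_nat //.
have := @ge0_nondecreasing_set_cvg_integral _ _ R F (fun x => (h x)%:E) mu ndF mF.
rewrite -DE => H; apply: (cvge_to_le (H _ _)); last by apply: nearW => n; exact: HM.
- by move=> n; apply/measurable_EFinP; exact: (measurable_funS mD (FD n)).
- by move=> n x _; rewrite lee_fin.
Qed.

(** If every tail were at least [e], every window would carry at most the total minus [e], and by
    monotone convergence so would the whole of [D]. *)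
Lemma integrable_tail (D : set (measurableTypeR R)) (h : R -> R) e : measurable D ->
  mu.-integrable D (EFin \o h) -> (forall x, 0 <= h x) -> 0 < e ->
  exists n, (\int[mu]_(x in D `\` window n) (h x)%:E < e%:E)%E.
Proof.
move=> mD ih h0 e0; apply: contrapT => /forallNP H.
have /integrableP[/measurable_EFinP mh _] := ih.
have hfin : (\int[mu]_(x in D) (h x)%:E \is a fin_num)%E by exact: integrable_fin_num ih.
have mW n : measurable (window n) by exact: measurable_itv.
have : (\int[mu]_(x in D) (h x)%:E <= (fine (\int[mu]_(x in D) (h x)%:E) - e)%:E)%E.
  apply: ge0_integral_exhaust => // n.
  have mDI : measurable (D `&` window n) by exact: measurableI.
  have mDD : measurable (D `\` window n) by exact: measurableD.
  rewrite EFinB fineK // leeBrDr // -[in leRHS](setUIDK D (window n)) ge0_integral_setU //=.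
  - by rewrite leeD2l // leNgt; apply/negP; exact: H.
  - by rewrite setUIDK; apply/measurable_EFinP.
  - by move=> x _; rewrite lee_fin.
  - by apply/disj_setPS => x [[_ h1] [_ h2]].
by rewrite -{1}(fineK hfin) lee_fin; lra.
Qed.
End HalfLines.

(** * Integration by parts on half-lines *)

Section IntegrationByParts.
Variable R : realType.
Local Notation mu := (@lebesgue_measure R).
Implicit Types (f g u v d : R -> R).
Local Notation Rm := (`]-oo, 0%R]%classic : set (measurableTypeR R)).

Let mRm : measurable Rm. Proof. exact: measurable_itv. Qed.

Lemma rsob_prod_integrable (I : interval R) f u d g v e : rsob I f u d -> rsob I g v e ->
  mu.-integrable [set` I] (EFin \o (fun x => d x * v x + u x * e x)).
Proof.
move=> [_ _ _ su sd] [_ _ _ sv se].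
have mI : measurable ([set` I] : set (measurableTypeR R)) by exact: measurable_itv.
exact: (integrableD mI (sqi_mul_integrable mI sd sv) (sqi_mul_integrable mI su se)).
Qed.

Lemma rsob_prod_FTC (I : interval R) f u d g v e a b : rsob I f u d -> rsob I g v e ->
  a \in I -> b \in I -> a <= b ->
  f b * g b - f a * g a = (\int[mu]_(x in `]a, b]) (d x * v x + u x * e x))%R.
Proof.
move=> sf sg aI bI ab; have wi := rsob_prod_integrable sf sg.
move: sf sg => [acf uf df su sd] [acg vg dg sv se].
have sub : `[a, b] `<=` [set` I].
  by move=> x /=; rewrite in_itv /= => /andP[ax xb]; apply: (@interval_is_interval _ I a b aI bI); rewrite ax xb.
rewrite Rintegral_itv_obnd_cbnd; last first.
  by apply: integrableS wi => //; apply: subset_trans sub; apply: subset_itvr; rewrite bnd_simp.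
apply: (rac_FTC (f := fun x => f x * g x)) => //.
- by apply: racM; [exact: acf|exact: acg].
- exact: integrableS wi.
- have F := @ae_filter_ringOfSetsType _ _ R mu.
  rewrite /aeI in uf vg df dg.
  apply: filterS (filterI (filterI uf vg) (filterI df dg)) => x [[ux vx] [dx ex]] /sub xI.
  have := is_deriveM (dx xI) (ex xI).
  by rewrite (ux xI) (vx xI) /GRing.scale /= addrC [d x * _]mulrC.
Qed.

(** The boundary term at minus infinity is removed without pointwise decay: the product [u v] is
    integrable, hence small on average over a distant interval of length one. *)
Lemma rsob_parts_neg f u d g v e : rsob `]-oo, 0] f u d -> rsob `]-oo, 0] g v e ->
  (\int[mu]_(x in `]-oo, 0]) (d x * v x + u x * e x))%R = f 0 * g 0.
Proof.
move=> sf sg; have wi := rsob_prod_integrable sf sg.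
set w := (fun x => d x * v x + u x * e x) in wi *; set K := (\int[mu]_(x in _) _)%R.
have uvi : mu.-integrable Rm (EFin \o (fun x => u x * v x)).
  by case: sf sg => [_ _ _ su _] [_ _ _ sv _]; exact: sqi_mul_integrable.
apply/eqP; rewrite eq_sym -subr_eq0 -normr_eq0; apply/eqP/le_anti; rewrite normr_ge0 andbT.
apply/ler_addgt0Pl => r r0; rewrite addr0; have r2 : 0 < r / 2 by rewrite divr_gt0.
have abs_i h : mu.-integrable Rm (EFin \o h) -> mu.-integrable Rm (EFin \o (fun x => `|h x|)).
  by move=> hi; exact: (integrable_norm hi).
have [n1 Hn1] := integrable_tail mRm (abs_i _ wi) (fun x => normr_ge0 (w x)) r2.
have [n2 Hn2] := integrable_tail mRm (abs_i _ uvi) (fun x => normr_ge0 (u x * v x)) r2.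
pose m : R := (maxn n1 n2)%:R.
have m1 : n1%:R <= m by rewrite ler_nat leq_maxl.
have m2 : n2%:R <= m by rewrite ler_nat leq_maxr.
have m0 : 0 <= m by rewrite ler0n.
have tail (A : set (measurableTypeR R)) (n : nat) h : n%:R <= m -> measurable A -> mu.-integrable Rm (EFin \o h) ->
    (\int[mu]_(x in Rm `\` window n) (`|h x|)%:E < (r / 2)%:E)%E ->
    A `<=` `]-oo, (- m - 1)] -> (\int[mu]_(x in A) (`|h x|)%:E < (r / 2)%:E)%E.
  move=> nm mA hi Hn AS; apply: le_lt_trans Hn; apply: ge0_subset_integral => //=.
  - by apply: measurableD => //; exact: measurable_itv.
  - apply: (measurable_funS mRm) => //; exact: (measurable_int mu (abs_i _ hi)).
  - move=> x /AS; rewrite /window /= !in_itv /= => xm; split; first by lra.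
    by move=> /andP[]; lra.
set k := `|f 0 * g 0 - K|.
have kle a : a <= - m - 1 -> k <= `|f a * g a| + r / 2.
  move=> am; have a0 : a <= 0 by lra.
  have aI : a \in `]-oo, 0] by rewrite in_itv.
  have := rsob_prod_FTC sf sg aI (_ : 0 \in `]-oo, 0]) a0; rewrite in_itv /= lexx -/w => /(_ isT).
  have := @Rintegral_itvB _ w -oo%O (BRight 0) a wi; rewrite !bnd_simp => /(_ isT a0) <- ibp.
  have wia : mu.-integrable `]-oo, a] (EFin \o w).
    by apply: integrableS wi => //; apply: subset_itvl; rewrite bnd_simp.
  have mA : measurable (`]-oo, a]%classic : set (measurableTypeR R)) by exact: measurable_itv.
  have ltw : (\int[mu]_(x in `]-oo, a]) `|w x| < r / 2)%R.
    have : (\int[mu]_(x in `]-oo, a]) (`|w x|)%:E < (r / 2)%:E)%E.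
      apply: (tail _ n1) => // x /=; rewrite !in_itv /= => xa; exact: le_trans xa am.
    rewrite -[X in (X < _)%E]fineK ?lte_fin // .
    exact: integrable_fin_num (integrable_norm wia).
  have := le_normr_Rintegral mA wia; rewrite -[X in _ - _ = X - _]/K in ibp.
  move=> pp'; rewrite /k (_ : f 0 * g 0 - K = f a * g a - \int[mu]_(x in `]-oo, a]) w x)%R; last by lra.
  by rewrite (le_trans (ler_normB _ _)) // lerD2l (le_trans pp') // ltW.
(* Integrating [kle] over this interval of length one replaces [|f a * g a|] by an integral below
   [r / 2]. *)
have : (\int[mu]_(x in `[(- m - 2)%R, (- m - 1)%R]) (`|u x * v x|)%:E < (r / 2)%:E)%E.
  by apply: (tail _ n2) => // x /=; rewrite !in_itv /= => /andP[].
set S : set (measurableTypeR R) := [set` _] => SI.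
have mS : measurable S by exact: measurable_itv.
have SD : S `<=` Rm by move=> x; rewrite /S /= !in_itv /= => /andP[_]; lra.
have muS : mu S = 1%E.
  rewrite lebesgue_measure_itv /= lte_fin ifT; last by lra.
  by rewrite -EFinB; congr EFin; lra.
have muv : measurable_fun S (fun x => `|u x * v x|).
  apply: (measurable_funS mRm SD); apply/measurable_EFinP.
  exact: (measurable_int mu (abs_i _ uvi)).
have : (\int[mu]_(x in S) k%:E <= \int[mu]_(x in S) (`|u x * v x|%:E + (r / 2)%:E))%E.
  apply: ae_ge0_le_integral => //.
  - by move=> x _; rewrite lee_fin normr_ge0.
  - by move=> x _; rewrite -EFinD lee_fin addr_ge0 // ltW.
  - by apply/measurable_EFinP; apply: measurable_funD.
  - case: sf sg => [_ uf _ _ _] [_ vg _ _ _].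
    have F := @ae_filter_ringOfSetsType _ _ R mu; rewrite /aeI in uf vg.
    apply: filterS (filterI uf vg) => x [ux vx] xS; have xI := SD x xS.
    rewrite lee_fin (ux xI) (vx xI); apply: kle.
    by move: xS; rewrite /S /= in_itv /= => /andP[].
rewrite ge0_integralD //=; [|by apply/measurable_EFinP|by move=> x _; rewrite lee_fin ltW].
have cstE c : (\int[mu]_(x in S) (c%:E : \bar R) = c%:E)%E 
  by apply: etrans (integral_cst mu mS _) _; rewrite -[RHS]mule1; congr (_ * _)%E; exact: muS.
rewrite !cstE => H.
have : (k%:E <= (r / 2)%:E + (r / 2)%:E)%E by apply: le_trans H _; rewrite leeD2r // ltW.
by rewrite -EFinD lee_fin -splitr.
Qed.
End IntegrationByParts.

Section Exponentials.
Variable R : realType.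
Local Notation mu := (@lebesgue_measure R).
Implicit Types (c x y a b : R).

Lemma sqiS (D D' : set (measurableTypeR R)) (f : R -> R) : measurable D -> measurable D' ->
  D' `<=` D -> sqi D f -> sqi D' f.
Proof.
move=> mD mD' DD [mf f2]; split; first exact: measurable_funS mf.
apply: le_lt_trans f2; apply: ge0_subset_integral => //=.
  by apply/measurable_EFinP/measurable_funX.
by move=> x _; rewrite lee_fin sqr_ge0.
Qed.

Lemma rsob_parts_pos (f u d g v e : R -> R) : rsob `[0, +oo[ f u d -> rsob `[0, +oo[ g v e ->
  (\int[mu]_(x in `[0%R, +oo[) (d x * v x + u x * e x))%R = - (f 0 * g 0).
Proof.
move=> sf sg; have mD : measurable (`[0%R, +oo[%classic : set (measurableTypeR R)) by exact: measurable_itv.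
have mE : measurable (`]-oo, 0%R]%classic : set (measurableTypeR R)) by exact: measurable_itv.
have II x : (x \in `]-oo, 0%R]) = (- x \in `[0%R, +oo[) by rewrite !in_itv /= oppr_ge0 andbT.
have oppI : (-%R : measurableTypeR R -> measurableTypeR R) @^-1` `[0%R, +oo[ = `]-oo, 0%R]%classic.
  by apply/seteqP; split=> x /=; rewrite II.
have wi := rsob_prod_integrable sf sg.
have := rsob_parts_neg (rsob_opp II sf) (rsob_opp II sg); rewrite oppr0 => <-.
rewrite (Rintegral_opp mD); last by apply/measurable_EFinP; exact: (measurable_int mu wi).
have wi' := rsob_prod_integrable (rsob_opp II sf) (rsob_opp II sg).
have E := @RintegralZl _ _ _ mu _ _ (-1) mE wi'; rewrite oppI; apply: etrans (etrans E (mulN1r _)).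
by apply: eq_Rintegral => x _; ring.
Qed.

Lemma is_derive_expRZ c x : is_derive x (1 : R) (fun t => expR (c * t)) (c * expR (c * x)).
Proof.
have D1 := is_deriveZ c (is_derive_id x (1 : R)).
have := is_derive1_comp (is_derive_expR (c * x)) D1.
by rewrite /GRing.scale /= mulr1 mulrC.
Qed.

Lemma continuous_expRZ c : continuous (fun x => expR (c * x)).
Proof.
move=> x; apply: (@continuous_comp _ _ _ (fun t => c * t) expR); last exact: continuous_expR.
by apply: cvgM; [exact: cvg_cst|exact: cvg_id].
Qed.

Lemma rac_expRZ c a b : rac a b (fun x => expR (c * x)).
Proof.
have expB x y : `|expR y - expR x| <= Num.max (expR x) (expR y) * `|y - x|.
  wlog xy : x y / x <= y.
    move=> W; case: (leP x y) => [|/ltW] /W //.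
    by rewrite distrC maxC [`|x - y|]distrC.
  rewrite !ger0_norm ?subr_ge0 ?ler_expR // max_r ?ler_expR //.
  have := expR_ge1Dx (x - y); rewrite -(ler_pM2l (expR_gt0 y)) -expRD subrKC; lra.
apply: (@rac_lipschitz _ ((expR (c * a) + expR (c * b)) * `|c|)) => [|u v au uv vb].
  by rewrite mulr_ge0 ?addr_ge0 ?expR_ge0.
apply: le_trans (expB _ _) _; rewrite -mulrBr normrM mulrA [`|v - u|]ger0_norm ?subr_ge0 //.
rewrite ler_wpM2r ?subr_ge0 // ler_wpM2r // ge_max.
have mono x : a <= x -> x <= b -> expR (c * x) <= expR (c * a) + expR (c * b).
  move=> ax xb; have [c0|/ltW c0] := leP 0 c.
    by apply: le_trans (_ : expR (c * b) <= _); rewrite ?lerDr ?expR_ge0 // ler_expR ler_wpM2l.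
  by apply: le_trans (_ : expR (c * a) <= _); rewrite ?lerDl ?expR_ge0 // ler_expR ler_wnM2l.
by rewrite !mono // ?(le_trans uv) // (le_trans au).
Qed.

Lemma sqi_expR c y : 0 < c -> sqi (`]-oo, y]%classic : set (measurableTypeR R)) (fun x => expR (c * x)) /\
  (\int[mu]_(x in `]-oo, y]) (expR (c * x) ^+ 2)%:E <= (expR (c * y) ^+ 2 / (2 * c))%:E)%E.
Proof.
move=> c0; have mf D : measurable_fun D (fun x : measurableTypeR R => expR (c * x)).
  by apply: measurable_funTS; apply: continuous_measurable_fun; exact: continuous_expRZ.
suff le1 : (\int[mu]_(x in `]-oo, y]) (expR (c * x) ^+ 2)%:E <= (expR (c * y) ^+ 2 / (2 * c))%:E)%E.
  by split=> //; split=> //; apply: le_lt_trans le1 _; rewrite ltry.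
apply: (@ge0_integral_exhaust _ _ (fun x => expR (c * x) ^+ 2)) => [|||n].
- exact: measurable_itv.
- exact: measurable_funX.
- by move=> x; exact: sqr_ge0.
(* The minimum covers the case where the window lies to the right of [y]. *)
pose a := Num.min (- n%:R) y; have ay : a <= y by rewrite ge_min lexx orbT.
have E2 : (fun x => expR (c * x) ^+ 2) = (fun x => expR ((2 * c) * x)).
  by apply/funext => x; rewrite -expRM_natl; congr expR; ring.
have ci : mu.-integrable `[a, y] (EFin \o (fun x => expR ((2 * c) * x))).
  apply: continuous_compact_integrable; first exact: segment_compact.
  by apply: continuous_subspaceT; exact: continuous_expRZ.
apply: (@le_trans _ _ (\int[mu]_(x in `[a, y]) (expR (c * x) ^+ 2)%:E)%E).
  apply: ge0_subset_integral => //=.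
  - by apply: measurableI; exact: measurable_itv.
  - by apply/measurable_EFinP/measurable_funX.
  - move=> x [/=]; rewrite /window /= !in_itv /= => xy /andP[nx _].
    by rewrite xy andbT ge_min nx.
have := rac_FTC ay (racZ (2 * c)^-1 (@rac_expRZ (2 * c) a y)) ci.
have c2 : 2 * c != 0 by rewrite gt_eqF // mulr_gt0.
have F := @ae_filter_ringOfSetsType _ _ R mu.
have HD : {ae mu, forall x, x \in `[a, y] -> is_derive x (1 : R) (fun t => (2 * c)^-1 * expR (2 * c * t)) (expR (2 * c * x))}.
  apply: aeW => x _; have := is_deriveZ (2 * c)^-1 (is_derive_expRZ (2 * c) x).
  by rewrite /GRing.scale /= mulrA mulVf // mul1r.
move=> /(_ HD) intE; under eq_integral => x _ do rewrite (congr1 (@^~ x) E2).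
rewrite -[leLHS]fineK; last exact: integrable_fin_num ci.
rewrite lee_fin -[leLHS]intE (congr1 (@^~ y) E2) /= mulrC gerBl.
by rewrite mulr_ge0 ?expR_ge0 // invr_ge0 mulr_ge0 // ltW.
Qed.
End Exponentials.

(** * Square integrable solutions on the line *)

Section LineSolution.
Variable R : realType.
Local Notation mu := (@lebesgue_measure R).
Implicit Types (f g : R -> R) (tau x a b : R).
Let T : set (measurableTypeR R) := setT.

Lemma integrable_comb (D : set (measurableTypeR R)) (c1 c2 : R) (f1 f2 : R -> R) : measurable D ->
  mu.-integrable D (EFin \o f1) -> mu.-integrable D (EFin \o f2) ->
  mu.-integrable D (EFin \o (fun x => c1 * f1 x + c2 * f2 x)).
Proof. by move=> mD i1 i2; exact: (integrableD mD (integrableZl mD c1 i1) (integrableZl mD c2 i2)). Qed.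

Lemma Rintegral_comb (D : set (measurableTypeR R)) (c1 c2 : R) (f1 f2 : R -> R) : measurable D ->
  mu.-integrable D (EFin \o f1) -> mu.-integrable D (EFin \o f2) ->
  (\int[mu]_(x in D) (c1 * f1 x + c2 * f2 x) =
   c1 * (\int[mu]_(x in D) f1 x) + c2 * (\int[mu]_(x in D) f2 x))%R.
Proof.
move=> mD i1 i2; have j1 := integrableZl mD c1 i1; have j2 := integrableZl mD c2 i2.
by rewrite -(@RintegralZl _ _ _ mu _ _ c1 mD i1) -(@RintegralZl _ _ _ mu _ _ c2 mD i2); exact: (RintegralD mD j1 j2).
Qed.

Lemma rac_continuous f : (forall a b, rac a b f) -> continuous f.
Proof.
move=> acf x; apply/cvgrPdist_lt => e e0.
have [d d0 Hd] := rac_single e0 (acf (x - 1) (x + 1)).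
have m0 : 0 < Num.min d 1 by rewrite lt_min d0 ltr01.
apply/nbhs_ballP; exists (Num.min d 1) => //= y.
rewrite /ball /= lt_min => /andP[]; rewrite !ltr_norml => /andP[h1 h2] /andP[h3 h4].
have [xy|/ltW yx] := leP x y.
  by rewrite -ltr_norml distrC; apply: Hd; lra.
by rewrite -ltr_norml; apply: Hd; lra.
Qed.

Lemma rac_measurable f (D : set (measurableTypeR R)) : (forall a b, rac a b f) -> measurable_fun D f.
Proof.
by move=> acf; apply: measurable_funTS; apply: continuous_measurable_fun; exact: rac_continuous.
Qed.

(** The solution is [tau] times the integral of [exp (- tau (x - s)) g(s)] over [s <= x]. It is
    first shown to be bounded, and the energy identity on [[- n, n]] then bounds its square integral
    uniformly in [n]. *)
Lemma line_solution_pos tau g : 0 < tau -> sqi T g -> exists f, [/\ forall a b, rac a b f,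
  {ae mu, forall x, is_derive x (1 : R) f (- tau * f x + tau * g x)} & sqi T f].
Proof.
move=> tau0 sg; have [mg g2] := sg.
have mO y : measurable (`]-oo, y]%classic : set (measurableTypeR R)) by exact: measurable_itv.
have sgS (D : set (measurableTypeR R)) : measurable D -> sqi D g by move=> mD; exact: (sqiS measurableT mD (@subsetT _ D) sg).
pose w s := expR (tau * s) * g s.
have mE (D : set (measurableTypeR R)) c : measurable_fun D (fun x => expR (c * x)).
  by apply: measurable_funTS; apply: continuous_measurable_fun; exact: continuous_expRZ.
have mw : measurable_fun T w by exact: measurable_funM.
have wi y : mu.-integrable `]-oo, y] (EFin \o w).
  by apply: sqi_mul_integrable => //; [exact: (sqi_expR y tau0).1|exact: sgS].
pose P := primitive w; pose f x := tau * (expR (- tau * x) * P x).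
have acf a b : rac a b f by apply/racZ/racM; [exact: rac_expRZ|exact: primitive_rac].
have df : {ae mu, forall x, is_derive x (1 : R) f (- tau * f x + tau * g x)}.
  have F := @ae_filter_ringOfSetsType _ _ R mu.
  apply: filterS (primitive_derive mw wi) => x Px.
  have Dx := is_deriveZ tau (is_deriveM (is_derive_expRZ (- tau) x) Px).
  have ee : expR (- tau * x) * expR (tau * x) = 1 by rewrite -expRD mulNr addNr expR0.
  apply: (is_derive_eq Dx); rewrite /GRing.scale /= /f /w -/P -[tau * g x]mul1r -ee; ring.
exists f; split=> //.
have mf D : measurable_fun (D : set (measurableTypeR R)) f by exact: rac_measurable.
pose G := fine (\int[mu]_(x in T) (g x ^+ 2)%:E).
have GE : (\int[mu]_(x in T) (g x ^+ 2)%:E = G%:E)%E.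
  rewrite /G fineK // ge0_fin_numE // integral_ge0 // => x _.
  by rewrite lee_fin sqr_ge0.
have G0 : 0 <= G by rewrite -lee_fin -GE integral_ge0 // => x _; rewrite lee_fin sqr_ge0.
pose C := tau / 2 * (1 / (2 * tau) + G).
have fC x : `|f x| <= C.
  have ex0 := expR_gt0 (tau * x); have ey0 := expR_gt0 (- tau * x).
  have ee : expR (- tau * x) * expR (tau * x) = 1 by rewrite -expRD mulNr addNr expR0.
  (* AM-GM: [2 e^(tau s) |g| <= e^(2 tau s) / e^(tau x) + e^(tau x) g^2]. *)
  have PB : `|P x| <= expR (tau * x) / 2 * (1 / (2 * tau) + G).
    have sE := (sqi_expR x tau0).1; have sgx := sgS _ (mO x).
    apply: le_trans (le_normr_Rintegral (mO x) (wi x)) _.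
    pose h s := (2 * expR (tau * x))^-1 * expR (tau * s) ^+ 2 + expR (tau * x) / 2 * g s ^+ 2.
    have i1 := sqi_sqr_integrable sE; have i2 := sqi_sqr_integrable sgx.
    apply: le_trans (@le_Rintegral _ _ _ mu _ _ h (mO x) _ _ _) _.
    - exact: integrable_norm (wi x).
    - exact: integrable_comb i1 i2.
    - move=> s _; rewrite /w /h normrM ger0_norm ?expR_ge0 // -[g s ^+ 2]real_normK ?num_real //.
      move: (expR (tau * s)) (`|g s|) (expR (tau * x)) ex0 => e p E0 E0_gt0.
      rewrite (_ : _ + _ = e * p + (e - E0 * p) ^+ 2 / (2 * E0)); last by field; rewrite gt_eqF.
      by rewrite lerDl divr_ge0 ?sqr_ge0 // mulr_ge0 // ltW.
    have I1 : (\int[mu]_(s in `]-oo, x]) expR (tau * s) ^+ 2 <= expR (tau * x) ^+ 2 / (2 * tau))%R.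
      rewrite -lee_fin /Rintegral fineK; first exact: (sqi_expR x tau0).2.
      exact: integrable_fin_num i1.
    have I2 : (\int[mu]_(s in `]-oo, x]) g s ^+ 2 <= G)%R.
      rewrite -lee_fin /Rintegral fineK; last exact: integrable_fin_num i2.
      rewrite -GE; apply: ge0_subset_integral => //=; first exact: measurableT.
        by apply/measurable_EFinP/measurable_funX.
      by move=> t _; rewrite lee_fin sqr_ge0.
    have := Rintegral_comb (2 * expR (tau * x))^-1 (expR (tau * x) / 2) (mO x) i1 i2; rewrite -/h => ->.
    move: I1 I2; move: (Rintegral _ _ _) (Rintegral _ _ _) => p' p I1 I2.
    have I3 : (2 * expR (tau * x))^-1 * p <= (2 * expR (tau * x))^-1 * (expR (tau * x) ^+ 2 / (2 * tau)).
      by rewrite ler_wpM2l // invr_ge0 mulr_ge0 // ltW.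
    have I4 : expR (tau * x) / 2 * p' <= expR (tau * x) / 2 * G.
      by rewrite ler_wpM2l // divr_ge0 // ltW.
    apply: le_trans (lerD I3 I4) _; rewrite mulrDr lerD2r le_eqVlt; apply/orP; left; apply/eqP.
    by field; rewrite !gt_eqF.
  rewrite /f !normrM (gtr0_norm tau0) (gtr0_norm ey0).
  rewrite /C; move: (1 / (2 * tau) + G) PB => X PB; have := ler_wpM2l (ltW ey0) PB.
  rewrite [leRHS](_ : _ = expR (- tau * x) * expR (tau * x) * (X / 2)); last by ring.
  by rewrite ee => /(ler_wpM2l (ltW tau0)); lra.
(* The bound [C] serves for [f (- n) ^ 2]; the term at the right end has the favourable sign. *)
have energy n : (\int[mu]_(x in T `&` window n) (f x ^+ 2)%:E <= (C ^+ 2 / tau + G)%:E)%E.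
  pose a : R := - n%:R; pose b : R := n%:R; have ab : a <= b by rewrite /a /b; have := ler0n R n; lra.
  have mab : measurable (`[a, b]%classic : set (measurableTypeR R)) by exact: measurable_itv.
  have m1 : sqi (`[a, b]%classic : set (measurableTypeR R)) f.
    split=> //; have ci : mu.-integrable `[a, b] (EFin \o (fun x => f x ^+ 2)).
      apply: continuous_compact_integrable; first exact: segment_compact.
      by apply: continuous_subspaceT; apply: rac_continuous => u v; exact: racM.
    by rewrite -ge0_fin_numE ?integral_ge0 //; [exact: integrable_fin_num ci|move=> x _; rewrite lee_fin sqr_ge0].
  have m2 := sgS _ mab.
  have fi := sqi_sqr_integrable m1; have gi := sqi_sqr_integrable m2; have fgi := sqi_mul_integrable mab m1 m2.
  pose F := (\int[mu]_(x in `[a, b]) (f x ^+ 2))%R; pose G' := (\int[mu]_(x in `[a, b]) (g x ^+ 2))%R.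
  have di : mu.-integrable `[a, b] (EFin \o (fun x => - 2 * tau * f x ^+ 2 + 2 * tau * (f x * g x))).
    exact: integrable_comb.
  have G'G : G' <= G.
    rewrite -lee_fin /G' /Rintegral fineK; last exact: integrable_fin_num gi.
    rewrite -GE; apply: ge0_subset_integral => //=; first exact: measurableT.
      by apply/measurable_EFinP/measurable_funX.
    by move=> t _; rewrite lee_fin sqr_ge0.
  have ftc : f b * f b - f a * f a = (\int[mu]_(x in `[a, b]) (- 2 * tau * f x ^+ 2 + 2 * tau * (f x * g x)))%R.
    apply: (@rac_FTC R (fun x => f x * f x)) => //; first exact: racM.
    have FF := @ae_filter_ringOfSetsType _ _ R mu.
    apply: filterS df => x dx _; apply: (is_derive_eq (is_deriveM dx dx)).
    by rewrite /GRing.scale /=; ring.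
  (* [(f^2)' = - 2 tau f^2 + 2 tau f g <= - tau f^2 + tau g^2] *)
  have le1 : f b * f b - f a * f a <= - tau * F + tau * G'.
    rewrite ftc -[leRHS](Rintegral_comb _ _ mab fi gi).
    apply: le_Rintegral => //; first exact: integrable_comb.
    move=> x _; have := mulr_ge0 (ltW tau0) (sqr_ge0 (f x - g x)); lra.
  have fa : f a * f a <= C ^+ 2.
    have := ler_pM (normr_ge0 _) (normr_ge0 _) (fC a) (fC a).
    by rewrite -expr2 real_normK ?num_real // -!expr2.
  have H : tau * F <= C ^+ 2 + tau * G.
    by have := ler_wpM2l (ltW tau0) G'G; have := sqr_ge0 (f b); rewrite expr2; lra.
  rewrite setTI -[leLHS]fineK; last exact: integrable_fin_num fi.
  rewrite lee_fin -[leLHS]/F -(ler_pM2l tau0) mulrDr [tau * (_ / _)]mulrC divfK ?gt_eqF //.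
split=> //; apply: le_lt_trans (_ : ((C ^+ 2 / tau + G)%:E < +oo)%E); last by rewrite ltry.
apply: (@ge0_integral_exhaust _ _ (fun x => f x ^+ 2)) => //.
- exact: measurableT.
- exact: measurable_funX.
- by move=> x; exact: sqr_ge0.
Qed.

Lemma line_solution tau g : tau != 0 -> sqi T g -> exists f, [/\ forall a b, rac a b f,
  {ae mu, forall x, is_derive x (1 : R) f (- tau * f x + tau * g x)} & sqi T f].
Proof.
rewrite neq_lt => /orP[tau0|]; last exact: line_solution_pos.
move=> sg; have sg' : sqi T (fun x => g (- x)) by exact: (sqi_opp measurableT sg).
have ntau0 : 0 < - tau by rewrite oppr_gt0.
have [f [acf df sf]] := line_solution_pos ntau0 sg'; exists (fun x => f (- x)); split.
- by move=> a b; rewrite -[a]opprK -[b]opprK; exact: rac_opp.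
- have F := @ae_filter_ringOfSetsType _ _ R mu.
  apply: filterS (ae_opp df) => x dx.
  have Dopp : is_derive x (1 : R) (fun t : R => - t) (-1) by exact: is_deriveNid.
  apply: (is_derive_eq (@is_derive1_comp R f (fun t => - t) x _ _ dx Dopp)).
  by rewrite !opprK; ring.
- exact: (sqi_opp measurableT sf).
Qed.
End LineSolution.

Section RealSobolev.
Variable R : realType.
Local Notation mu := (@lebesgue_measure R).
Implicit Types (I : interval R) (f g u v d e : R -> R) (a b x : R).

Let mI I : measurable ([set` I] : set (measurableTypeR R)). Proof. exact: measurable_itv. Qed.

Lemma rsob_ae I f u d u' d' : rsob I f u d -> sqi [set` I] u' -> sqi [set` I] d' ->
  aeI I (fun x => u' x = f x) -> aeI I (fun x => d' x = d x) -> rsob I f u' d'.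
Proof.
move=> [acf _ df _ _] su sd uf dd; split=> //.
by apply: aeI2 df dd => x _ dx ->.
Qed.

Lemma rsobD I f u d g v e : rsob I f u d -> rsob I g v e ->
  rsob I (fun x => f x + g x) (fun x => u x + v x) (fun x => d x + e x).
Proof.
move=> [acf uf df su sd] [acg vg dg sv se]; split.
- by move=> a b aI bI ab; apply: racD; [exact: acf|exact: acg].
- by apply: aeI2 uf vg => x _ -> ->.
- by apply: aeI2 df dg => x _ dx ex; exact: is_deriveD dx ex.
- exact: sqiD.
- exact: sqiD.
Qed.

Lemma rsobZ I c f u d : rsob I f u d ->
  rsob I (fun x => c * f x) (fun x => c * u x) (fun x => c * d x).
Proof.
move=> [acf uf df su sd]; split.
- by move=> a b aI bI ab; apply: racZ; exact: acf.
- by apply: aeI1 uf => x _ ->.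
- by apply: aeI1 df => x _ dx; exact: (is_deriveZ c dx).
- exact: sqiZ.
- exact: sqiZ.
Qed.

Lemma ae_ex a b (P : R -> Prop) : a < b -> {ae mu, forall x, x \in `[a, b] -> P x} ->
  exists2 x, x \in `[a, b] & P x.
Proof.
move=> ab [N [mN N0 PN]]; apply: contrapT => H.
have abN : `[a, b]%classic `<=` N.
  move=> x xab; apply: PN => /= Px; apply: H; exists x => //; exact: Px.
have : (mu `[a, b]%classic <= mu N)%E by apply: le_measure; rewrite ?inE.
by rewrite N0 lebesgue_measure_itv /= lte_fin ab -EFinB lee_fin; lra.
Qed.

(** This makes the derivative a function of the class and so [M_h] single-valued. A continuous
    function vanishing almost everywhere vanishes, as every interval contains good points. *)
Lemma rsob_zero_neg f u d : rsob `]-oo, 0] f u d -> aeI `]-oo, 0] (fun x => u x = 0) ->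
  (forall x, x <= 0 -> f x = 0) /\ aeI `]-oo, 0] (fun x => d x = 0).
Proof.
move=> [acf uf df _ _] u0.
have F := @ae_filter_ringOfSetsType _ _ R mu.
have f0 x : x <= 0 -> f x = 0.
  move=> x0; apply/eqP; rewrite -normr_eq0; apply/eqP/le_anti; rewrite normr_ge0 andbT.
  apply/ler_addgt0Pl => e e0; rewrite addr0.
  have [|dl dl0 Hd] := @rac_single _ (x - 1) x f e e0; first by apply: acf; rewrite ?in_itv /=; lra.
  pose y := Num.max (x - 1) (x - dl / 2).
  have yx : y < x by rewrite gt_max; apply/andP; split; lra.
  have [|z] := @ae_ex y x (fun z => f z = 0) yx.
    rewrite /aeI in uf u0; apply: filterS (filterI uf u0) => z [uz zz]; rewrite in_itv /= => /andP[_ zx].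
    have zI : z \in `]-oo, 0] by rewrite in_itv /= (le_trans zx).
    by rewrite -uz // zz.
  rewrite in_itv /= ge_max => /andP[/andP[h1 h2] h3] fz.
  have := Hd z x h1 h3 (lexx x); rewrite fz subr0 => /(_ _)/ltW; apply; lra.
split=> //.
(* The derivative is two-sided while [f] is known only for [x <= 0], so the end point is discarded
   as a null set. *)
have : {ae mu, forall x, x != 0}.
  exists [set 0]; split=> //; first exact: lebesgue_measure_set1.
  by move=> x /= /negP; rewrite negbK => /eqP.
move: df; rewrite /aeI => df ne0; apply: filterS2 df ne0 => x dx xn0; rewrite in_itv /= => x0.
have x_lt0 : x < 0 by rewrite lt_neqAle xn0.
have xI : x \in `]-oo, 0] by rewrite in_itv.
have D1 := dx xI.
have D2 : is_derive x (1 : R) f 0.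
  apply: near_eq_is_derive (is_derive_cst (0 : R) x (1 : R)).
  have : \forall y \near x, y < 0 by exact: lt_nbhsl.
  by apply: filterS => y y0; rewrite f0 // ltW.
have := @derive_val _ _ _ _ _ _ _ D1; rewrite (@derive_val _ _ _ _ _ _ _ D2) => ->//.
Qed.
End RealSobolev.

Section ComplexSobolev.
Variable R : realType.
Local Notation C := R[i].
Local Notation mu := (@lebesgue_measure R).
Implicit Types (I : interval R) (phi psi : R -> C).

Let mI I : measurable ([set` I] : set (measurableTypeR R)). Proof. exact: measurable_itv. Qed.

Lemma rsob_zero_pos (f u d : R -> R) : rsob `[0, +oo[ f u d -> aeI `[0, +oo[ (fun x => u x = 0) ->
  (forall x, 0 <= x -> f x = 0) /\ aeI `[0, +oo[ (fun x => d x = 0).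
Proof.
have II (x : R) : (x \in `]-oo, 0%R]) = (- x \in `[0%R, +oo[) by rewrite !in_itv /= oppr_ge0 andbT.
have F := @ae_filter_ringOfSetsType _ _ R mu.
move=> /(rsob_opp II)/rsob_zero_neg H u0; have [|f0 d0] := H.
  move: (ae_opp u0); rewrite /aeI; apply: filterS => x Hx; rewrite II; exact: Hx.
split=> [x x0|]; first by have := f0 (- x); rewrite opprK oppr_le0; apply.
move: (ae_opp d0); rewrite /aeI; apply: filterS => x; rewrite II opprK => Hx /Hx.
by move/eqP; rewrite mulN1r oppr_eq0 => /eqP.
Qed.

Lemma sobolevP I phi (u du : L2 I) : sobolev phi u du <->
  rsob I (fun x => Re (phi x)) (fun x => Re (repr u x)) (fun x => Re (repr du x)) /\
  rsob I (fun x => Im (phi x)) (fun x => Im (repr u x)) (fun x => Im (repr du x)).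
Proof.
have [ur ui] := L2_sqi u; have [dr di] := L2_sqi du.
split=> [[lac uf df]|[[ar fr er _ _] [ai fi ei _ _]]].
  split; split=> //.
  - by move=> a b aI bI ab; have /abs_continuousP[] := lac a b aI bI ab.
  - by apply: aeI1 uf => x _ ->.
  - by apply: aeI1 df => x _ [].
  - by move=> a b aI bI ab; have /abs_continuousP[] := lac a b aI bI ab.
  - by apply: aeI1 uf => x _ ->.
  - by apply: aeI1 df => x _ [].
split.
- by move=> a b aI bI ab; apply/abs_continuousP; split; [exact: ar|exact: ai].
- by apply: aeI2 fr fi => x _ h1 h2; exact: complex_eq.
- by apply: aeI2 er ei => x _ h1 h2.
Qed.

Lemma sobolev_linear I (a : C) phi psi (u v du dv : L2 I) : sobolev phi u du -> sobolev psi v dv ->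
  sobolev (fun x => a * phi x + psi x) (a *: u + v) (a *: du + dv).
Proof.
move=> /sobolevP[ur ui] /sobolevP[vr vi]; apply/sobolevP.
have [s1 s2] := L2_sqi (a *: u + v); have [s3 s4] := L2_sqi (a *: du + dv).
split.
  have := rsobD (rsobD (rsobZ (Re a) ur) (rsobZ (- Im a) ui)) vr => H.
  rewrite (_ : (fun x => Re (a * phi x + psi x)) =
    (fun x => Re a * Re (phi x) + - Im a * Im (phi x) + Re (psi x))); last first.
    by apply/funext => x; rewrite cReD cReM; ring.
  apply: (rsob_ae H) => //; first last.
    by apply: aeI1 (repr_linear a du dv) => x _ ->; rewrite cReD cReM; ring.
  case: H => _ H _ _ _; apply: aeI2 (repr_linear a u v) H => x _ -> <-.
  by rewrite cReD cReM; ring.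
have := rsobD (rsobD (rsobZ (Re a) ui) (rsobZ (Im a) ur)) vi => H.
rewrite (_ : (fun x => Im (a * phi x + psi x)) =
  (fun x => Re a * Im (phi x) + Im a * Re (phi x) + Im (psi x))); last first.
  by apply/funext => x; rewrite cImD cImM; ring.
apply: (rsob_ae H) => //; first last.
  by apply: aeI1 (repr_linear a du dv) => x _ ->; rewrite cImD cImM; ring.
case: H => _ H _ _ _; apply: aeI2 (repr_linear a u v) H => x _ -> <-.
by rewrite cImD cImM; ring.
Qed.

Lemma sobolev_zero_neg phi (du : L2 `]-oo, (0 : R)]) : sobolev phi 0 du -> phi 0 = 0 /\ du = 0.
Proof.
move=> /sobolevP[ur ui].
have z1 : aeI `]-oo, (0 : R)] (fun x => Re (repr (0 : L2 `]-oo, (0 : R)]) x) = 0).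
  by apply: aeI1 (repr0 _) => x _ ->.
have z2 : aeI `]-oo, (0 : R)] (fun x => Im (repr (0 : L2 `]-oo, (0 : R)]) x) = 0).
  by apply: aeI1 (repr0 _) => x _ ->.
have [f1 d1] := rsob_zero_neg ur z1; have [f2 d2] := rsob_zero_neg ui z2.
split; first by apply: complex_eq; rewrite ?f1 ?f2.
apply: L2_ext; have dz : aeI `]-oo, (0 : R)] (fun x => repr du x = 0) by apply: aeI2 d1 d2 => x _ ? ?; exact: complex_eq.
by apply: aeI2 dz (repr0 _) => x _ -> ->.
Qed.

Lemma sobolev_zero_pos phi (du : L2 `[(0 : R), +oo[) : sobolev phi 0 du -> phi 0 = 0 /\ du = 0.
Proof.
move=> /sobolevP[ur ui].
have z1 : aeI `[(0 : R), +oo[ (fun x => Re (repr (0 : L2 `[(0 : R), +oo[) x) = 0).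
  by apply: aeI1 (repr0 _) => x _ ->.
have z2 : aeI `[(0 : R), +oo[ (fun x => Im (repr (0 : L2 `[(0 : R), +oo[) x) = 0).
  by apply: aeI1 (repr0 _) => x _ ->.
have [f1 d1] := rsob_zero_pos ur z1; have [f2 d2] := rsob_zero_pos ui z2.
split; first by apply: complex_eq; rewrite ?f1 ?f2.
apply: L2_ext; have dz : aeI `[(0 : R), +oo[ (fun x => repr du x = 0) by apply: aeI2 d1 d2 => x _ ? ?; exact: complex_eq.
by apply: aeI2 dz (repr0 _) => x _ -> ->.
Qed.

(** The sign [c] is 1 when zero is the right end of the half-line and -1 when it is the left one;
    the complex identity combines four real ones. *)
Lemma sobolev_parts I (c : R) : (forall f u d g v e : R -> R, rsob I f u d -> rsob I g v e ->
    (\int[mu]_(x in [set` I]) (d x * v x + u x * e x))%R = c * (f 0 * g 0)) ->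
  forall phi psi (u v du dv : L2 I), sobolev phi u du -> sobolev psi v dv ->
    dotL2 du v + dotL2 u dv = c%:C * (phi 0 * conjc (psi 0)).
Proof.
move=> parts phi psi u v du dv /sobolevP[ur ui] /sobolevP[vr vi].
have prod := rsob_prod_integrable; have D (f g : R -> R) := @RintegralD _ _ _ mu [set` I] f g (mI I).
have B (f g : R -> R) := @RintegralB _ _ _ mu [set` I] f g (mI I).
rewrite !dotL2E; apply: complex_eq; rewrite !(cReD, cImD, cReM, cImM, cReJ, cImJ) /=.
  rewrite -D; [|exact: wRe_integrable|exact: wRe_integrable].
  have E := congr2 +%R (parts _ _ _ _ _ _ ur vr) (parts _ _ _ _ _ _ ui vi).
  rewrite -D in E; [|exact: prod ur vr|exact: prod ui vi].
  apply: etrans (etrans _ E) _; last by ring.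
  by apply: eq_Rintegral => x _; rewrite /wRe; ring.
rewrite -D; [|exact: wIm_integrable|exact: wIm_integrable].
have E := congr2 (fun x y => x - y) (parts _ _ _ _ _ _ ui vr) (parts _ _ _ _ _ _ ur vi).
rewrite -B in E; [|exact: prod ui vr|exact: prod ur vi].
apply: etrans (etrans _ E) _; last by ring.
by apply: eq_Rintegral => x _; rewrite /wIm; ring.
Qed.

Lemma sobolev_parts_neg phi psi (u v du dv : L2 `]-oo, (0 : R)]) : sobolev phi u du -> sobolev psi v dv ->
  dotL2 du v + dotL2 u dv = phi 0 * conjc (psi 0).
Proof.
move=> su sv; rewrite (@sobolev_parts _ 1 _ _ _ _ _ _ _ su sv) ?rmorph1 ?mul1r // => f a d g b e sf sg.
by rewrite mul1r; exact: rsob_parts_neg.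
Qed.

Lemma sobolev_parts_pos phi psi (u v du dv : L2 `[(0 : R), +oo[) : sobolev phi u du -> sobolev psi v dv ->
  dotL2 du v + dotL2 u dv = - (phi 0 * conjc (psi 0)).
Proof.
move=> su sv; rewrite (@sobolev_parts _ (-1) _ _ _ _ _ _ _ su sv) ?rmorphN1 ?mulN1r // => f a d g b e sf sg.
by rewrite mulN1r; exact: rsob_parts_pos.
Qed.
End ComplexSobolev.

Section SobolevExistence.
Variable R : realType.
Local Notation C := R[i].
Local Notation mu := (@lebesgue_measure R).
Implicit Types (I : interval R) (tau : R).
Local Open Scope quotient_scope.

Let mI I : measurable ([set` I] : set (measurableTypeR R)). Proof. exact: measurable_itv. Qed.

Lemma L2_of I (f : R -> C) : sqi [set` I] (fun x => Re (f x)) -> sqi [set` I] (fun x => Im (f x)) ->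
  exists u : L2 I, aeI I (fun x => repr u x = f x).
Proof.
move=> fr fi; have fL : f \in L2fun I by rewrite inE; apply/sqr_integrableP.
by exists (\pi_(L2 I) (MkL2rep fL)); exact: repr_pi.
Qed.

Lemma repr_affine I tau (u f : L2 I) :
  aeI I (fun x => repr (- tau%:C *: (u - f)) x = - tau%:C * repr u x + tau%:C * repr f x).
Proof.
rewrite (_ : - tau%:C *: (u - f) = - tau%:C *: u + (tau%:C *: f + 0)); last first.
  by rewrite scalerBr !scaleNr opprK addr0.
have h : aeI I (fun x => repr (tau%:C *: f + 0) x = tau%:C * repr f x).
  by apply: aeI2 (repr_linear tau%:C f 0) (repr0 I) => x _ -> ->; rewrite addr0.
by apply: aeI2 (repr_linear (- tau%:C) u (tau%:C *: f + 0)) h => x _ -> ->.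
Qed.

Lemma sobolev_solution I tau (f : L2 I) : tau != 0 ->
  exists phi (u : L2 I), sobolev phi u (- tau%:C *: (u - f)).
Proof.
move=> tau0; have [fr fi] := L2_sqi f.
(* The right-hand side is extended by zero, so that the equation can be solved on the whole line. *)
have patch (g : R -> R) : sqi [set` I] g -> sqi setT (g \_ [set` I]).
  move=> [mg g2]; split; first by apply/measurable_restrict => //; rewrite setTI.
  apply: le_lt_trans g2; rewrite [leRHS]integral_mkcond le_eqVlt; apply/orP; left; apply/eqP.
  apply: eq_integral => x _; rewrite !patchE; case: ifP => // _.
  by rewrite expr0n.
have real_solution (g : R -> R) : sqi [set` I] g -> exists h : R -> R,
    sqi [set` I] h /\ rsob I h h (fun x => - tau * h x + tau * g x).
  move=> sg; have [h [ach dh sh]] := line_solution tau0 (patch _ sg); exists h.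
  have shI : sqi [set` I] h by exact: sqiS sh.
  have F := @ae_filter_ringOfSetsType _ _ R mu.
  split=> //; split=> //; first by apply: aeW.
    rewrite /aeI; apply: filterS dh => x; rewrite patchE => dx xI.
    by rewrite mem_set in dx.
  by apply: sqiD => //; exact: sqiZ.
have [h1 [s1 r1]] := real_solution _ fr; have [h2 [s2 r2]] := real_solution _ fi.
pose phi x : C := h1 x +i* h2 x.
have [u uphi] := @L2_of I phi s1 s2; exists phi, u; apply/sobolevP.
have [ur ui] := L2_sqi u; have [dr di] := L2_sqi (- tau%:C *: (u - f)).
split; [apply: (rsob_ae r1) | apply: (rsob_ae r2)] => //.
- by apply: aeI1 uphi => x _ ->.
- apply: aeI2 uphi (repr_affine tau u f) => x _ h -> ; rewrite h.
  by rewrite !(cReD, cReN, cReM, cImN) /=; ring.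
- by apply: aeI1 uphi => x _ ->.
- apply: aeI2 uphi (repr_affine tau u f) => x _ h -> ; rewrite h.
  by rewrite !(cImD, cReN, cImM, cImN) /=; ring.
Qed.

Lemma sobolev_exp I tau : sqi [set` I] (fun x => expR (- tau * x)) ->
  exists phi (u : L2 I), sobolev phi u (- tau%:C *: u) /\ phi 0 = 1.
Proof.
move=> se; pose phi x : C := (expR (- tau * x))%:C.
have s0 : sqi [set` I] (fun=> 0 : R).
  have := sqiZ (mI I) 0 se; rewrite (_ : (fun x => _) = (fun=> 0)) //.
  by apply/funext => x; rewrite mul0r.
have [u uphi] := @L2_of I phi se s0; exists phi, u; split; last by rewrite /phi mulr0 expR0.
have [ur ui] := L2_sqi u; have [dr di] := L2_sqi (- tau%:C *: u).
have r1 : rsob I (fun x => expR (- tau * x)) (fun x => expR (- tau * x)) (fun x => - tau * expR (- tau * x)).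
  split=> //; [by move=> *; exact: rac_expRZ|by apply: aeW|by apply: aeW => x _; exact: is_derive_expRZ|exact: sqiZ].
have r0 : rsob I (fun=> 0 : R) (fun=> 0) (fun=> 0).
  have := rsobZ 0 r1; rewrite (_ : (fun x => 0 * expR _) = (fun=> 0)); last by apply/funext => x; rewrite mul0r.
  by rewrite (_ : (fun x => 0 * _) = (fun=> 0)) //; apply/funext => x; rewrite mul0r.
have du : aeI I (fun x => repr (- tau%:C *: u) x = - tau%:C * phi x).
  have := repr_linear (- tau%:C) u 0; rewrite addr0 => E.
  have E' : aeI I (fun x => repr (- tau%:C *: u) x = - tau%:C * repr u x).
    by apply: aeI2 E (repr0 I) => x _ -> ->; rewrite addr0.
  by apply: aeI2 uphi E' => x _ -> ->.
apply/sobolevP; split; [apply: (rsob_ae r1) | apply: (rsob_ae r0)] => //.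
- by apply: aeI1 uphi => x _ ->.
- by apply: aeI1 du => x _ ->; rewrite !(cReN, cReM, cImN) /=; ring.
- by apply: aeI1 uphi => x _ ->.
- by apply: aeI1 du => x _ ->; rewrite !(cReN, cImM, cImN) /=; ring.
Qed.

Lemma sobolev_exp_neg tau : tau < 0 ->
  exists phi (u : L2 `]-oo, (0 : R)]), sobolev phi u (- tau%:C *: u) /\ phi 0 = 1.
Proof. by rewrite -oppr_gt0 => tau0; apply: sobolev_exp; exact: (sqi_expR 0 tau0).1. Qed.

Lemma sobolev_exp_pos tau : 0 < tau ->
  exists phi (u : L2 `[(0 : R), +oo[), sobolev phi u (- tau%:C *: u) /\ phi 0 = 1.
Proof.
move=> tau0; apply: sobolev_exp.
have mD : measurable (`]-oo, 0%R]%classic : set (measurableTypeR R)) by exact: measurable_itv.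
have := sqi_opp mD (sqi_expR 0 tau0).1.
rewrite (_ : _ @^-1` _ = `[0%R, +oo[%classic); last first.
  by apply/seteqP; split=> x /=; rewrite !in_itv /= oppr_le0 andbT.
by rewrite (_ : (fun x => expR (tau * - x)) = (fun x => expR (- tau * x))) //; apply/funext => x; rewrite mulrN mulNr.
Qed.
End SobolevExistence.

Lemma triple_eq (A B C : Type) (u v : A * B * C) : u.1.1 = v.1.1 -> u.1.2 = v.1.2 -> u.2 = v.2 -> u = v.
Proof. by case: u => [[? ?] ?]; case: v => [[? ?] ?] /= -> -> ->. Qed.

(** * Dilations in a product of three spaces *)

Section ProductSpace.
Variables (R : realType) (Vm V Vp : lmodType R[i]).
Variables (dotm : Vm -> Vm -> R[i]) (dot : V -> V -> R[i]) (dotp : Vp -> Vp -> R[i]).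
Hypotheses (dotmP : inner_product dotm) (dotP : inner_product dot) (dotpP : inner_product dotp).
Local Notation K := (Vm * V * Vp)%type.
Implicit Types u v : K.

(** The abstract form of [dotH], which keeps function spaces out of the dilation argument. *)
Definition dot3 u v : R[i] := dotm u.1.1 v.1.1 + dot u.1.2 v.1.2 + dotp u.2 v.2.

Lemma hnorm3_sqr u : Re (dot3 u u) = hnorm dotm u.1.1 ^+ 2 + hnorm dot u.1.2 ^+ 2 + hnorm dotp u.2 ^+ 2.
Proof. by rewrite /dot3 !cReD (hnorm_sqr dotmP) (hnorm_sqr dotP) (hnorm_sqr dotpP). Qed.

Lemma dot3_inner : inner_product dot3.
Proof.
split.
- move=> a [[xm x] xp] [[ym y] yp] [[zm z] zp]; rewrite /dot3 /=.
  by rewrite (dot_linear dotmP) (dot_linear dotP) (dot_linear dotpP); ring.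
- move=> u v; rewrite /dot3 !cJD.
  by rewrite -(dot_conj dotmP) -(dot_conj dotP) -(dot_conj dotpP).
- by move=> u; rewrite hnorm3_sqr !addr_ge0 ?sqr_ge0.
- move=> [[xm x] xp]; rewrite hnorm3_sqr /= => H.
  have a0 := sqr_ge0 (hnorm dotm xm); have b0 := sqr_ge0 (hnorm dot x); have c0 := sqr_ge0 (hnorm dotp xp).
  have z (t : R) : t ^+ 2 = 0 -> t = 0 by move/eqP; rewrite sqrf_eq0 => /eqP.
  have -> : xm = 0 by apply: (hnorm_eq0 dotmP); apply: z; lra.
  have -> : x = 0 by apply: (hnorm_eq0 dotP); apply: z; lra.
  by have -> : xp = 0 by apply: (hnorm_eq0 dotpP); apply: z; lra.
Qed.

Lemma hnorm3E u : hnorm dot3 u ^+ 2 = hnorm dotm u.1.1 ^+ 2 + hnorm dot u.1.2 ^+ 2 + hnorm dotp u.2 ^+ 2.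
Proof. by rewrite (hnorm_sqr dot3_inner) [LHS]hnorm3_sqr. Qed.

Lemma hnorm3_parts u : [/\ hnorm dotm u.1.1 <= hnorm dot3 u, hnorm dot u.1.2 <= hnorm dot3 u & hnorm dotp u.2 <= hnorm dot3 u].
Proof.
have a0 := sqr_ge0 (hnorm dotm u.1.1); have b0 := sqr_ge0 (hnorm dot u.1.2); have c0 := sqr_ge0 (hnorm dotp u.2).
by split; rewrite -(@ler_pXn2r _ 2) ?nnegrE ?hnorm_ge0 // hnorm3E; lra.
Qed.

Lemma hnorm3_le u : hnorm dot3 u <= hnorm dotm u.1.1 + hnorm dot u.1.2 + hnorm dotp u.2.
Proof.
have a0 := hnorm_ge0 dotm u.1.1; have b0 := hnorm_ge0 dot u.1.2; have c0 := hnorm_ge0 dotp u.2.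
by rewrite -(@ler_pXn2r _ 2) ?nnegrE ?hnorm_ge0 ?addr_ge0 // hnorm3E; nra.
Qed.

Lemma dot3_complete : norm_complete dotm -> norm_complete dot -> norm_complete dotp -> norm_complete dot3.
Proof.
move=> cm c cp u cau.
have part (W : lmodType R[i]) (d : W -> W -> R[i]) (pr : K -> W) :
    (forall x y, hnorm d (pr x - pr y) <= hnorm dot3 (x - y)) -> norm_complete d ->
    exists l, forall e : R, 0 < e -> exists N, forall n, (N <= n)%N -> hnorm d (pr (u n) - l) < e.
  move=> Hle; apply => e /cau[N HN]; exists N => m n Nm Nn.
  exact: le_lt_trans (Hle _ _) (HN m n Nm Nn).
have [lm Hm] := part _ dotm (fun x => x.1.1) (fun x y => let: And3 h _ _ := hnorm3_parts (x - y) in h) cm.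
have [l Hl] := part _ dot (fun x => x.1.2) (fun x y => let: And3 _ h _ := hnorm3_parts (x - y) in h) c.
have [lp Hp] := part _ dotp (fun x => x.2) (fun x y => let: And3 _ _ h := hnorm3_parts (x - y) in h) cp.
exists (lm, l, lp) => e e0; have e3 : 0 < e / 3 by rewrite divr_gt0.
have [N1 H1] := Hm _ e3; have [N2 H2] := Hl _ e3; have [N3 H3] := Hp _ e3.
exists (maxn N1 (maxn N2 N3)) => n; rewrite !geq_max => /andP[/H1 h1 /andP[/H2 h2 /H3 h3]].
by apply: le_lt_trans (hnorm3_le _) _; rewrite /=; lra.
Qed.
End ProductSpace.

Section Dilation.
Variables (R : realType) (Vm V Vp : lmodType R[i]).
Variables (dotm : Vm -> Vm -> R[i]) (dot : V -> V -> R[i]) (dotp : Vp -> Vp -> R[i]).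
Hypotheses (dotmP : inner_product dotm) (dotP : inner_product dot) (dotpP : inner_product dotp).
Hypotheses (dotm_complete : norm_complete dotm) (dot_complete : norm_complete dot)
  (dotp_complete : norm_complete dotp).
Local Notation K := (Vm * V * Vp)%type.
Local Notation dotK := (dot3 dotm dot dotp).
Local Notation normK := (hnorm dotK).
Local Notation norm := (hnorm dot).
Variables (M : K -> K -> Prop) (T : V -> V -> Prop).
Hypothesis M_linear : forall a x x' y y', M x x' -> M y y' -> M (a *: x + y) (a *: x' + y').
Hypothesis M0 : M 0 0.
Hypothesis M_fun : forall x', M 0 x' -> x' = 0.
Hypothesis M_sym : forall x x' y y', M x x' -> M y y' -> dotK x' y = dotK x y'.
Hypothesis M_onto : forall (s : R) z, s != 0 -> exists x x', M x x' /\ x - ('i%C * s%:C) *: x' = z.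
Hypothesis M_dissipative_m : forall x x', M x x' -> 0 <= Im (dotm x'.1.1 x.1.1).
Hypothesis M_dissipative : forall x x', M x x' -> 0 <= Im (dotm x'.1.1 x.1.1 + dot x'.1.2 x.1.2).
Hypothesis T_lift : forall y z, T y z -> exists e e', M (0, y, e) (0, z, e').
Hypothesis T_onto : forall z, exists y y', T y y' /\ y - 'i%C *: y' = z.

Let KP : inner_product dotK. Proof. exact: dot3_inner. Qed.
Let KC : norm_complete dotK. Proof. exact: dot3_complete. Qed.

Definition middle (x : K) : V := x.1.2.
Definition embed (y : V) : K := (0, y, 0).

Lemma product_dilation : selfadjoint_dilation dot dotK middle embed M T.
Proof.
have [U0 HU0] := stone_group KP KC M_linear M0 M_fun M_sym M_onto.
(* The default value of [exp_i] is ruled out by the existence of one group. *)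
have HU : is_exp_group dotK M (exp_i dotK M).
  suff : [set U | is_exp_group dotK M U] (exp_i dotK M) by [].
  by rewrite /exp_i; apply: xgetPex; exists U0.
rewrite /selfadjoint_dilation; move: (exp_i dotK M) HU => U HU {U0 HU0}.
have [[Uu U0 Uadd Ucont] Ugen] := HU.
have Ulin s : forall a x y, U s (a *: x + y) = a *: U s x + U s y by case: (Uu s).
have UD s x y : U s (x + y) = U s x + U s y by have := Ulin s 1 x y; rewrite !scale1r.
have Unorm s x : normK (U s x) = normK x by rewrite /hnorm; case: (Uu s) => _ ->.
have mid_le x : norm (middle x) <= normK x by case: (hnorm3_parts dotmP dotP dotpP x).
have embed_norm y : normK (embed y) = norm y.
  apply/eqP; rewrite -(@eqrXn2 _ 2) ?hnorm_ge0 // (hnorm3E dotmP dotP dotpP) /=.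
  by rewrite (hnorm_zero dotmP) (hnorm_zero dotpP) expr0n /= add0r addr0.
have keep_m t y : 0 <= t -> (U t (embed y)).1.1 = 0.
  move=> t0; pose Q (x : K) : K := (x.1.1, 0, 0).
  have Qn x : normK (Q x) = hnorm dotm x.1.1.
    apply/eqP; rewrite -(@eqrXn2 _ 2) ?hnorm_ge0 // (hnorm3E dotmP dotP dotpP) /=.
    by rewrite (hnorm_zero dotP) (hnorm_zero dotpP) expr0n /= !addr0.
  apply: (hnorm_eq0 dotmP); apply/le_anti; rewrite hnorm_ge0 andbT -Qn -(hnorm_zero dotmP).
  rewrite -[leRHS](Qn (embed y)); apply: (exp_group_decay KP KC M_linear M0 M_fun M_sym M_onto _ HU) => //.
  - by move=> a u v; apply: triple_eq; rewrite /= ?scaler0 ?addr0.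
  - by move=> x; rewrite Qn; case: (hnorm3_parts dotmP dotP dotpP x).
  - move=> x x' Mx; rewrite /dot3 /= (dot0l dotP) (dot0l dotpP) !addr0.
    exact: M_dissipative_m.
have keep_p t (x : K) : 0 <= t -> x.1 = 0 -> (U t x).1 = 0.
  move=> t0 x0; pose Q (x : K) : K := (x.1, 0).
  suff : Q (U t x) = 0 by move=> [].
  apply: (hnorm_eq0 KP); apply/le_anti; rewrite hnorm_ge0 andbT.
  have -> : 0 = normK (Q x) by rewrite /Q x0 (hnorm_zero KP).
  apply: (exp_group_decay KP KC M_linear M0 M_fun M_sym M_onto _ HU) => //.
  - by move=> a u v; apply: triple_eq; rewrite /= ?scaler0 ?addr0.
  - move=> u; rewrite -(@ler_pXn2r _ 2) ?nnegrE ?hnorm_ge0 // !(hnorm3E dotmP dotP dotpP) /=.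
    by rewrite (hnorm_zero dotpP) expr0n /= lerD2l sqr_ge0.
  - move=> u u' Mu; rewrite /dot3 /= (dot0l dotpP) !addr0.
    exact: M_dissipative.
pose Z s y := middle (U s (embed y)).
have midU t (x : K) : 0 <= t -> x.1.1 = 0 -> middle (U t x) = Z t x.1.2.
  (* The second part stays in the third summand for positive times, so it never reaches the middle
     one. *)
  move=> t0 x0; have xE : x = embed x.1.2 + (0, 0, x.2).
    by apply: triple_eq; rewrite /= ?addr0 ?add0r.
  by rewrite {1}xE UD /middle /= (keep_p _ (0, 0, x.2)) // addr0.
have Zlin s : is_linear (Z s).
  move=> a x y; rewrite /Z (_ : embed (a *: x + y) = a *: embed x + embed y) ?Ulin //.
  by apply: triple_eq; rewrite /= ?scaler0 ?addr0.
have ZB s x y : Z s (x - y) = Z s x - Z s y.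
  by rewrite addrC -scaleN1r Zlin scaleN1r addrC.
have Zle s x : norm (Z s x) <= norm x by rewrite -(embed_norm x) -(Unorm s); exact: mid_le.
have Z0 x : Z 0 x = x by rewrite /Z U0.
split.
- exact: stone_selfadjoint.
- split; [by move=> s _; exact: Zlin|by move=> s x _; exact: Zle|exact: Z0| |].
  + move=> s t x s0 t0; rewrite -[RHS]/(Z s (U t (embed x)).1.2) -midU ?keep_m //.
    by rewrite -Uadd.
  + move=> s x s0; apply/norm_cvg_within => e e0.
    have [d d0 Hd] := (norm_cvg_nbhs _ _ _ _).1 (Ucont s (embed x)) e e0.
    exists d => // t _ /Hd; apply: le_lt_trans.
    exact: (mid_le (U t (embed x) - U s (embed x))).
have T_gen y z : T y z -> generator dot 0^'+ Z y z.
  move=> /T_lift[w [w' /Ugen/norm_cvg_dnbhs H]]; apply/norm_cvg_right => e /H[d d0 Hd].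
  exists d => // t t0 td; have {Hd} := Hd t; rewrite gt_eqF // gtr0_norm // => /(_ isT td).
  apply: le_lt_trans; have := mid_le (('i%C * t%:C)^-1 *: (U t (0, y, w) - (0, y, w)) - (0, z, w')).
  rewrite /middle /= -[(U t _).1.2]/(middle _) midU //; exact: ltW.
move=> y y'; split; first exact: T_gen.
have gen_linear b b' c c' : generator dot 0^'+ Z b b' -> generator dot 0^'+ Z c c' ->
    generator dot 0^'+ Z (b - c) (b' - c').
  move=> /norm_cvg_right gb /norm_cvg_right gc; apply/norm_cvg_right => e e0.
  have e2 : 0 < e / 2 by rewrite divr_gt0.
  have [d1 d10 H1] := gb _ e2; have [d2 d20 H2] := gc _ e2.
  exists (Num.min d1 d2); first by rewrite lt_min d10.
  move=> t t0; rewrite lt_min => /andP[/(H1 t t0) h1 /(H2 t t0) h2].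
  rewrite ZB (_ : _ - _ = (('i%C * t%:C)^-1 *: (Z t b - b) - b') - (('i%C * t%:C)^-1 *: (Z t c - c) - c')); last by lmod_ring R.
  by apply: le_lt_trans (hnorm_add dotP _ _) _; rewrite (hnorm_opp dotP); lra.
(* Contractivity gives [ip (Z t b - b) b <= 0] for positive [t]; division by [i t] turns this into a
   sign of the imaginary part. *)
have gen_dissipative b b' : generator dot 0^'+ Z b b' -> 0 <= Im (dot b' b).
  move=> /norm_cvg_right gb; rewrite leNgt; apply/negP => neg.
  have n1 : 0 < norm b + 1 by rewrite ltr_pwDr ?hnorm_ge0.
  have n0 : 0 < - Im (dot b' b) by rewrite oppr_gt0.
  have [d d0 Hd] := gb _ (divr_gt0 n0 n1).
  pose t := d / 2; have t0 : 0 < t by rewrite divr_gt0.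
  have td : t < d by rewrite /t; lra.
  have {Hd} := Hd t t0 td; rewrite ltr_pdivlMr //.
  set c := (_)^-1 *: _; have cE : Z t b - b = ('i%C * t%:C) *: c.
    rewrite /c scalerA divff ?scale1r // mulf_neq0 ?i_neq0 //.
    by apply/eqP => /(congr1 (@complex.Re R)) /= /eqP; rewrite gt_eqF.
  have c0 : 0 <= Im (dot c b).
    have : ip dot (Z t b - b) b <= 0.
      rewrite (ipDl dotP) (ipNl dotP) subr_le0 -(hnorm_sqr dotP) expr2.
      by apply: le_trans (cauchy_schwarz dotP _ _) _; rewrite ler_wpM2r ?hnorm_ge0.
    rewrite cE /ip (dotZl dotP) !complexE_parts /= => H.
    by rewrite -(pmulr_rge0 _ t0); lra.
  have kb : Im (dot (c - b') b) <= norm (c - b') * norm b.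
    have -> : Im (dot (c - b') b) = ip dot (c - b') ('i%C *: b).
      by rewrite /ip (dotZr dotP) cReM /=; ring.
    by apply: le_trans (cauchy_schwarz dotP _ _) _; rewrite (hnorm_scale dotP) modulus_i mul1r.
  have := hnorm_ge0 dot (c - b'); rewrite (dotDl dotP) (dotNl dotP) cImD cImN in kb; lra.
(* The generator at [y - v] has value [w' = y' - v'] with [y - v = i w']; dissipativity then reads
   [- |w'|^2 >= 0]. *)
move=> gy; have [v [v' [Tv vE]]] := T_onto (y - 'i%C *: y').
have gw := gen_linear _ _ _ _ gy (T_gen _ _ Tv); have dw := gen_dissipative _ _ gw.
have wE : y - v = 'i%C *: (y' - v').
  rewrite (_ : y - v = (y - 'i%C *: y') - (v - 'i%C *: v') + 'i%C *: (y' - v')); last by lmod_ring R.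
  by rewrite vE subrr add0r.
have w'0 : y' - v' = 0.
  apply: (dot_eq0 dotP); apply/le_anti; rewrite (dot_ge0 dotP) andbT.
  by move: dw; rewrite wE (dotZr dotP) !complexE_parts /=; lra.
have w0 : y - v = 0 by rewrite wE w'0 scaler0.
by move/eqP: w0; rewrite subr_eq0 => /eqP ->; move/eqP: w'0; rewrite subr_eq0 => /eqP ->.
Qed.
End Dilation.

(** * The operator M_h *)

Section DiracDilation.
Variables (R : realType) (q : R) (q01 : 0 < q < 1) (p r : int -> R).
Hypotheses (p_regular : q_regular p) (r_regular : q_regular r).
Variables (h : R[i]) (delta : R).
Hypotheses (h_im : 0 < Im h) (delta_gt0 : 0 < delta) (delta_h : delta ^+ 2 = 2 * Im h).
Local Notation C := R[i].
Local Notation Vm := (L2 `]-oo, (0 : R)]).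
Local Notation Vp := (L2 `[(0 : R), +oo[).
Local Notation V := (Lq2 q01).
Local Notation K := (Vm * V * Vp)%type.
Local Notation dotm := (@dotL2 R `]-oo, (0 : R)]).
Local Notation dotp := (@dotL2 R `[(0 : R), +oo[).
Local Notation dot := (@dotLq2 R q q01).
Local Notation M := (@M_op R q q01 p r h delta).
Local Notation T := (@T_op R q q01 p r h).
Local Notation L := (l1 q p r).

Let dmP : inner_product dotm. Proof. exact: dotL2_inner. Qed.
Let dpP : inner_product dotp. Proof. exact: dotL2_inner. Qed.
Let dP : inner_product dot. Proof. exact: dotLq2_inner. Qed.

Lemma M_opP (u w : K) : M u w <-> exists (phim phip : R -> C) (dm : Vm) (dp : Vp),
  [/\ sobolev phim u.1.1 dm, sobolev phip u.2 dp, L u.1.2 = w.1.2 :> (int -> C * C),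
    y2_0 u.1.2 - h * y1_0 u.1.2 = delta%:C * phim 0 /\
    y2_0 u.1.2 - conjc h * y1_0 u.1.2 = delta%:C * phip 0 & w.1.1 = 'i%C *: dm /\ w.2 = 'i%C *: dp].
Proof.
case: u => [[um y] up]; case: w => [[wm z] wp]; split.
  by move=> [phim [phip [dm [dp [sm sp _ bc [em Ly ep]]]]]]; exists phim, phip, dm, dp.
move=> [phim [phip [dm [dp /= [sm sp Ly bc [em ep]]]]]]; exists phim, phip, dm, dp; split=> //.
exact: (l1_Dmax p_regular r_regular Ly).
Qed.

Lemma M_op_linear (a : C) x x' y y' : M x x' -> M y y' -> M (a *: x + y) (a *: x' + y').
Proof.
move=> /M_opP[fm [fp [dm [dp [sm sp Lx [b1 b2] [em ep]]]]]] /M_opP[gm [gp [em' [ep' [tm tp Ly [c1 c2] [fm' fp']]]]]].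
apply/M_opP; exists (fun t : R => a * fm t + gm t), (fun t : R => a * fp t + gp t), (a *: dm + em'), (a *: dp + ep').
have [e1 e2] := boundary_linear p_regular r_regular a Lx Ly.
split; [exact: sobolev_linear|exact: sobolev_linear|exact: l1_scaleD| |].
- rewrite /= e1 e2; split.
    by rewrite (_ : _ * (a * fm 0 + gm 0) = a * (delta%:C * fm 0) + delta%:C * gm 0); [rewrite -b1 -c1; ring|ring].
  by rewrite (_ : _ * (a * fp 0 + gp 0) = a * (delta%:C * fp 0) + delta%:C * gp 0); [rewrite -b2 -c2; ring|ring].
- by rewrite /= em ep fm' fp'; split; lmod_ring R.
Qed.

Lemma sobolev0 (I : interval R) : sobolev (fun=> 0 : C) (0 : L2 I) 0.
Proof.
have s0 : sqi [set` I] (fun=> 0 : R).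
  by split; [exact: measurable_cst|under eq_integral do rewrite expr0n /=; rewrite integral0].
have r0 : rsob I (fun=> 0 : R) (fun=> 0) (fun=> 0).
  split=> //; [|exact: aeW|by apply: aeW => x _; exact: is_derive_cst].
  by move=> a b _ _ _; apply: (@rac_lipschitz _ 0) => // *; rewrite subrr normr0 mul0r.
have [u1 u2] := L2_sqi (0 : L2 I).
by apply/sobolevP; split; apply: (rsob_ae r0) => //; apply: aeI1 (repr0 I) => x _ ->.
Qed.

Lemma M_op0 : M 0 0.
Proof.
have /(T_opP p_regular r_regular)[L0 _] := T_op0 q01 p_regular r_regular h.
apply/M_opP; exists (fun=> 0), (fun=> 0), 0, 0; split; try exact: sobolev0; rewrite /= ?scaler0 //.
by rewrite /y1_0 /y2_0 !(ccvg_at_zero (ccvg_cst 0)) !mulr0 subr0.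
Qed.

Lemma M_op_fun x' : M 0 x' -> x' = 0.
Proof.
move=> /M_opP[fm [fp [dm [dp [sm sp Lx _ [em ep]]]]]].
have [_ dm0] := sobolev_zero_neg sm; have [_ dp0] := sobolev_zero_pos sp.
have /(T_opP p_regular r_regular)[L0 _] := T_op0 q01 p_regular r_regular h.
apply: triple_eq => /=; rewrite ?em ?ep ?dm0 ?dp0 ?scaler0 //.
by apply: val_inj; exact: etrans (esym Lx) L0.
Qed.

Let delta_neq0 : delta%:C != 0 :> C.
Proof. by apply/eqP => /(congr1 (@complex.Re R)) /= /eqP; rewrite gt_eqF. Qed.

(** The coupling constant enters the symmetry of [M_h] in this form. *)
Let delta_hC : 'i%C * (h - conjc h) = - delta%:C ^+ 2.
Proof.
apply: complex_eq; rewrite expr2 !complexE_parts /=; last by ring.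
by have := delta_h; rewrite expr2; lra.
Qed.

Lemma M_op_sym x x' y y' : M x x' -> M y y' -> dot3 dotm dot dotp x' y = dot3 dotm dot dotp x y'.
Proof.
move=> /M_opP[fm [fp [dm [dp [sm sp Lx [b1 b2] [em ep]]]]]] /M_opP[gm [gp [em' [ep' [tm tp Ly [c1 c2] [fm' fp']]]]]].
have g0 := green0 p_regular r_regular Lx Ly.
have pm := sobolev_parts_neg sm tm; have pp := sobolev_parts_pos sp tp.
rewrite /dot3 em ep fm' fp' (dotZl dmP) (dotZl dpP) (dotZr dmP) (dotZr dpP).
have -> : conjc 'i%C = - 'i%C :> C by apply: complex_eq; rewrite /= ?oppr0.
apply/eqP; rewrite -subr_eq0; apply/eqP.
set A := dotm dm _ in pm *; set B := dotm _ em' in pm *; set A' := dotp dp _ in pp *; set B' := dotp _ ep' in pp *.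
set G := dot x'.1.2 _ in g0 *; set G' := dot _ y'.1.2 in g0 *.
rewrite (_ : _ - _ = 'i%C * (A + B) + (G - G') + 'i%C * (A' + B')); last by ring.
(* Multiplying by [delta ^ 2] lets the boundary conditions replace every value of the half-line
   functions at zero by boundary values of the lattice functions. *)
rewrite pm pp g0; apply: (mulfI (mulf_neq0 delta_neq0 delta_neq0)); rewrite mulr0.
have cd1 := congr1 conjc c1; have cd2 := congr1 conjc c2.
rewrite !conjE in cd1 cd2.
set a1 := y1_0 x.1.2 in b1 b2 *; set a2 := y2_0 x.1.2 in b1 b2 *.
set z1 := conjc (y1_0 y.1.2) in cd1 cd2 *; set z2 := conjc (y2_0 y.1.2) in cd1 cd2 *.
transitivity ('i%C * ((delta%:C * fm 0) * (delta%:C * conjc (gm 0))) + delta%:C ^+ 2 * (z1 * a2 - a1 * z2)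
  - 'i%C * ((delta%:C * fp 0) * (delta%:C * conjc (gp 0)))); first by ring.
rewrite -b1 -b2 -cd1 -cd2.
transitivity (('i%C * (h - conjc h) + delta%:C ^+ 2) * (z1 * a2 - a1 * z2)); first by ring.
by rewrite delta_hC addNr mul0r.
Qed.

Lemma M_op_dissipative_m x x' : M x x' -> 0 <= Im (dotm x'.1.1 x.1.1).
Proof.
move=> /M_opP[fm [fp [dm [dp [sm sp Lx [b1 b2] [em ep]]]]]].
have := congr1 (@complex.Re R) (sobolev_parts_neg sm sm).
rewrite cReD (dot_conj dmP dm) cReJ em (dotZl dmP) !complexE_parts /=.
by have := sqr_ge0 (Re (fm 0)); have := sqr_ge0 (Im (fm 0)); rewrite !expr2; lra.
Qed.

(** Symmetry makes the full form real, so the first two summands contribute the opposite of the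
    third, which integration by parts evaluates. *)
Lemma M_op_dissipative x x' : M x x' -> 0 <= Im (dotm x'.1.1 x.1.1 + dot x'.1.2 x.1.2).
Proof.
move=> Mx; have := congr1 (@complex.Im R) (M_op_sym Mx Mx).
rewrite (dot_conj (dot3_inner dmP dP dpP) x' x) cImJ => H0.
have -> : Im (dotm x'.1.1 x.1.1 + dot x'.1.2 x.1.2) = - Im (dotp x'.2 x.2).
  have : Im (dot3 dotm dot dotp x' x) = 0 by lra.
  by rewrite /dot3 cImD; lra.
move: Mx => /M_opP[fm [fp [dm [dp [sm sp Lx [b1 b2] [em ep]]]]]].
have := congr1 (@complex.Re R) (sobolev_parts_pos sp sp).
rewrite cReD (dot_conj dpP dp) cReJ ep (dotZl dpP) !complexE_parts /=.
by have := sqr_ge0 (Re (fp 0)); have := sqr_ge0 (Im (fp 0)); rewrite !expr2; lra.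
Qed.

Lemma T_op_lift y z : T y z -> exists e e', M (0, y, e) (0, z, e').
Proof.
move=> /(T_opP p_regular r_regular)[Ly by_].
have [ph [e [se ph0]]] := @sobolev_exp_pos R 1 ltr01.
(* The value at zero demanded by the second boundary condition; the first holds with zero incoming
   part since [y] is in the domain of [T_h]. *)
pose k := (y2_0 y - conjc h * y1_0 y) / delta%:C.
have := sobolev_linear k se (sobolev0 _); rewrite addr0 => sk.
exists (k *: e), ('i%C *: (k *: (- 1%:C *: e) + 0)); apply/M_opP.
exists (fun=> 0), (fun x => k * ph x + 0), 0, (k *: (- 1%:C *: e) + 0); split=> //=; first exact: sobolev0.
  split; first by rewrite by_ subrr mulr0.
  by rewrite ph0 mulr1 addr0 /k [RHS]mulrC divfK.
by rewrite scaler0.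
Qed.

Lemma T_op_onto z : exists y y', T y y' /\ y - 'i%C *: y' = z.
Proof.
have h1 : 0 < 1 * Im h by rewrite mul1r.
have [y [w [Ly wE bc]]] := lattice_onto p_regular r_regular h1 z 0.
exists y, w; split; last by rewrite wE scalerA mulrN mulr1 ii opprK scale1r opprB addrC subrK.
by apply/(T_opP p_regular r_regular); split=> //; move/eqP: bc; rewrite subr_eq0 => /eqP.
Qed.

(** On the half-line where [exp (- tau x)] is square integrable the solution can be adjusted; on the
    other it is kept as found. The kept value at zero prescribes the lattice condition with [h] if
    [tau > 0] and with its conjugate if [tau < 0], each time with the sign needed by [lattice_onto];
    the adjustable side then meets the other condition. *)
Lemma M_op_onto (s : R) z : s != 0 -> exists x x', M x x' /\ x - ('i%C * s%:C) *: x' = z.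
Proof.
move=> s0; case: z => [[fm g] fp]; pose tau := s^-1; have tau0 : tau != 0 by rewrite invr_eq0.
have st : s%:C * tau%:C = 1 :> C by rewrite -rmorphM divff ?rmorph1.
have finish (ph1 ph2 : R -> C) (u : Vm) (v : Vp) (y w : V) :
    sobolev ph1 u (- tau%:C *: (u - fm)) -> sobolev ph2 v (- tau%:C *: (v - fp)) ->
    L y = w :> (int -> C * C) -> w = - ('i%C * tau%:C) *: (y - g) ->
    y2_0 y - h * y1_0 y = delta%:C * ph1 0 -> y2_0 y - conjc h * y1_0 y = delta%:C * ph2 0 ->
    exists x x', M x x' /\ x - ('i%C * s%:C) *: x' = (fm, g, fp).
  move=> su sv Ly wE b1 b2; exists (u, y, v), ('i%C *: (- tau%:C *: (u - fm)), w, 'i%C *: (- tau%:C *: (v - fp))).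
  split; first by apply/M_opP; exists ph1, ph2, (- tau%:C *: (u - fm)), (- tau%:C *: (v - fp)).
  have sc (W : lmodType C) (a b : W) : a - ('i%C * s%:C) *: (- ('i%C * tau%:C) *: (a - b)) = b.
    rewrite scalerA mulrN mulrACA ii st mulr1 opprK scale1r opprB; exact: subrKC.
  have sc' (W : lmodType C) (a b : W) : a - ('i%C * s%:C) *: ('i%C *: (- tau%:C *: (a - b))) = b.
    by rewrite (scalerA 'i%C) mulrN sc.
  by apply: triple_eq; rewrite /= ?sc' // wE sc.
have [ph1 [u su]] := @sobolev_solution _ _ tau fm tau0.
have [ph2 [v sv]] := @sobolev_solution _ _ tau fp tau0.
have adjust (I : interval R) (ph e : R -> C) (a b f : L2 I) (k : C) : sobolev ph a (- tau%:C *: (a - f)) ->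
    sobolev e b (- tau%:C *: b) -> sobolev (fun x => k * e x + ph x) (k *: b + a) (- tau%:C *: (k *: b + a - f)).
  move=> sa sb; rewrite (_ : - tau%:C *: _ = k *: (- tau%:C *: b) + - tau%:C *: (a - f)); last by lmod_ring R.
  exact: sobolev_linear.
move: tau0; rewrite neq_lt => /orP[t0|t0].
  have th : 0 < tau * Im (conjc h) by rewrite cImJ mulrN -mulNr mulr_gt0 ?oppr_gt0.
  have [y [w [Ly wE bc]]] := lattice_onto p_regular r_regular th g (delta%:C * ph2 0).
  have [e [b [sb e0]]] := sobolev_exp_neg t0.
  pose k := (y2_0 y - h * y1_0 y) / delta%:C - ph1 0.
  apply: finish (adjust _ _ _ _ _ _ k su sb) sv Ly wE _ bc.
  by rewrite e0 mulr1 /k subrK [RHS]mulrC divfK.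
have th : 0 < tau * Im h by rewrite mulr_gt0.
have [y [w [Ly wE bc]]] := lattice_onto p_regular r_regular th g (delta%:C * ph1 0).
have [e [b [sb e0]]] := sobolev_exp_pos t0.
pose k := (y2_0 y - conjc h * y1_0 y) / delta%:C - ph2 0.
apply: finish su (adjust _ _ _ _ _ _ k sv sb) Ly wE bc _.
by rewrite e0 mulr1 /k subrK [RHS]mulrC divfK.
Qed.
End DiracDilation.

Theorem theorem4 (R : realType) (q : R) (q01 : 0 < q < 1)
  (p r : int -> R) (p_regular : q_regular p) (r_regular : q_regular r)
  (p_neq0 : forall n, p n <> 0) (r_neq0 : forall n, r n <> 0)
  (h : R[i]) (h_im : 0 < complex.Im h)
  (delta : R) (delta_gt0 : 0 < delta)
  (delta_h : delta ^+ 2 = 2 * complex.Im h) :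
  selfadjoint_dilation (@dotLq2 R q q01) (@dotH R q q01)
    (@P1 R q q01) (@P2 R q q01) (M_op p r h delta) (T_op p r h).
Proof.
apply: (product_dilation (dotL2_inner _) (dotLq2_inner q01) (dotL2_inner _)
  (@L2_complete R _) (@Lq2_complete R q q01) (@L2_complete R _)).
- exact: M_op_linear.
- exact: M_op0.
- exact: M_op_fun.
- exact: M_op_sym.
- exact: M_op_onto.
- exact: M_op_dissipative_m.
- exact: M_op_dissipative.
- exact: T_op_lift.
- exact: T_op_onto.
Qed.
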